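(* For $p\ge1$ let $\Delta_p$ be the convex hull of $(0,0),(p,0),(p,1),(0,1)$ in the $(\mu_1,\mu_2)$-plane, and consider the corresponding toric Kähler surface $\mathbf{CP}^1\times\mathbf{CP}^1$ with moment map image $\Delta_p$. Consider affine functions $f=a\mu_1+b\mu_2+c$ that are positive on $\Delta_p$ and normalized by $b+pa+2c=1$. If $1\le p\le2$, then the cKEM-Futaki invariant of $f$ vanishes only when $(a,b)=(0,0)$. If $p>2$, then the cKEM-Futaki invariant of $f$ vanishes when $(a,b)=(0,0)$ and when $(a,b)=\left(\pm\frac{\sqrt{p-2}}{p^{3/2}},0\right)$.
   Context: Let $M=\mathbf{CP}^1\times\mathbf{CP}^1$ with its standard complex structure and $T^2$-action, and let $\Omega_p$ be the Kähler class whose $T^2$-invariant Kähler forms have moment map image $\Delta_p$, with coordinates $(\mu_1,\mu_2)$ given by the moment map. Given a $T^2$-invariant Kähler metric $g$ in $\Omega_p$ with Kähler form $\omega$, an affine function $f=a\mu_1+b\mu_2+c$ on $\Delta_p$ is regarded as a function on $M$ by pulling back along the moment map; it is then the Hamiltonian function of a Killing vector field in $\mathrm{Lie}(T^2)$. It is positive on $\Delta_p$ if and only if $c,\ pa+c,\ pa+b+c,\ b+c>0$. For such $f$, the cKEM-Futaki invariant of $f$ is the linear function $\mathrm{Lie}(T^2)\to\mathbf R$, $$H\mapsto\int_M\frac{s_{\tilde g}-c_f}{f^{5}}\,f_H\,\frac{\omega^2}{2},\qquad \tilde g=f^{-2}g,\qquad c_f=\frac{\int_M s_{\tilde g}f^{-5}\omega^2}{\int_M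 f^{-5}\omega^2},$$ where $s_{\tilde g}$ is the scalar curvature of $\tilde g$ and $f_H$ is any Hamiltonian function of $H$ with respect to $\omega$; it is independent of the $T^2$-invariant $g\in\Omega_p$ and of the additive constant in $f_H$. It ''vanishes'' when it is identically zero on $\mathrm{Lie}(T^2)$. Its vanishing is unaffected by multiplying $f$ by a positive constant, which is why the normalization $b+pa+2c=1$ (so $c=(1-b-pa)/2$) is imposed. *)

(* Defs.v *)
From HB Require Import structures.
From mathcomp Require Import all_boot all_order all_algebra.
From mathcomp Require Import all_classical all_reals all_analysis.

Set Implicit Arguments.
Unset Strict Implicit.
Unset Printing Implicit Defensive.

Import Order.TTheory GRing.Theory Num.Theory.
Import numFieldNormedType.Exports.

Local Open Scope classical_set_scope.
Local Open Scope ring_scope.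

(* Tangent vectors are row vectors, so a bilinear form B takes the value      *)
(* (u *m B *m v^T) 0 0 on (u, v), and a linear map acts by right              *)
(* multiplication; this is also the convention of the Jacobian 'J.            *)

Section RiemannianGeometry.
Context {R : realType} {n : nat}.
Implicit Types (u : 'rV[R]_n -> R) (g : 'rV[R]_n -> 'M[R]_n) (x : 'rV[R]_n).

Definition partial (i : 'I_n) u x : R := 'D_(delta_mx 0 i) u x.

Definition smooth u : Prop :=
  forall (s : seq 'I_n) x, differentiable (foldr partial u s) x.

Definition christoffel g (k i j : 'I_n) x : R :=
  2^-1 * \sum_(l < n) invmx (g x) k l *
    (partial i (fun y => g y j l) x + partial j (fun y => g y i l) x
     - partial l (fun y => g y i j) x).

Definition ricci g (j k : 'I_n) x : R :=
  \sum_(i < n) (partial i (christoffel g i j k) x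
                - partial j (christoffel g i i k) x
                + \sum_(m < n)
                    (christoffel g i i m x * christoffel g m j k x
                     - christoffel g i j m x * christoffel g m i k x)).

Definition scalar_curvature g x : R :=
  \sum_(j < n) \sum_(k < n) invmx (g x) j k * ricci g j k x.

Definition conformal_metric u g x : 'M[R]_n := u x ^- 2 *: g x.

Definition pullback (F : 'rV[R]_n -> 'rV[R]_n) g x : 'M[R]_n :=
  'J F x *m g (F x) *m ('J F x)^T.

End RiemannianGeometry.

Section ToricCP1xCP1.
Context {R : realType}.

(* CP^1 x CP^1 is covered by the four affine charts (z1^{+-1}, z2^{+-1}),     *)
(* indexed by pairs of booleans (true = inverted coordinate).  A point of a   *)
(* chart (w1, w2) is (Re w1, Im w1, Re w2, Im w2) in R^4.  The dense open    *)
(* orbit (C \ 0)^2 of the complexified torus has coordinates (y1, t1, y2, t2),*)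
(* where z_j = exp (y_j + i t_j) and t_j is 2 pi-periodic; orbit_chart e      *)
(* expresses its points in the affine chart e.                                *)
Definition chart : Type := (bool * bool)%type.

Definition std_chart : chart := (false, false).

Definition orbit_chart (e : chart) (x : 'rV[R]_4) : 'rV[R]_4 :=
  let s1 : R := (-1) ^+ e.1 in
  let s2 : R := (-1) ^+ e.2 in
  let y1 := x 0 (inord 0) in let t1 := x 0 (inord 1) in
  let y2 := x 0 (inord 2) in let t2 := x 0 (inord 3) in
  \row_(i < 4) [:: expR (s1 * y1) * cos (s1 * t1);
                   expR (s1 * y1) * sin (s1 * t1);
                   expR (s2 * y2) * cos (s2 * t2);
                   expR (s2 * y2) * sin (s2 * t2)]`_i.

(* The complex structure e0 |-> e1, e1 |-> - e0, e2 |-> e3, e3 |-> - e2, in   *)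
(* each affine chart as well as in the coordinates (y1, t1, y2, t2), since    *)
(* all the coordinate changes are holomorphic.                                *)
Definition Jmx : 'M[R]_4 :=
  \matrix_(i, j) ((~~ odd i && (j == i.+1 :> nat))%:R
                  - (odd i && (i == j.+1 :> nat))%:R).

(* omega (u, v) = g (J u, v) *)
Definition fundamental_form (g : 'rV[R]_4 -> 'M[R]_4) (x : 'rV[R]_4) : 'M[R]_4 :=
  Jmx *m g x.

(* The vector field h_1 d/dt1 + h_2 d/dt2 of h in Lie(T^2) = R^2; since it is *)
(* constant, it is also the translation by which exp h acts on the orbit.     *)
Definition torus_field (h : 'rV[R]_2) : 'rV[R]_4 :=
  \row_(i < 4) [:: 0; h 0 0; 0; h 0 1]`_i.

(* Two pieces of data on overlapping charts agree as soon as they agree on    *)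
(* the open orbit, which is dense.                                            *)
Definition orbit_metric (G : chart -> 'rV[R]_4 -> 'M[R]_4) :
    'rV[R]_4 -> 'M[R]_4 :=
  pullback (orbit_chart std_chart) (G std_chart).

Definition orbit_fun (u : chart -> 'rV[R]_4 -> R) : 'rV[R]_4 -> R :=
  u std_chart \o orbit_chart std_chart.

Record smooth_function (u : chart -> 'rV[R]_4 -> R) : Prop := {
  sf_smooth : forall e, smooth (u e) ;
  sf_compat : forall e x, u e (orbit_chart e x) = orbit_fun u x }.

Record toric_kahler_metric (G : chart -> 'rV[R]_4 -> 'M[R]_4) : Prop := {
  tk_smooth : forall e i j, smooth (fun x => G e x i j) ;
  tk_compat : forall e x, pullback (orbit_chart e) (G e) x = orbit_metric G x ;
  tk_sym : forall e x, (G e x)^T = G e x ;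
  tk_pos : forall e x (v : 'rV[R]_4), v != 0 -> 0 < (v *m G e x *m v^T) 0 0 ;
  tk_hermitian : forall e x, Jmx *m G e x *m Jmx^T = G e x ;
  tk_closed : forall e i j k x,
    partial i (fun y => fundamental_form (G e) y j k) x
    + partial j (fun y => fundamental_form (G e) y k i) x
    + partial k (fun y => fundamental_form (G e) y i j) x = 0 ;
  tk_invariant : forall (h : 'rV[R]_2) x,
    orbit_metric G (x + torus_field h) = orbit_metric G x }.

(* du = omega (., h); with this sign, the moment map coordinate mu_j          *)
(* increases with |z_j|.                                                      *)
Definition hamiltonian (g : 'rV[R]_4 -> 'M[R]_4) (h : 'rV[R]_2)
    (u : 'rV[R]_4 -> R) : Prop :=
  forall x v : 'rV[R]_4,
    is_derive x v u ((v *m fundamental_form g x *m (torus_field h)^T) 0 0).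

Record moment_map (G : chart -> 'rV[R]_4 -> 'M[R]_4)
    (mu : 'I_2 -> chart -> 'rV[R]_4 -> R) : Prop := {
  mm_smooth : forall j, smooth_function (mu j) ;
  mm_hamiltonian : forall j,
    hamiltonian (orbit_metric G) (delta_mx 0 j) (orbit_fun (mu j)) }.

Definition moment_image (mu : 'I_2 -> chart -> 'rV[R]_4 -> R) : set 'rV[R]_2 :=
  [set q | exists e x, q = \row_(j < 2) mu j e x].

Definition convex_hull (s : seq 'rV[R]_2) : set 'rV[R]_2 :=
  [set q | exists t : 'I_(size s) -> R,
    [/\ forall i, 0 <= t i, \sum_i t i = 1 & q = \sum_i t i *: s`_i]].

Definition vec2 (x y : R) : 'rV[R]_2 := \row_(j < 2) [:: x; y]`_j.

Definition Delta (p : R) : set 'rV[R]_2 :=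
  convex_hull [:: vec2 0 0; vec2 p 0; vec2 p 1; vec2 0 1].

Definition affine_fun (a b c : R) (q : 'rV[R]_2) : R :=
  a * q 0 0 + b * q 0 1 + c.

(* omega^2 / 2 = omega /\ omega / 2 as a multiple of dy1 dt1 dy2 dt2 *)
Definition half_omega_sq (g : 'rV[R]_4 -> 'M[R]_4) (x : 'rV[R]_4) : R :=
  let w i j := fundamental_form g x (inord i) (inord j) in
  w 0%N 1%N * w 2%N 3%N - w 0%N 2%N * w 1%N 3%N + w 0%N 3%N * w 1%N 2%N.

(* The integral of F omega^2 / 2 over CP^1 x CP^1, computed as an iterated     *)
(* Lebesgue integral on the open orbit, whose complement has measure zero.    *)
Definition integral_M (g : 'rV[R]_4 -> 'M[R]_4) (F : 'rV[R]_4 -> R) : R :=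
  \int[lebesgue_measure]_(y1 in [set: R]) \int[lebesgue_measure]_(y2 in [set: R])
  \int[lebesgue_measure]_(t1 in `[0, 2 * pi]) \int[lebesgue_measure]_(t2 in `[0, 2 * pi])
    (let x := \row_(i < 4) [:: y1; t1; y2; t2]`_i in
     F x * half_omega_sq g x).

(* Numerator and denominator both carry omega^2 / 2 in place of omega^2. *)
Definition mean_curvature_const (g : 'rV[R]_4 -> 'M[R]_4)
    (f : 'rV[R]_4 -> R) : R :=
  integral_M g
    (fun x => scalar_curvature (conformal_metric f g) x * f x ^- 5)
  / integral_M g (fun x => f x ^- 5).

Definition ckem_futaki (g : 'rV[R]_4 -> 'M[R]_4) (f u : 'rV[R]_4 -> R) : R :=
  integral_M g
    (fun x => (scalar_curvature (conformal_metric f g) x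
               - mean_curvature_const g f) / f x ^+ 5 * u x).

Definition ckem_futaki_vanishes (G : chart -> 'rV[R]_4 -> 'M[R]_4)
    (mu : 'I_2 -> chart -> 'rV[R]_4 -> R) (a b c : R) : Prop :=
  let g := orbit_metric G in
  let f x := affine_fun a b c (\row_(j < 2) orbit_fun (mu j) x) in
  forall (h : 'rV[R]_2) (u : 'rV[R]_4 -> R),
    hamiltonian g h u -> ckem_futaki g f u = 0.

(* f = a mu_1 + b mu_2 + c is positive on Delta p and normalized *)
Definition admissible (p a b c : R) : Prop :=
  (forall q, Delta p q -> 0 < affine_fun a b c q) /\ b + p * a + 2 * c = 1.

End ToricCP1xCP1.

(* Main.v *)
(* On the open orbit, with z_j = exp (y_j + i t_j), an invariant Kahler metric  *)
(* is the Hessian H = (d mu_j / d y_i) of the Kahler potential tensored with   *)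
(* the identity of R^2, so everything depends on (y1, y2) only.  For affine l  *)
(* and f, with f positive, both l f^-5 det H and s f^-5 l det H (s the scalar  *)
(* curvature of f^-2 g) are divergences in (y1, y2) of fields that decay       *)
(* exponentially, because they are smooth in the charts.  The divergence       *)
(* theorem then turns the two integrals into explicit rational functions of    *)
(* the values of f at the four vertices of Delta_p: the first is an integral   *)
(* over Delta_p, the second twice the integral of l f^-3 over its boundary.    *)
(* Testing with l = f, and writing x = p a, X = x^2, Y = b^2, u = 1 - X - Y,   *)
(* the invariant is a negative multiple of                                     *)
(*   u ((2 - p) X + (2 p - 1) Y) + 2 X^2 + 2 p Y^2,                            *)
(* where u > 0 by positivity of f.  If p <= 2 this vanishes only for X = Y = 0.*)
(* If b = 0 it is X (2 - p + p X), and by the symmetry mu_2 -> 1 - mu_2 (and   *)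
(* mu_1 -> p - mu_1 when a = 0) no other test function is needed.              *)

Require Import Defs.
From HB Require Import structures.
From mathcomp Require Import all_boot all_order all_algebra.
From mathcomp Require Import all_classical all_reals all_analysis.
From mathcomp Require Import measurable_realfun ring lra.
Import Order.TTheory GRing.Theory Num.Theory.
Import numFieldNormedType.Exports.
Local Open Scope classical_set_scope.
Local Open Scope ring_scope.
Set Implicit Arguments.
Unset Strict Implicit.
Unset Printing Implicit Defensive.

(** * Functions of class C^n of two variables *)

(** In the logarithmic coordinates z_j = exp (y_j + i t_j) of the open orbit an invariant Kahler
    metric is H tensored with the identity of R^2, where the symmetric matrix H depends on (y1, y2)
    only and is the Jacobian of the moment map ([orbit_metric_met], [orbit_mu_der]). The invariant
    therefore reduces to plane integrals. Let S l and V l be the integrals of s f^-5 l det H and of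
    f^-5 l det H, with s the scalar curvature of f^-2 g. For the Hamiltonian l the invariant
    vanishes exactly when S l V 1 = S 1 V l, that is when [futaki_det] is zero at l
    ([futaki_vanishing], [ckem_futaki_vanishesE]).

    Both integrals are fluxes that depend on the vertices of the polytope only. For V, det H dy1 dy2
    is the pullback of d mu_1 d mu_2, and Stokes' theorem is applied to the pullback of E d mu_2
    ([volume_integral]). For S, the conformal change formula together with s(g) = - tr (H^-1 Hess
    log det H) exhibits s f^-5 l det H as the divergence of an explicit field
    ([scalar_curvature_conformal], [scal_divergence]). In each chart det H is r1^2 r2^2 times a
    nowhere zero smooth function, so log det H has y_j-derivative tending to 2 or -2 at the edges,
    and the flux is twice the boundary integral of l f^-3 ([curvature_integral]). Convergence and
    the limits come from the charts: every orbit point has both radii at most 1 in one of the four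
    charts, where all fields are bounded on the unit square ([charted_tame], [flux1_int2]). The
    moment image being the rectangle fixes the values of mu_1 and mu_2 on the edges ([moment_edge1],
    [moment_edge2]).

    Testing with l = f gives the closed formula [futaki_det_f]. Positivity of f at the vertices
    gives (p a)^2 + b^2 < 1, and for 1 <= p <= 2 every term of the bracket is then nonnegative, so
    that its vanishing forces a = b = 0 ([bracket_eq0]). Conversely let b = 0. The functional is
    linear in l, kills 1, kills mu_2 - 1/2 by reflection, and kills f when p (p a)^2 = p - 2; for a
    nonzero these three span the affine functions. For a = 0 the function mu_1 - p/2 replaces f
    ([futaki_det_vanishes]). *)

Section C2.
Context {R : realType}.
Implicit Types (f g : R -> R -> R) (x y s : R) (n : nat).

Definition D1 f x y : R := 'D_1 (f ^~ y) x.
Definition D2 f x y : R := 'D_1 (f x) y.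
Definition cont2 f := continuous (fun z : R * R => f z.1 z.2).

(** Joint continuity is required at every stage: it is what the symmetry of mixed derivatives and
    the bounds on compact squares rest on. *)
Fixpoint Cn n f : Prop :=
  cont2 f /\
  if n is n'.+1 then
    [/\ forall x y, derivable (f ^~ y) x 1, forall x y, derivable (f x) y 1,
        Cn n' (D1 f) & Cn n' (D2 f)]
  else True.

Arguments Cn : simpl never.

Definition smooth2 f := forall n, Cn n f.

Lemma is_derive_mulr (u v : R -> R) (t du dv : R) :
  is_derive t 1 u du -> is_derive t 1 v dv ->
  is_derive t 1 (fun t => u t * v t) (du * v t + u t * dv).
Proof.
move=> hu hv; have /is_derive_eq := is_deriveM hu hv; apply.
by rewrite addrC /GRing.scale /= [v t * _]mulrC.
Qed.

Lemma is_derive_addr (u v : R -> R) (t du dv : R) :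
  is_derive t 1 u du -> is_derive t 1 v dv ->
  is_derive t 1 (fun t => u t + v t) (du + dv).
Proof. by move=> ? ?; exact: is_deriveD. Qed.

Lemma is_derive_oppr (u : R -> R) (t du : R) :
  is_derive t 1 u du -> is_derive t 1 (fun t => - u t) (- du).
Proof. by move=> ?; exact: is_deriveN. Qed.

Lemma is_derive_constr (c t : R) : is_derive t 1 (fun _ => c) 0.
Proof. exact: is_derive_cst. Qed.

Lemma is_derive_invr (u : R -> R) (t du : R) : u t != 0 ->
  is_derive t 1 u du ->
  is_derive t 1 (fun t => (u t)^-1) (- (du * (u t)^-1 * (u t)^-1)).
Proof.
move=> u0 [d <-]; apply: DeriveDef; first exact: derivableV.
by rewrite deriveV// /GRing.scale /= expr2 invfM; ring.
Qed.

Lemma is_derive_exprn (u : R -> R) (t du : R) (n : nat) :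
  is_derive t 1 u du ->
  is_derive t 1 (fun t => u t ^+ n) (n%:R * u t ^+ n.-1 * du).
Proof. by move=> h; have := is_deriveX n h; rewrite exprfctE. Qed.

(** The change from a chart radius r = exp (s y) to the logarithmic coordinate y: d/dy = s r d/dr.
    The factor r is the source of all exponential decay below. *)
Lemma is_derive_comp_expR (u : R -> R) (t s du : R) :
  is_derive (expR (s * t)) 1 u du ->
  is_derive t 1 (fun t => u (expR (s * t))) (s * expR (s * t) * du).
Proof.
move=> du'.
have h : is_derive t 1 (fun t => s * t) s.
  have := is_derive_mulr (is_derive_constr s t) (is_derive_id t (1 : R)).
  by rewrite mul0r add0r mulr1.
have h2 : is_derive t 1 (expR \o (fun t => s * t)) (s * expR (s * t)).
  by rewrite [X in is_derive _ _ _ X]mulrC; exact: is_derive1_comp.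
by rewrite mulrC; exact: (is_derive1_comp (g := expR \o (fun t => s * t)) du' h2).
Qed.

Lemma is_derive_cong (u v : R -> R) (t du dv : R) :
  is_derive t 1 u du -> u = v -> du = dv -> is_derive t 1 v dv.
Proof. by move=> h <- <-. Qed.

Lemma cont2_at (T : topologicalType) f (u v : T -> R) (t : T) : cont2 f ->
  {for t, continuous u} -> {for t, continuous v} ->
  {for t, continuous (fun t => f (u t) (v t))}.
Proof.
by move=> cf cu cv; apply: (@continuous2_cvg _ _ _ _ _ _ _ _ f (u t) (v t));
  [exact: (cf (u t, v t))|exact: cu|exact: cv].
Qed.

Lemma cont2_swap f : cont2 f -> cont2 (fun x y => f y x).
Proof.
move=> cf z; exact: (@cont2_at _ f (fun z => z.2) (fun z => z.1) z cf cvg_snd cvg_fst).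
Qed.

Lemma Cn0 f : cont2 f -> Cn 0 f.
Proof. by split. Qed.

Lemma Cn_cont2 n f : Cn n f -> cont2 f.
Proof. by case: n => [|n] []. Qed.

Lemma Cn_D1 n f : Cn n.+1 f -> Cn n (D1 f).
Proof. by move=> [_ []]. Qed.

Lemma Cn_D2 n f : Cn n.+1 f -> Cn n (D2 f).
Proof. by move=> [_ []]. Qed.

Lemma CnS n f : Cn n.+1 f -> Cn n f.
Proof.
elim: n f => [|n IH] f; first by move/Cn_cont2/Cn0.
move=> [cf [h1 h2 h3 h4]]; split; first exact: cf.
by split; [exact: h1|exact: h2|exact: (IH _ h3)|exact: (IH _ h4)].
Qed.

Lemma Cn_der1 n f x y : Cn n.+1 f -> is_derive x 1 (f ^~ y) (D1 f x y).
Proof. by move=> [_ [h _ _ _]]; apply: DeriveDef. Qed.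

Lemma Cn_der2 n f x y : Cn n.+1 f -> is_derive y 1 (f x) (D2 f x y).
Proof. by move=> [_ [_ h _ _]]; apply: DeriveDef. Qed.

Lemma Cn_intro n f f1 f2 : cont2 f ->
  (forall x y, is_derive x 1 (f ^~ y) (f1 x y)) ->
  (forall x y, is_derive y 1 (f x) (f2 x y)) ->
  Cn n f1 -> Cn n f2 -> Cn n.+1 f.
Proof.
move=> cf h1 h2 c1 c2; split; first exact: cf.
have E1 : D1 f = f1.
  by apply/funext => x; apply/funext => y; have [_ ] := h1 x y.
have E2 : D2 f = f2.
  by apply/funext => x; apply/funext => y; have [_ ] := h2 x y.
rewrite E1 E2; split; [|..|exact: c1|exact: c2] => x y.
  by have [] := h1 x y.
by have [] := h2 x y.
Qed.

Lemma Cn_swap n f : Cn n f -> Cn n (fun x y => f y x).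
Proof.
elim: n f => [|n IH] f Cf; first exact/Cn0/cont2_swap/(Cn_cont2 Cf).
apply: (@Cn_intro n _ (fun x y => D2 f y x) (fun x y => D1 f y x)).
- exact/cont2_swap/(Cn_cont2 Cf).
- by move=> x y; exact: Cn_der2 Cf.
- by move=> x y; exact: Cn_der1 Cf.
- exact/IH/Cn_D2.
- exact/IH/Cn_D1.
Qed.

Lemma cont2_comp (u : R -> R) f : continuous u -> cont2 f ->
  cont2 (fun x y => u (f x y)).
Proof. by move=> cu cf z; apply: (continuous_comp (cf z)); exact: cu. Qed.

Lemma cont2D f g : cont2 f -> cont2 g -> cont2 (fun x y => f x y + g x y).
Proof. by move=> cf cg z; apply: continuousD; [exact: cf|exact: cg]. Qed.

Lemma cont2M f g : cont2 f -> cont2 g -> cont2 (fun x y => f x y * g x y).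
Proof. by move=> cf cg z; apply: continuousM; [exact: cf|exact: cg]. Qed.

Lemma cont2V f : (forall x y, f x y != 0) -> cont2 f ->
  cont2 (fun x y => (f x y)^-1).
Proof. by move=> f0 cf z; apply: continuousV; [exact: f0|exact: cf]. Qed.

Lemma Cn_cst n (c : R) : Cn n (fun _ _ => c).
Proof.
elim: n c => [|n IH] c; first by apply: Cn0; exact: cst_continuous.
apply: (@Cn_intro n _ (fun _ _ => 0) (fun _ _ => 0)).
- exact: cst_continuous.
- by move=> x y; exact: is_derive_cst.
- exact: (IH 0).
- exact: (IH 0).
Qed.

Lemma CnD n f g : Cn n f -> Cn n g -> Cn n (fun x y => f x y + g x y).
Proof.
elim: n f g => [|n IH] f g Cf Cg.
  by apply/Cn0/cont2D; [exact: Cn_cont2 Cf|exact: Cn_cont2 Cg].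
apply: (@Cn_intro n _ (fun x y => D1 f x y + D1 g x y)
  (fun x y => D2 f x y + D2 g x y)).
- by apply: cont2D; [exact: Cn_cont2 Cf|exact: Cn_cont2 Cg].
- by move=> x y; apply: is_derive_addr; apply: Cn_der1; [exact: Cf|exact: Cg].
- by move=> x y; apply: is_derive_addr; apply: Cn_der2; [exact: Cf|exact: Cg].
- by apply: IH; exact: Cn_D1.
- by apply: IH; exact: Cn_D2.
Qed.

Lemma CnM n f g : Cn n f -> Cn n g -> Cn n (fun x y => f x y * g x y).
Proof.
elim: n f g => [|n IH] f g Cf Cg.
  by apply/Cn0/cont2M; [exact: Cn_cont2 Cf|exact: Cn_cont2 Cg].
apply: (@Cn_intro n (fun x y => f x y * g x y)
  (fun x y => D1 f x y * g x y + f x y * D1 g x y)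
  (fun x y => D2 f x y * g x y + f x y * D2 g x y)).
- by apply: cont2M; [exact: Cn_cont2 Cf|exact: Cn_cont2 Cg].
- by move=> x y; apply: is_derive_mulr; apply: Cn_der1; [exact: Cf|exact: Cg].
- by move=> x y; apply: is_derive_mulr; apply: Cn_der2; [exact: Cf|exact: Cg].
- by apply: CnD; apply: IH; [exact: Cn_D1|exact: CnS|exact: CnS|exact: Cn_D1].
- by apply: CnD; apply: IH; [exact: Cn_D2|exact: CnS|exact: CnS|exact: Cn_D2].
Qed.

Lemma CnN n f : Cn n f -> Cn n (fun x y => - f x y).
Proof.
move=> Cf; have := CnM (Cn_cst n (-1)) Cf.
congr (Cn n _); by apply/funext => x; apply/funext => y; rewrite mulN1r.
Qed.

Lemma CnV n f : (forall x y, f x y != 0) -> Cn n f ->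
  Cn n (fun x y => (f x y)^-1).
Proof.
move=> f0; elim: n => [|n IH] Cf.
  by apply/Cn0/cont2V; [exact: f0|exact: Cn_cont2 Cf].
have IHf := IH (CnS Cf).
apply: (@Cn_intro n (fun x y => (f x y)^-1)
  (fun x y => - (D1 f x y * (f x y)^-1 * (f x y)^-1))
  (fun x y => - (D2 f x y * (f x y)^-1 * (f x y)^-1))).
- by apply: cont2V; [exact: f0|exact: Cn_cont2 Cf].
- by move=> x y; apply: is_derive_invr; [exact: f0|exact: Cn_der1 Cf].
- by move=> x y; apply: is_derive_invr; [exact: f0|exact: Cn_der2 Cf].
- by apply/CnN/CnM; [apply: CnM; [exact: Cn_D1|exact: IHf]|exact: IHf].
- by apply/CnN/CnM; [apply: CnM; [exact: Cn_D2|exact: IHf]|exact: IHf].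
Qed.

Lemma CnX n f k : Cn n f -> Cn n (fun x y => f x y ^+ k).
Proof.
move=> Cf; elim: k => [|k IH]; first exact: (Cn_cst n 1).
have := CnM Cf IH; congr (Cn n _).
by apply/funext => x; apply/funext => y; rewrite exprS.
Qed.

Lemma cont2_fst : cont2 (fun x _ => x).
Proof. by move=> z; exact: cvg_fst. Qed.

Lemma Cn_fst n : Cn n (fun x _ => x).
Proof.
case: n => [|n]; first exact/Cn0/cont2_fst.
apply: (@Cn_intro n _ (fun _ _ => 1) (fun _ _ => 0)).
- exact: cont2_fst.
- exact: Cn_cst.
- exact: Cn_cst.
Qed.

Lemma Cn_snd n : Cn n (fun _ y => y).
Proof. exact: (Cn_swap (Cn_fst n)). Qed.

Lemma cont2_pair f (u v : R -> R) : continuous u -> continuous v -> cont2 f ->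
  cont2 (fun x y => f (u x) (v y)).
Proof.
move=> cu cv cf z; apply: cont2_at => //.
  by apply: continuous_comp; [exact: cvg_fst|exact: cu].
by apply: continuous_comp; [exact: cvg_snd|exact: cv].
Qed.

Lemma continuous_expRM s : continuous (fun t : R => expR (s * t)).
Proof.
move=> t; apply: continuous_comp; last exact: continuous_expR.
by apply: continuousM; [exact: cst_continuous|exact: cvg_id].
Qed.

Lemma Cn_expR1 n s : Cn n (fun x _ : R => expR (s * x)).
Proof.
have ce : cont2 (fun x _ : R => expR (s * x)).
  by apply: (cont2_comp (@continuous_expRM s)); exact: cont2_fst.
elim: n => [|n IH]; first exact: Cn0.
apply: (@Cn_intro n _ (fun x _ => s * expR (s * x)) (fun _ _ => 0)).
- exact: ce.
- move=> x y; have := is_derive_comp_expR (is_derive_id (expR (s * x)) (1 : R)).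
  by rewrite mulr1.
- by apply: CnM; [exact: Cn_cst|exact: IH].
- exact: Cn_cst.
Qed.

Lemma Cn_expR2 n s : Cn n (fun _ y : R => expR (s * y)).
Proof. exact: (Cn_swap (Cn_expR1 n s)). Qed.

Lemma Cn_comp_expR n f (s1 s2 : R) : Cn n f ->
  Cn n (fun x y => f (expR (s1 * x)) (expR (s2 * y))).
Proof.
elim: n f => [|n IH] f Cf.
  by apply/Cn0/cont2_pair; [exact: continuous_expRM
    |exact: continuous_expRM|exact: Cn_cont2 Cf].
apply: (@Cn_intro n _
   (fun x y => s1 * expR (s1 * x) * D1 f (expR (s1 * x)) (expR (s2 * y)))
   (fun x y => s2 * expR (s2 * y) * D2 f (expR (s1 * x)) (expR (s2 * y)))).
- by apply: cont2_pair; [exact: continuous_expRM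
    |exact: continuous_expRM|exact: Cn_cont2 Cf].
- move=> x y; apply: (@is_derive_comp_expR (f ^~ (expR (s2 * y)))).
  exact: Cn_der1 Cf.
- move=> x y; apply: (@is_derive_comp_expR (f (expR (s1 * x)))).
  exact: Cn_der2 Cf.
- apply: CnM; first by apply: CnM; [exact: Cn_cst|exact: Cn_expR1].
  by apply: IH; exact: Cn_D1.
- apply: CnM; first by apply: CnM; [exact: Cn_cst|exact: Cn_expR2].
  by apply: IH; exact: Cn_D2.
Qed.

Lemma smooth2_D1 f : smooth2 f -> smooth2 (D1 f).
Proof. by move=> sf n; apply: Cn_D1. Qed.

Lemma smooth2_D2 f : smooth2 f -> smooth2 (D2 f).
Proof. by move=> sf n; apply: Cn_D2. Qed.

Lemma smooth2_der1 f x y : smooth2 f -> is_derive x 1 (f ^~ y) (D1 f x y).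
Proof. by move=> sf; exact: Cn_der1 (sf 1%N). Qed.

Lemma smooth2_der2 f x y : smooth2 f -> is_derive y 1 (f x) (D2 f x y).
Proof. by move=> sf; exact: Cn_der2 (sf 1%N). Qed.

Lemma smooth2_cont2 f : smooth2 f -> cont2 f.
Proof. by move=> sf; exact: Cn_cont2 (sf 0%N). Qed.

Lemma cont2_1 f y : cont2 f -> continuous (f ^~ y).
Proof. by move=> cf x; apply: cont2_at => //; exact: cvg_cst. Qed.

Lemma cont2_2 f x : cont2 f -> continuous (f x).
Proof. by move=> cf y; apply: cont2_at => //; exact: cvg_cst. Qed.

End C2.

Section Measurable2.
Context {R : realType}.

(** The sigma-algebra here is the product one, so openness does not give measurability at once: the
    open set is the countable union of the rational rectangles that it contains. *)
Lemma open2_measurable (O : set (R * R)) : open O -> measurable O.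
Proof.
move=> oO.
pose rect (a b c d : rat) : set (R * R) :=
  `]ratr a, ratr b[ `*` `]ratr c, ratr d[.
pose F a b c d := [set z | rect a b c d `<=` O /\ rect a b c d z].
have -> : O = \bigcup_a \bigcup_b \bigcup_c \bigcup_d F a b c d.
  apply/seteqP; split; last by move=> z [a _ [b _ [c _ [d _ [h ?]]]]]; exact: h.
  move=> [x y] Oxy.
  have : nbhs (x, y) O by exact: open_nbhs_nbhs.
  case=> -[U V] /= [/nbhs_ballP[e1 /= e10 U1] /nbhs_ballP[e2 /= e20 V2]] UV.
  have lt1 e (t : R) : 0 < e -> t - e < t by move=> ?; lra.
  have lt2 e (t : R) : 0 < e -> t < t + e by move=> ?; lra.
  have /rat_in_itvoo[a] := lt1 _ x e10; rewrite in_itv/= => /andP[a1 a2].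
  have /rat_in_itvoo[b] := lt2 _ x e10; rewrite in_itv/= => /andP[b1 b2].
  have /rat_in_itvoo[c] := lt1 _ y e20; rewrite in_itv/= => /andP[c1 c2].
  have /rat_in_itvoo[d] := lt2 _ y e20; rewrite in_itv/= => /andP[d1 d2].
  exists a => //; exists b => //; exists c => //; exists d => //; split.
    move=> [u v] [] /=; rewrite !in_itv/= => /andP[? ?] /andP[? ?].
    apply: UV; split => /=.
      by apply: U1; rewrite /ball/= ltr_norml; apply/andP; split; lra.
    by apply: V2; rewrite /ball/= ltr_norml; apply/andP; split; lra.
  by rewrite /rect; split; rewrite /= in_itv/=; apply/andP; split.
do 4 (apply: bigcupT_measurable_rat => ?).
rewrite /F; set a := (X in rect X); set b := (X in rect _ X).
set c := (X in rect _ _ X); set d := (X in rect _ _ _ X).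
have [h|h] := pselect (rect a b c d `<=` O).
  rewrite (_ : [set _ | _] = rect a b c d); first exact: measurableX.
  by apply/seteqP; split => z // [].
rewrite (_ : [set _ | _] = set0); first exact: measurable0.
by apply/seteqP; split => z // [].
Qed.

Lemma cont2_measurable (f : R -> R -> R) : cont2 f ->
  measurable_fun setT (fun z : R * R => f z.1 z.2).
Proof.
move=> cf; apply: (measurability _ (RGenOpens.measurableE R)).
move=> _ [_ [a [b ->] <-]]; rewrite setTI.
apply: open2_measurable; apply: open_comp; last exact: interval_open.
by move=> z _; exact: cf.
Qed.

End Measurable2.

(** * Integration of exponentially decaying functions *)

Section LineIntegral.
Context {R : realType}.
Notation mu := (@lebesgue_measure R).

(** This is the radius exp y or exp (- y) in whichever of the two charts of the projective line it
    is at most 1. *)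
Definition ebound (y : R) : R := expR (- `|y|).

Lemma ebound_ge0 y : 0 <= ebound y. Proof. exact: expR_ge0. Qed.

Lemma continuous_ebound : continuous ebound.
Proof.
move=> y; apply: continuous_comp; last exact: continuous_expR.
by apply: continuousN; exact: norm_continuous.
Qed.

Lemma integrable_ebound : mu.-integrable setT (EFin \o ebound).
Proof.
apply/integrableP; split.
  apply/measurable_EFinP; apply: continuous_measurable_fun.
  exact: continuous_ebound.
under eq_integral => y _ do rewrite /= ger0_norm ?ebound_ge0//.
rewrite ge0_symfun_integralT; last 3 first.
- exact: ebound_ge0.
- exact: continuous_ebound.
- by move=> y; rewrite /ebound /= normrN.
rewrite -set_itvcy.
under eq_integral => y.
  rewrite inE/= in_itv/= andbT => y0; rewrite /ebound ger0_norm//; over.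
rewrite (@ge0_continuous_FTC2y _ (fun y => expR (- y)) (fun y => - expR (- y)) 0 0).
- by rewrite -EFinB -EFinM ltry.
- by move=> x _; exact: expR_ge0.
- apply: continuous_subspaceT => y; apply: continuous_comp; last exact: continuous_expR.
  exact: opp_continuous.
- by rewrite -oppr0; apply: cvgN; exact: cvgr_expR.
- by move=> x _; apply: derivableN; apply: ex_derive.
- apply: cvg_at_right_filter; apply: cvgN; apply: continuous_comp; last exact: continuous_expR.
  exact: opp_continuous.
- move=> x _; rewrite derive1E deriveN//.
  have h : is_derive x 1 (expR \o (fun y : R => - y)) (expR (- x) * -1).
    by apply: is_derive1_comp.
  by rewrite [X in - X](@derive_val _ _ _ _ _ _ _ h) mulrN1 opprK.
Qed.

Lemma integrable_dom (f : R -> R) (K : R) : continuous f ->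
  (forall y, `|f y| <= K * ebound y) -> mu.-integrable setT (EFin \o f).
Proof.
move=> cf fK; apply: (@le_integrable _ _ _ mu _ measurableT _ (EFin \o (fun y => K * ebound y))).
- by apply/measurable_EFinP; exact: continuous_measurable_fun.
- move=> y _ /=; rewrite lee_fin; apply: (le_trans (fK y)); exact: ler_norm.
- have -> : EFin \o (fun y => K * ebound y) = (fun y => K%:E * (EFin \o ebound) y)%E.
    by apply/funext => y /=.
  by apply: integrableZl => //; exact: integrable_ebound.
Qed.

(** The fundamental theorem on [-n, n], followed by dominated convergence. *)
Lemma FTC_line (F f : R -> R) (K lp lm : R) :
  (forall y : R, is_derive y 1 F (f y)) -> continuous f ->
  (forall y, `|f y| <= K * ebound y) ->
  F n%:R @[n --> \oo] --> lp -> F (- n%:R) @[n --> \oo] --> lm ->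
  \int[mu]_y f y = lp - lm.
Proof.
move=> dF cf fK Flp Flm.
have ifn := integrable_dom cf fK.
pose I n : set R := `[- n%:R, n%:R]%classic.
pose fn n : R -> \bar R := (EFin \o f) \_ (I n).
have mI n : measurable (I n) by exact: measurable_itv.
have mf : measurable_fun setT (EFin \o f) by case/integrableP: ifn.
have m_fn n : measurable_fun setT (fn n).
  apply/(measurable_restrictT _ (mI n)).
  by apply: (@measurable_funTS _ _ _ _ _ (EFin \o f)); exact: mf.
have cvg_fn : {ae mu, forall x, setT x -> fn ^~ x @ \oo --> (EFin \o f) x}.
  apply: aeW => y _; apply: cvg_near_cst.
  exists (Num.truncn `|y|).+1 => // n /= yn.
  rewrite /fn patchE ifT// inE /I /= in_itv/=.
  have : `|y| <= n%:R.
    by rewrite (le_trans (ltW (truncnS_gt `|y|)))// ler_nat.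
  by rewrite ler_norml.
have i_abs : mu.-integrable setT (EFin \o (fun y => `|f y|)).
  by have := integrable_abse ifn; congr (_.-integrable _ _); apply/funext.
have le_fn : {ae mu, forall x n, setT x -> (`|fn n x| <= (EFin \o (fun y => `|f y|%R)) x)%E}.
  apply: aeW => y n _; rewrite /fn patchE; case: ifP => _ //=.
  by rewrite normr0 lee_fin.
have [_ _ h] := @dominated_convergence _ _ _ mu _ measurableT _ _ _ m_fn mf cvg_fn i_abs le_fn.
rewrite /Rintegral -(cvg_lim _ h)//.
(* The index is shifted because the fundamental theorem wants a nondegenerate interval, which fails
   for n = 0. *)
have E1 n : (\int[mu]_x fn n.+1 x)%E = (F n.+1%:R - F (- n.+1%:R))%:E.
  rewrite /fn -integral_mkcond.
  have nn : - n.+1%:R < n.+1%:R :> R by rewrite gtrN ?ltr0n.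
  have cF : continuous F.
    by move=> y; apply: differentiable_continuous; apply/derivable1_diffP; have [] := dF y.
  rewrite (continuous_FTC2 (F := F) nn) ?EFinB//.
  - exact: continuous_subspaceT.
  - split.
    + by move=> y _; have [] := dF y.
    + by apply: cvg_at_right_filter; exact: cF.
    + by apply: cvg_at_left_filter; exact: cF.
  - by move=> y _; rewrite derive1E; have [] := dF y.
suff -> : lim ([sequence (\int[mu]_x fn n x)%E]_n @ \oo) = (lp - lm)%:E by [].
apply: cvg_lim => //; rewrite -cvg_shiftS /=.
under eq_cvg do rewrite E1.
apply: cvg_EFin; first exact: nearW.
apply: cvgB.
  by have := Flp; rewrite -(cvg_shiftS (fun n => F n%:R)).
by have := Flm; rewrite -(cvg_shiftS (fun n => F (- n%:R))).
Qed.
End LineIntegral.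

Section PlaneIntegral.
Context {R : realType}.
Notation mu := (@lebesgue_measure R).

Lemma measurable_ebound c : measurable_fun [set: R] (fun y => (c * ebound y)%:E).
Proof.
apply/measurable_EFinP; apply: continuous_measurable_fun => y.
by apply: continuousM; [exact: cvg_cst|exact: continuous_ebound].
Qed.

Lemma integral_ebound_lty c : (\int[mu]_y (c * ebound y)%:E < +oo)%E.
Proof.
have i : mu.-integrable setT (EFin \o (fun y => c * ebound y)).
  apply: (@integrable_dom _ _ `|c|).
    by move=> y; apply: continuousM; [exact: cvg_cst|exact: continuous_ebound].
  by move=> y; rewrite normrM (ger0_norm (ebound_ge0 y)).
by have /fin_numPlt/andP[] := integrable_fin_num measurableT i.
Qed.

Definition dom2 (w : R -> R -> R) :=
  exists K, forall y1 y2, `|w y1 y2| <= K * (ebound y1 * ebound y2).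

Definition int2 (w : R -> R -> R) : R :=
  \int[mu]_y1 \int[mu]_y2 w y1 y2.

Definition prod_int (w : R -> R -> R) : \bar R :=
  (\int[(mu \x mu)%E]_z (w z.1 z.2)%:E)%E.

Lemma dom2_slice2 w y1 : cont2 w -> dom2 w ->
  mu.-integrable setT (EFin \o w y1).
Proof.
move=> cw [K wK]; apply: (@integrable_dom _ _ (K * ebound y1)).
  exact: cont2_2.
by move=> y; rewrite -mulrA.
Qed.

Lemma dom2_slice1 w y2 : cont2 w -> dom2 w ->
  mu.-integrable setT (EFin \o (w ^~ y2)).
Proof.
move=> cw [K wK]; apply: (@integrable_dom _ _ (K * ebound y2)).
  exact: cont2_1.
by move=> y; rewrite -mulrA [ebound y2 * _]mulrC.
Qed.

(** Tonelli: the inner integral of the absolute value is at most a multiple of [ebound], which is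
    integrable. *)
Lemma dom2_integrable w : cont2 w -> dom2 w ->
  (mu \x mu)%E.-integrable setT (fun z => (w z.1 z.2)%:E).
Proof.
move=> cw [K wK]; apply/integrable12ltyP.
  by apply/measurable_EFinP; exact: cont2_measurable.
pose c := fine (\int[mu]_y (ebound y)%:E)%E.
have cE : (\int[mu]_y (ebound y)%:E)%E = c%:E.
  by rewrite fineK//; apply: integrable_fin_num => //; exact: integrable_ebound.
have K0 : 0 <= K.
  have := le_trans (normr_ge0 _) (wK 0 0).
  by rewrite /ebound normr0 oppr0 expR0 !mulr1.
have le1 x : (\int[mu]_y `|(w x y)%:E| <= (K * c * ebound x)%:E)%E.
  rewrite mulrAC EFinM -cE -ge0_integralZl//; last 3 first.
  - by apply/measurable_EFinP; apply: continuous_measurable_fun; exact: continuous_ebound.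
  - by move=> y _; rewrite lee_fin ebound_ge0.
  - by rewrite lee_fin mulr_ge0// ebound_ge0.
  apply: ge0_le_integral => //.
  - apply/measurable_EFinP; apply: continuous_measurable_fun.
    by move=> y; apply: continuous_comp; [exact: (cont2_2 cw)|exact: norm_continuous].
  - exact: measurable_ebound.
  - by move=> y _; rewrite lee_fin -mulrA; exact: wK.
apply: le_lt_trans (integral_ebound_lty (K * c)).
apply: ge0_le_integral => //.
- by move=> x _; exact: integral_ge0.
- have mw : measurable_fun setT (fun z : R * R => `|w z.1 z.2|).
    apply: (@cont2_measurable _ (fun x y => `|w x y|)).
    by move=> z; apply: continuous_comp; [exact: cw|exact: norm_continuous].
  move/measurable_EFinP : mw => mw.
  apply: (@measurable_fun_fubini_tonelli_F _ _ _ _ _ mu _ mw).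
  by move=> z /=; rewrite lee_fin.
- exact: measurable_ebound.
- by move=> x _; exact: le1.
Qed.

Lemma int2E w : cont2 w -> dom2 w -> int2 w = fine (prod_int w).
Proof.
move=> cw dw; rewrite /prod_int -(integral12_prod_meas1 (dom2_integrable cw dw)).
rewrite /int2 /Rintegral; congr fine; apply: eq_integral => x _.
rewrite /fubini_F fineK//; apply: integrable_fin_num => //.
exact: dom2_slice2.
Qed.

Lemma int2_swap w : cont2 w -> dom2 w ->
  int2 w = \int[mu]_y2 \int[mu]_y1 w y1 y2.
Proof.
move=> cw dw; rewrite int2E// /prod_int.
rewrite -(integral21_prod_meas1 (dom2_integrable cw dw)).
rewrite /Rintegral; congr fine; apply: eq_integral => x _.
rewrite /fubini_G fineK//; apply: integrable_fin_num => //.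
exact: dom2_slice1.
Qed.

Lemma dom2D v w : dom2 v -> dom2 w -> dom2 (fun x y => v x y + w x y).
Proof.
move=> [K1 h1] [K2 h2]; exists (K1 + K2) => x y.
by rewrite mulrDl; apply: (le_trans (ler_normD _ _)); exact: lerD.
Qed.

Lemma dom2Z c w : dom2 w -> dom2 (fun x y => c * w x y).
Proof.
move=> [K h]; exists (`|c| * K) => x y.
by rewrite normrM -mulrA ler_wpM2l.
Qed.

Lemma int2D v w : cont2 v -> dom2 v -> cont2 w -> dom2 w ->
  int2 (fun x y => v x y + w x y) = int2 v + int2 w.
Proof.
move=> cv dv cw dw; rewrite !int2E//; [|exact: cont2D|exact: dom2D].
have iv := dom2_integrable cv dv; have iw := dom2_integrable cw dw.
by rewrite /prod_int integralD_EFin// fineD//; exact: integrable_fin_num.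
Qed.

Lemma cont2Z c (w : R -> R -> R) : cont2 w -> cont2 (fun x y => c * w x y).
Proof. by move=> cw z; apply: continuousM; [exact: cvg_cst|exact: cw]. Qed.

Lemma int2Z c w : cont2 w -> dom2 w ->
  int2 (fun x y => c * w x y) = c * int2 w.
Proof.
move=> cw dw; rewrite !int2E//; [|exact: cont2Z|exact: dom2Z].
have iw := dom2_integrable cw dw.
rewrite /prod_int; under eq_integral do rewrite EFinM.
by rewrite integralZl// fineM//; exact: integrable_fin_num.
Qed.

End PlaneIntegral.

(** * Fluxes of fields that are smooth in the charts *)

Section Flux.
Context {R : realType}.
Notation mu := (@lebesgue_measure R).

Definition sg (b : bool) : R := (-1) ^+ b.

Lemma sgE b : sg b = if b then -1 else 1.
Proof. by case: b; rewrite /sg /= ?expr1 ?expr0. Qed.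

Lemma sg2 b : sg b * sg b = 1.
Proof. by rewrite sgE; case: b; ring. Qed.

Lemma sg_neg y : sg (0 < y) * y = - `|y|.
Proof.
rewrite sgE; case: ltP => y0; first by rewrite gtr0_norm// mulN1r.
by rewrite ler0_norm// opprK mul1r.
Qed.

Lemma continuous_mulr (u v : R -> R) : continuous u -> continuous v ->
  continuous (fun x => u x * v x).
Proof. by move=> cu cv x; apply: (@continuousM _ _ u v); [exact: cu|exact: cv]. Qed.

Lemma unit_square_bound (g : R -> R -> R) : cont2 g ->
  exists K, forall x y, 0 <= x <= 1 -> 0 <= y <= 1 -> `|g x y| <= K.
Proof.
move=> cg.
pose A : set (R * R) := `[0, 1]%classic `*` `[0, 1]%classic.
have cA : compact A by apply: compact_setX; exact: segment_compact.
have A0 : A !=set0 by exists (0, 0); split; rewrite /= in_itv/= lexx ler01.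
have [] := @compact_EVT_max _ _ (fun z : R * R => `|g z.1 z.2|) _ A0 cA.
  apply: continuous_subspaceT => z.
  by apply: continuous_comp; [exact: cg|exact: norm_continuous].
move=> z _ h; exists `|g z.1 z.2| => x y x01 y01; apply: (h (x, y)).
by rewrite inE; split; rewrite /= in_itv.
Qed.

Lemma cvg_expRN : expR (- n%:R : R) @[n --> \oo] --> (0 : R).
Proof.
apply: (cvg_comp (fun n => n%:R : R) (fun x : R => expR (- x))).
  exact: cvgr_idn.
exact: cvgr_expR.
Qed.

(** A function on the projective line minus two points that extends smoothly over both of them, as
    [N true] near y = +oo and [N false] near y = -oo. Its derivative in y carries the factor r,
    hence decays, and the limits of F are the values of N at r = 0. *)
Lemma FTC_tame (N n : bool -> R -> R) (F f : R -> R) :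
  (forall b (r : R), is_derive r 1 (N b) (n b r)) ->
  (forall b, continuous (n b)) ->
  (forall b y, F y = N b (expR (sg b * y))) ->
  (forall y : R, is_derive y 1 F (f y)) ->
  [/\ continuous f, exists K, forall y, `|f y| <= K * ebound y &
    \int[mu]_y f y = N true 0 - N false 0].
Proof.
move=> dN cn FN dF.
have fE b y : f y = sg b * expR (sg b * y) * n b (expR (sg b * y)).
  have d := @is_derive_comp_expR R (N b) y (sg b) _ (dN b _).
  have <- := @derive_val _ _ _ _ _ _ _ (dF y).
  by rewrite -(@derive_val _ _ _ _ _ _ _ d); congr ('D_1 _ y); apply/funext.
have cf : continuous f.
  rewrite (_ : f = fun y => sg false * expR (sg false * y) * n false (expR (sg false * y))).
    apply: (@continuous_mulr (fun y => sg false * expR (sg false * y))).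
      apply: (@continuous_mulr (fun=> sg false)); last exact: continuous_expRM.
      exact: cst_continuous.
    by move=> y; apply: continuous_comp; [exact: continuous_expRM|exact: cn].
  by apply/funext => y.
have [K1 h1] := unit_square_bound (cont2_comp (cn true) cont2_fst).
have [K2 h2] := unit_square_bound (cont2_comp (cn false) cont2_fst).
have fK y : `|f y| <= Num.max K1 K2 * ebound y.
  rewrite (fE (0 < y)) sg_neg -/(ebound y) !normrM.
  have -> : `|sg (0 < y)| = 1 by rewrite /sg normrX normrN1 expr1n.
  rewrite mul1r (ger0_norm (ebound_ge0 y)) mulrC ler_wpM2r ?ebound_ge0//.
  have e1 : 0 <= ebound y <= 1.
    by rewrite ebound_ge0 /ebound -expR0 ler_expR oppr_le0 normr_ge0.
  have e0 : 0 <= (0 : R) <= 1 by rewrite lexx ler01.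
  rewrite le_max; case: (0 < y); first by rewrite (h1 _ 0).
  by rewrite (h2 _ 0)// orbT.
split=> //; first by eexists.
have cN b : continuous (N b).
  by move=> r; apply: differentiable_continuous; apply/derivable1_diffP; have [] := dN b r.
apply: (FTC_line dF cf fK).
  under eq_cvg do rewrite (FN true) sgE mulN1r.
  by apply: (cvg_comp _ (N true) cvg_expRN); exact: cN.
under eq_cvg do rewrite (FN false) sgE mul1r.
by apply: (cvg_comp _ (N false) cvg_expRN); exact: cN.
Qed.

End Flux.

Section Flux2.
Context {R : realType}.
Notation mu := (@lebesgue_measure R).
Implicit Types (S : chart -> R -> R -> R) (W : R -> R -> R).

(* The four charts are indexed by the fixed points of the torus, which map to  *)
(* the vertices of Delta p.                                                    *)
Definition corners (N : chart -> R) : R :=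
  N (true, true) - N (false, true) - N (true, false) + N (false, false).

(* In the chart [e] the orbit coordinates are y_j = +- ln r_j.                 *)
Definition charted S W := forall e y1 y2,
  W y1 y2 = S e (expR (sg e.1 * y1)) (expR (sg e.2 * y2)).

(* [W] is one component of a vector field on the orbit; [S e] describes it in  *)
(* the chart [e], and the factor r2 makes it decay along the edges mu_1 = 0, p. *)
Definition flux1 S W :=
  (forall e, Cn 1 (S e)) /\ charted (fun e r1 r2 => r2 * S e r1 r2) W.

Definition flux2 S W :=
  (forall e, Cn 1 (S e)) /\ charted (fun e r1 r2 => r1 * S e r1 r2) W.

Lemma flux1_derive S W (e : chart) (y1 y2 : R) : flux1 S W ->
  is_derive y1 1 (W ^~ y2) (expR (sg e.2 * y2) * (sg e.1 * expR (sg e.1 * y1) *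
    D1 (S e) (expR (sg e.1 * y1)) (expR (sg e.2 * y2)))).
Proof.
move=> [cS hW].
have := is_derive_comp_expR (Cn_der1 (expR (sg e.1 * y1)) (expR (sg e.2 * y2)) (cS e)).
move/(is_derive_mulr (is_derive_constr (expR (sg e.2 * y2)) y1)) => h.
apply: is_derive_cong h _ _; last by rewrite mul0r add0r.
by apply/funext => t; rewrite (hW e).
Qed.

(** A product r1 r2 S with S continuous in each chart is dominated by exp (-|y1|) exp (-|y2|), since
    each point of the orbit falls in the unit square of some chart, where S is bounded by
    compactness. *)
Lemma charted_tame S W : (forall e, Cn 0 (S e)) ->
  charted (fun e r1 r2 => r1 * r2 * S e r1 r2) W -> cont2 W /\ dom2 W.
Proof.
move=> cS hW; split.
  pose e : chart := (false, false).
  have -> : W = fun y1 y2 => expR (sg e.1 * y1) * expR (sg e.2 * y2) *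
      S e (expR (sg e.1 * y1)) (expR (sg e.2 * y2)).
    by apply/funext => y1; apply/funext => y2; exact: (hW e).
  exact: (Cn_cont2 (CnM (CnM (Cn_expR1 0 (sg e.1)) (Cn_expR2 0 (sg e.2)))
    (Cn_comp_expR (sg e.1) (sg e.2) (cS e)))).
have /choice[K Kh] : forall e, exists k : R, forall x y : R, 0 <= x <= 1 ->
    0 <= y <= 1 -> `|S e x y| <= k.
  by move=> e; apply: unit_square_bound; exact/Cn_cont2/cS.
have K0 e : 0 <= K e.
  by apply: le_trans (normr_ge0 _) (Kh e 0 0 _ _); rewrite lexx ler01.
exists (\sum_e K e) => y1 y2.
(* The chart in which both radii are at most 1: inverting the coordinate z_j when y_j > 0 turns r_j
   into exp (-|y_j|). *)
pose e : chart := (0 < y1, 0 < y2).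
rewrite (hW e) /= !sg_neg -!/(ebound _) !normrM.
rewrite !(ger0_norm (ebound_ge0 _)) mulrC.
apply: ler_wpM2r; first by rewrite mulr_ge0 ?ebound_ge0.
have e1 (y : R) : 0 <= ebound y <= 1.
  by rewrite ebound_ge0 /ebound -expR0 ler_expR oppr_le0 normr_ge0.
apply: (le_trans (Kh e _ _ (e1 _) (e1 _))).
by rewrite (bigD1 e)//= lerDl sumr_ge0.
Qed.

Lemma flux1_tame S W : flux1 S W -> cont2 (D1 W) /\ dom2 (D1 W).
Proof.
move=> h; have [cS hW] := h.
apply: (@charted_tame (fun e r1 r2 => sg e.1 * D1 (S e) r1 r2)).
  by move=> e; exact: CnM (Cn_cst 0 _) (Cn_D1 (cS e)).
move=> e y1 y2; rewrite /D1 [LHS](@derive_val _ _ _ _ _ _ _ (flux1_derive e y1 y2 h)).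
set r1 := expR (sg e.1 * _); set r2 := expR (sg e.2 * _).
rewrite -/(D1 (S e) r1 r2); move: (D1 (S e) r1 r2) => d; ring.
Qed.

(** The divergence theorem for one component: the y1-integral leaves the difference of the boundary
    values of W on the two edges r1 = 0, and the edge density n, having the antiderivative N on each
    edge, then leaves the values of N at the four vertices. The compatibility assumed of N says that
    its two chart expressions glue along an edge. *)
Lemma flux1_int S W (N n : chart -> R -> R) : flux1 S W ->
  (forall e (r : R), is_derive r 1 (N e) (n e r)) ->
  (forall e, continuous (n e)) ->
  (forall b y, N (b, false) (expR y) = N (b, true) (expR (- y))) ->
  (forall b r, 0 < r -> S (b, false) 0 r = n (b, false) r) ->
  \int[mu]_y2 \int[mu]_y1 D1 W y1 y2 = corners (N ^~ 0).
Proof.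
move=> h dN cn Nc Sn; have [cS hW] := h.
(* At fixed y2 the chart of the second factor may be kept to the non-inverted one; only the first
   coordinate runs to both ends. *)
have inner y2 : \int[mu]_y1 D1 W y1 y2 =
    expR y2 * n (true, false) (expR y2) - expR y2 * n (false, false) (expR y2).
  have dW (y : R) : is_derive y 1 (W ^~ y2) (D1 W y y2).
    by have [d _] := flux1_derive (false, false) y y2 h; exact: DeriveDef.
  have dN1 b (r : R) : is_derive r 1 (fun r => expR y2 * S (b, false) r (expR y2))
      (expR y2 * D1 (S (b, false)) r (expR y2)).
    have := is_derive_mulr (is_derive_constr (expR y2) r)
       (Cn_der1 r (expR y2) (cS (b, false))).
    by rewrite mul0r add0r.
  have cN1 b : continuous (fun r => expR y2 * D1 (S (b, false)) r (expR y2)).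
    apply: (@continuous_mulr _ (fun=> _)); first exact: cst_continuous.
    exact/cont2_1/Cn_cont2/Cn_D1.
  have FN1 b y : W y y2 =
      expR y2 * S (b, false) (expR (sg b * y)) (expR y2).
    by rewrite (hW (b, false)) /= (sgE false) mul1r.
  have [_ _ ->] := FTC_tame dN1 cN1 FN1 dW.
  by rewrite !Sn ?expR_gt0.
under eq_Rintegral do rewrite inner.
pose NN b r := N (true, b) r - N (false, b) r.
pose F y : R := NN false (expR y).
have dF (y : R) : is_derive y 1 F
   (expR y * n (true, false) (expR y) - expR y * n (false, false) (expR y)).
  have d b := is_derive_comp_expR (t := y) (s := 1) (dN (b, false) (expR (1 * y))).
  have := is_derive_addr (d true) (is_derive_oppr (d false)).
  rewrite !mul1r => h1; apply: is_derive_cong h1 _ _ => //.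
  by apply/funext => t; rewrite mul1r.
have dNN b (r : R) : is_derive r 1 (NN b) (n (true, b) r - n (false, b) r).
  exact: (is_derive_addr (dN (true, b) r) (is_derive_oppr (dN (false, b) r))).
have cNN b : continuous (fun r => n (true, b) r - n (false, b) r).
  by move=> r; apply: continuousB; exact: cn.
have FNN b y : F y = NN b (expR (sg b * y)).
  by rewrite /F sgE; case: b; rewrite ?mulN1r ?mul1r // /NN !Nc.
have [_ _ ->] := FTC_tame dNN cNN FNN dF.
by rewrite /corners /NN; ring.
Qed.

Lemma flux1_int2 S W (N n : chart -> R -> R) : flux1 S W ->
  (forall e (r : R), is_derive r 1 (N e) (n e r)) ->
  (forall e, continuous (n e)) ->
  (forall b y, N (b, false) (expR y) = N (b, true) (expR (- y))) ->
  (forall b r, 0 < r -> S (b, false) 0 r = n (b, false) r) ->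
  int2 (D1 W) = corners (N ^~ 0).
Proof.
move=> h ? ? ? ?; have [c d] := flux1_tame h.
rewrite int2_swap//; exact: (flux1_int (N := N) (n := n) h).
Qed.

Lemma flux2_swap S W : flux2 S W ->
  flux1 (fun e r1 r2 => S (e.2, e.1) r2 r1) (fun y1 y2 => W y2 y1).
Proof.
move=> [cS hW]; split => [e|e y1 y2]; first exact: (Cn_swap (cS (e.2, e.1))).
exact: (hW (e.2, e.1)).
Qed.

Lemma flux2_tame S W : flux2 S W -> cont2 (D2 W) /\ dom2 (D2 W).
Proof.
move=> /flux2_swap/flux1_tame [c [K h]]; split; first exact: cont2_swap c.
by exists K => y1 y2; rewrite [ebound y1 * _]mulrC; exact: h.
Qed.

Lemma flux2_int2 S W (N n : chart -> R -> R) : flux2 S W ->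
  (forall e (r : R), is_derive r 1 (N e) (n e r)) ->
  (forall e, continuous (n e)) ->
  (forall b y, N (false, b) (expR y) = N (true, b) (expR (- y))) ->
  (forall b r, 0 < r -> S (false, b) r 0 = n (false, b) r) ->
  int2 (D2 W) = corners (N ^~ 0).
Proof.
move=> /flux2_swap h dN cn Nc Sn.
transitivity (corners (fun e : chart => N (e.2, e.1) 0)).
  have cn' (e : chart) : continuous (n (e.2, e.1)) by exact: cn.
  have Nc' b y : N (false, b) (expR y) = N (true, b) (expR (- y)) by exact: Nc.
  have Sn' b r : 0 < r -> S (false, b) r 0 = n (false, b) r by exact: Sn.
  exact: (flux1_int (N := fun e => N (e.2, e.1)) h _ cn' Nc' Sn').
by rewrite /corners /=; ring.
Qed.

End Flux2.

(** * Scalar curvature of H (x) 1 *)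

Section BlockMetric.
Context {R : realType}.
Implicit Types (F a b c : R -> R -> R) (x : 'rV[R]_4).

Definition lift2 F x : R := F (x 0 (inord 0)) (x 0 (inord 2)).

Definition dir (i : nat) F : R -> R -> R :=
  match i with 0 => D1 F | 2 => D2 F | _ => fun _ _ => 0 end.

(** A directional derivative sees only the restriction to a line; this carries derivatives from R^4
    to functions of one variable. *)
Lemma derive_eq_along (V V' W : normedModType R) (f : V -> W) (g : V' -> W)
    (x v : V) (y w : V') : (forall h : R, f (h *: v + x) = g (h *: w + y)) ->
  'D_v f x = 'D_w g y.
Proof.
move=> fg; have := fg 0; rewrite !scale0r !add0r => fgx.
rewrite /derive fgx; set u := (fun _ => _); set u' := (fun _ => _).
by rewrite (_ : u = u') //; apply/funext => h; rewrite /u /u' /= fg.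
Qed.

Lemma derivable_eq_along (V V' W : normedModType R) (f : V -> W) (g : V' -> W)
    (x v : V) (y w : V') : (forall h : R, f (h *: v + x) = g (h *: w + y)) ->
  derivable f x v -> derivable g y w.
Proof.
move=> fg; have := fg 0; rewrite !scale0r !add0r => fgx.
rewrite /derivable fgx; set u := (fun _ => _); set u' := (fun _ => _).
by rewrite (_ : u = u') //; apply/funext => h; rewrite /u /u' /= fg.
Qed.

Lemma partial_lift2 (i : 'I_4) F : partial i (lift2 F) = lift2 (dir i F).
Proof.
apply/funext => x; rewrite /partial /lift2.
have E (h : R) j : (h *: (delta_mx 0 i : 'rV[R]_4) + x) 0 j = h * (j == i)%:R + x 0 j.
  by rewrite !mxE eqxx.
have v k : (k < 4)%N -> (inord k == i :> 'I_4) = (k == i :> nat).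
  by move=> k4; rewrite -val_eqE /= inordK.
case: i E v => -[|[|[|[|//]]]] i4 E v; rewrite /dir /=.
- apply: derive_eq_along => h /=.
  by rewrite !E !v//= mulr0 add0r.
- rewrite -[RHS](derive_cst (F (x 0 (inord 0)) (x 0 (inord 2))) x
    (delta_mx 0 (Ordinal i4))).
  apply: derive_eq_along => h /=.
  by rewrite !E !v//= !mulr0 !add0r.
- apply: derive_eq_along => h /=.
  by rewrite !E !v//= mulr0 add0r.
- rewrite -[RHS](derive_cst (F (x 0 (inord 0)) (x 0 (inord 2))) x
    (delta_mx 0 (Ordinal i4))).
  apply: derive_eq_along => h /=.
  by rewrite !E !v//= !mulr0 !add0r.
Qed.

Lemma big_ord4 (V : nmodType) (F : 'I_4 -> V) :
  \sum_(i < 4) F i = F (inord 0) + F (inord 1) + F (inord 2) + F (inord 3).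
Proof.
rewrite !big_ord_recl big_ord0 addr0 !addrA.
by congr (F _ + F _ + F _ + F _); apply: val_inj; rewrite /= inordK.
Qed.

(* The (i, j) entry of [[a, c], [c, b]] (x) 1_2 in the basis (y1, t1, y2, t2) *)
Definition ent (a b c : R) (i j : nat) : R :=
  match i, j with
  | 0, 0 | 1, 1 => a
  | 2, 2 | 3, 3 => b
  | 0, 2 | 2, 0 | 1, 3 | 3, 1 => c
  | _, _ => 0
  end.

Definition block (a b c : R) : 'M[R]_4 := \matrix_(i, j) ent a b c i j.

Lemma invmx_block (a b c : R) : a * b - c ^+ 2 != 0 ->
  invmx (block a b c) = block (b / (a * b - c ^+ 2)) (a / (a * b - c ^+ 2))
    (- c / (a * b - c ^+ 2)).
Proof.
move=> d0.
set B := block _ _ (- c / _).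
have AB : block a b c *m B = 1%:M.
  apply/matrixP => i j; rewrite !mxE big_ord4 !mxE.
  rewrite !inordK//; case: i => -[|[|[|[|//]]]] i4; case: j => -[|[|[|[|//]]]] j4;
    rewrite /= -?val_eqE /=; first [by field | by rewrite ?(mulr0, mul0r, addr0, add0r); field].
have [uA _] := mulmx1_unit AB.
by rewrite -[RHS]mul1mx -(mulVmx uA) -mulmxA AB mulmx1.
Qed.

(** Twice the Christoffel symbol of the first kind; only the directions y1 and y2, of indices 0 and
    2, differentiate the metric. *)
Definition low (a1 a2 b1 b2 c1 c2 : R) (i j l : nat) : R :=
  let d i j l := match i with
    | 0 => ent a1 b1 c1 j l | 2 => ent a2 b2 c2 j l | _ => 0 end in
  d i j l + d j i l - d l i j.

(* [u v w] stand for the inverse metric, the other arguments for the first    *)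
(* derivatives of the metric.                                                 *)
Definition chr (u v w a1 a2 b1 b2 c1 c2 : R) (k i j : nat) : R :=
  match k, i, j with
  | 0, 0, 0 => 2^-1 * (u * a1 + w * (2 * c1 - a2))
  | 2, 0, 0 => 2^-1 * (w * a1 + v * (2 * c1 - a2))
  | 0, 0, 2 | 0, 2, 0 => 2^-1 * (u * a2 + w * b1)
  | 2, 0, 2 | 2, 2, 0 => 2^-1 * (w * a2 + v * b1)
  | 0, 2, 2 => 2^-1 * (u * (2 * c2 - b1) + w * b2)
  | 2, 2, 2 => 2^-1 * (w * (2 * c2 - b1) + v * b2)
  | 0, 1, 1 => - (2^-1 * (u * a1 + w * a2))
  | 2, 1, 1 => - (2^-1 * (w * a1 + v * a2))
  | 0, 1, 3 | 0, 3, 1 => - (2^-1 * (u * c1 + w * c2))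
  | 2, 1, 3 | 2, 3, 1 => - (2^-1 * (w * c1 + v * c2))
  | 0, 3, 3 => - (2^-1 * (u * b1 + w * b2))
  | 2, 3, 3 => - (2^-1 * (w * b1 + v * b2))
  | 1, 0, 1 | 1, 1, 0 => 2^-1 * (u * a1 + w * c1)
  | 3, 0, 1 | 3, 1, 0 => 2^-1 * (w * a1 + v * c1)
  | 1, 0, 3 | 1, 3, 0 => 2^-1 * (u * c1 + w * b1)
  | 3, 0, 3 | 3, 3, 0 => 2^-1 * (w * c1 + v * b1)
  | 1, 2, 1 | 1, 1, 2 => 2^-1 * (u * a2 + w * c2)
  | 3, 2, 1 | 3, 1, 2 => 2^-1 * (w * a2 + v * c2)
  | 1, 2, 3 | 1, 3, 2 => 2^-1 * (u * c2 + w * b2)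
  | 3, 2, 3 | 3, 3, 2 => 2^-1 * (w * c2 + v * b2)
  | _, _, _ => 0
  end.

(** The table holds for arbitrary a, b, c, without a Kahler relation between their derivatives: it
    has to serve for the conformal metric f^-2 g. *)
Lemma chrE (u v w a1 a2 b1 b2 c1 c2 : R) (k i j : 'I_4) :
  2^-1 * \sum_(l < 4) ent u v w k l * low a1 a2 b1 b2 c1 c2 i j l =
  chr u v w a1 a2 b1 b2 c1 c2 k i j.
Proof.
rewrite big_ord4 !inordK// /low.
by case: k => -[|[|[|[|//]]]] k4; case: i => -[|[|[|[|//]]]] i4;
  case: j => -[|[|[|[|//]]]] j4; rewrite /=; ring.
Qed.

End BlockMetric.

(* [is_derive] is a class: this transparent alias keeps instance resolution   *)
(* from instantiating the derivative while it is being computed.              *)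
Definition has_der {R : realType} (u : R -> R) (t d : R) : Prop :=
  is_derive t (1 : R) u d.

Section HasDer.
Context {R : realType}.
Implicit Types (u v : R -> R) (t du dv c : R).

Lemma has_derM u v t du dv : has_der u t du -> has_der v t dv ->
  has_der (fun t => u t * v t) t (du * v t + u t * dv).
Proof. exact: is_derive_mulr. Qed.

Lemma has_derD u v t du dv : has_der u t du -> has_der v t dv ->
  has_der (fun t => u t + v t) t (du + dv).
Proof. exact: is_derive_addr. Qed.

Lemma has_derN u t du : has_der u t du -> has_der (fun t => - u t) t (- du).
Proof. exact: is_derive_oppr. Qed.

Lemma has_der_cst c t : has_der (fun _ => c) t 0.
Proof. exact: is_derive_constr. Qed.

Lemma has_derV u t du : u t != 0 -> has_der u t du ->
  has_der (fun t => (u t)^-1) t (- (du * (u t)^-1 * (u t)^-1)).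
Proof. exact: is_derive_invr. Qed.

Lemma has_derX u t du n : has_der u t du ->
  has_der (fun t => u t ^+ n) t (n%:R * u t ^+ n.-1 * du).
Proof. exact: is_derive_exprn. Qed.

Lemma has_der_eq u t du du' : has_der u t du -> du = du' -> has_der u t du'.
Proof. by move=> h <-. Qed.

Lemma has_derE u t du : has_der u t du -> 'D_1 u t = du.
Proof. by case. Qed.

End HasDer.

(** Differentiates by recursion on the syntax, with hypotheses as atoms; [der] leaves the comparison
    with the announced derivative, usually a ring identity. *)
Ltac der_step :=
  first [exact: has_der_cst | eassumption | lazymatch goal with
  | |- has_der (fun t => - @?f t) _ _ => apply: (@has_derN _ f)
  | |- has_der (fun t => @?f t + @?g t) _ _ => apply: (@has_derD _ f g)
  | |- has_der (fun t => @?f t * @?g t) _ _ => apply: (@has_derM _ f g)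
  | |- has_der (fun t => @?f t ^+ ?n) _ _ => apply: (@has_derX _ f _ _ n)
  | |- has_der (fun t => (@?f t)^-1) _ _ => apply: (@has_derV _ f)
  end].

Ltac der := apply: has_der_eq; [repeat der_step|cbv beta].

(** * Symmetry of mixed derivatives *)

Section Schwarz.
Context {R : realType}.

Lemma MVT_right (u u' : R -> R) (t h : R) : 0 < h ->
  (forall s, is_derive s (1 : R) u (u' s)) ->
  exists2 s, t < s < t + h & u (t + h) - u t = h * u' s.
Proof.
move=> h0 du.
have th : t < t + h by rewrite ltrDl.
have cu : {within `[t, t + h], continuous u}.
  apply: continuous_subspaceT => s.
  by apply: differentiable_continuous; apply/derivable1_diffP; have [] := du s.
have [s] := MVT th (fun s _ => du s) cu.
rewrite in_itv/= => hs ->; exists s => //.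
by rewrite mulrC; congr (_ * _); ring.
Qed.

Lemma ltr_dist_right (s z h d : R) : z < s < z + h -> h < d -> `|s - z| < d.
Proof. by move=> /andP[? ?] ?; rewrite ltr_norml; apply/andP; split; lra. Qed.

Lemma ltr_distBB (a b c e : R) : `|a - b| < e -> `|a - c| < e ->
  `|c - b| < e + e.
Proof.
move=> ab ac; rewrite (_ : c - b = (a - b) - (a - c)); last by ring.
by apply: (le_lt_trans (ler_normB _ _)); exact: ltrD.
Qed.

Lemma mixed_difference (A B C D h p q : R) : h != 0 ->
  A - B - (C - D) = h * (h * p) -> A - C - (B - D) = h * (h * q) -> q = p.
Proof.
move=> h0 E1 E2; apply: (mulfI h0); apply: (mulfI h0); rewrite -E1 -E2; ring.
Qed.

(** The second difference of f over a square of side h is h^2 times each of the mixed derivatives at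
    some point of the square, by the mean value theorem used in either order. If the two differed at
    (x, y), a small square would contradict their continuity. *)
Lemma schwarz (f : R -> R -> R) : Cn 2 f -> D1 (D2 f) = D2 (D1 f).
Proof.
move=> cf; apply/funext => x; apply/funext => y; apply/eqP/negPn/negP => ne.
have c1 : cont2 (D1 (D2 f)) := Cn_cont2 (Cn_D1 (Cn_D2 cf)).
have c2 : cont2 (D2 (D1 f)) := Cn_cont2 (Cn_D2 (Cn_D1 cf)).
pose g s t := D1 (D2 f) s t - D2 (D1 f) s t.
pose e := `|g x y| / 2.
have e0 : 0 < e by rewrite divr_gt0// normr_gt0 subr_eq0.
have near_e (q : R -> R -> R) : cont2 q -> exists2 d, 0 < d &
    forall s t, `|s - x| < d -> `|t - y| < d -> `|q s t - q x y| < e.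
  move=> cq; have := cq (x, y).
  move/cvgrPdist_lt => /(_ e e0) /nbhs_ballP[d /= d0 hd]; exists d => // s t hs ht.
  rewrite distrC; apply: (hd (s, t)); split; rewrite /ball /= distrC.
    exact: hs.
  exact: ht.
have [d1 d10 h1] := near_e _ c1; have [d2 d20 h2] := near_e _ c2.
pose h := Num.min d1 d2 / 2.
have h0 : 0 < h by rewrite divr_gt0// lt_min d10.
have hd1 : h < d1.
  have m1 : Num.min d1 d2 <= d1 by rewrite ge_min lexx.
  by rewrite /h ltr_pdivrMr//; apply: (le_lt_trans m1); lra.
have hd2 : h < d2.
  have m2 : Num.min d1 d2 <= d2 by rewrite ge_min lexx orbT.
  by rewrite /h ltr_pdivrMr//; apply: (le_lt_trans m2); lra.
have [s1 s1x] := @MVT_right (fun s => f s (y + h) - f s y)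
   (fun s => D1 f s (y + h) - D1 f s y) x h h0
   (fun s => is_derive_addr (Cn_der1 s (y + h) cf) (is_derive_oppr (Cn_der1 s y cf))).
have [t1 t1y ->] := @MVT_right _ _ y h h0 (fun t => Cn_der2 s1 t (Cn_D1 cf)).
have [t2 t2y] := @MVT_right (fun t => f (x + h) t - f x t)
   (fun t => D2 f (x + h) t - D2 f x t) y h h0
   (fun t => is_derive_addr (Cn_der2 (x + h) t cf) (is_derive_oppr (Cn_der2 x t cf))).
have [s2 s2x ->] := @MVT_right _ _ x h h0 (fun s => Cn_der1 s t2 (Cn_D2 cf)).
move=> E2 E1.
have E : D1 (D2 f) s2 t2 = D2 (D1 f) s1 t1.
  by cbv beta in E1, E2; exact: (mixed_difference (lt0r_neq0 h0) E1 E2).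
have := h1 s2 t2 (ltr_dist_right s2x hd1) (ltr_dist_right t2y hd1).
have := h2 s1 t1 (ltr_dist_right s1x hd2) (ltr_dist_right t1y hd2).
rewrite E => k2 k1.
have := ltr_distBB k2 k1.
by rewrite -/(g x y) /e -splitr ltxx.
Qed.

End Schwarz.

Section BlockCurvature.
Context {R : realType}.
Implicit Types (F a b c : R -> R -> R) (x : 'rV[R]_4).

(** Leibniz rule: [chr] is bilinear in the inverse metric and in the first derivatives of the
    metric. *)
Lemma has_der_chr (u v w a1 a2 b1 b2 c1 c2 : R -> R)
   (t u' v' w' a1' a2' b1' b2' c1' c2' : R) (k i j : 'I_4) :
  has_der u t u' -> has_der v t v' -> has_der w t w' ->
  has_der a1 t a1' -> has_der a2 t a2' -> has_der b1 t b1' ->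
  has_der b2 t b2' -> has_der c1 t c1' -> has_der c2 t c2' ->
  has_der (fun t => chr (u t) (v t) (w t) (a1 t) (a2 t) (b1 t) (b2 t)
     (c1 t) (c2 t) k i j) t
   (chr u' v' w' (a1 t) (a2 t) (b1 t) (b2 t) (c1 t) (c2 t) k i j +
    chr (u t) (v t) (w t) a1' a2' b1' b2' c1' c2' k i j).
Proof.
move=> hu hv hw ha1 ha2 hb1 hb2 hc1 hc2.
case: k => -[|[|[|[|//]]]] k4; case: i => -[|[|[|[|//]]]] i4;
  case: j => -[|[|[|[|//]]]] j4; rewrite /=.
all: der.
all: ring.
Qed.

End BlockCurvature.

Section ScalarNumbers.
Context {R : realType}.

Definition sum4 (F : nat -> R) : R := F 0 + F 1 + F 2 + F 3.

(* d(H^-1) = - H^-1 dH H^-1, for [[u, w], [w, v]] = H^-1.                     *)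
Definition dinv_u (u v w da db dc : R) : R :=
  - (u * u * da + 2 * u * w * dc + w * w * db).
Definition dinv_v (u v w da db dc : R) : R :=
  - (w * w * da + 2 * w * v * dc + v * v * db).
Definition dinv_w (u v w da db dc : R) : R :=
  - (u * w * da + (u * v + w * w) * dc + w * v * db).

Definition dchr (u v w a1 a2 b1 b2 c1 c2 a11 a12 a22 b11 b12 b22 c11 c12 c22 : R)
    (i k l m : nat) : R :=
  match i with
  | 0 => chr (dinv_u u v w a1 b1 c1) (dinv_v u v w a1 b1 c1) (dinv_w u v w a1 b1 c1)
           a1 a2 b1 b2 c1 c2 k l m + chr u v w a11 a12 b11 b12 c11 c12 k l m
  | 2 => chr (dinv_u u v w a2 b2 c2) (dinv_v u v w a2 b2 c2) (dinv_w u v w a2 b2 c2)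
           a1 a2 b1 b2 c1 c2 k l m + chr u v w a12 a22 b12 b22 c12 c22 k l m
  | _ => 0
  end.

Definition ric_jet (u v w a1 a2 b1 b2 c1 c2 a11 a12 a22 b11 b12 b22 c11 c12 c22 : R)
    (j k : nat) : R :=
  let G := chr u v w a1 a2 b1 b2 c1 c2 in
  let dG := dchr u v w a1 a2 b1 b2 c1 c2 a11 a12 a22 b11 b12 b22 c11 c12 c22 in
  sum4 (fun i => dG i i j k - dG j i i k
    + sum4 (fun m => G i i m * G m j k - G i j m * G m i k)).

(** Scalar curvature as a function of plain numbers, the inverse metric and the derivatives of the
    metric up to order two, so that curvature identities become identities of rational functions. *)
Definition scal_jet (u v w a1 a2 b1 b2 c1 c2 a11 a12 a22 b11 b12 b22 c11 c12 c22 : R) : R :=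
  sum4 (fun j => sum4 (fun k => ent u v w j k *
    ric_jet u v w a1 a2 b1 b2 c1 c2 a11 a12 a22 b11 b12 b22 c11 c12 c22 j k)).

(** The conformal change s(f^-2 g) = f^2 s(g) + 6 f Lap f - 12 |df|^2 in dimension 4. The values
    given to [c1], [c2], [b11], [c11], [c12], [c22] say that H is a Hessian, which is where s(g) = -
    tr (H^-1 Hess log det H) and Lap f = tr (H^-1 Hess f) come from. The numbers [q], [q1], ...,
    [q22] are the derivatives of f^-2. *)
Lemma scal_jet_conformal (a b c f a1 a2 b1 b2 f1 f2 a11 a12 a22 b12 b22 f11 f12 f22 : R) :
  a * b - c ^+ 2 != 0 -> f != 0 ->
  let c1 := a2 in let c2 := b1 in
  let b11 := a22 in let c11 := a12 in let c12 := a22 in let c22 := b12 in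
  let d := a * b - c ^+ 2 in
  let d1 := a1 * b + a * b1 - 2 * c * c1 in
  let d2 := a2 * b + a * b2 - 2 * c * c2 in
  let d11 := a11 * b + 2 * a1 * b1 + a * b11 - 2 * c1 * c1 - 2 * c * c11 in
  let d12 := a12 * b + a1 * b2 + a2 * b1 + a * b12 - 2 * c1 * c2 - 2 * c * c12 in
  let d22 := a22 * b + 2 * a2 * b2 + a * b22 - 2 * c2 * c2 - 2 * c * c22 in
  let h := f^-1 in
  let h1 := - (f1 * h * h) in let h2 := - (f2 * h * h) in
  let q := h * h in
  let q1 := 2 * h * h1 in let q2 := 2 * h * h2 in
  let q11 := 6 * f1 * f1 * q * q - 2 * f11 * q * h in
  let q12 := 6 * f1 * f2 * q * q - 2 * f12 * q * h in
  let q22 := 6 * f2 * f2 * q * q - 2 * f22 * q * h in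
  scal_jet (f ^+ 2 * (b / d)) (f ^+ 2 * (a / d)) (f ^+ 2 * (- c / d))
    (a1 * q + a * q1) (a2 * q + a * q2) (b1 * q + b * q1) (b2 * q + b * q2)
    (c1 * q + c * q1) (c2 * q + c * q2)
    (a11 * q + 2 * a1 * q1 + a * q11) (a12 * q + a1 * q2 + a2 * q1 + a * q12)
    (a22 * q + 2 * a2 * q2 + a * q22)
    (b11 * q + 2 * b1 * q1 + b * q11) (b12 * q + b1 * q2 + b2 * q1 + b * q12)
    (b22 * q + 2 * b2 * q2 + b * q22)
    (c11 * q + 2 * c1 * q1 + c * q11) (c12 * q + c1 * q2 + c2 * q1 + c * q12)
    (c22 * q + 2 * c2 * q2 + c * q22)
  = f ^+ 2 * (- (b * (d11 / d - d1 * d1 / d ^+ 2) + a * (d22 / d - d2 * d2 / d ^+ 2)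
          - 2 * c * (d12 / d - d1 * d2 / d ^+ 2)) / d)
    + 6 * f * (b * f11 + a * f22 - 2 * c * f12) / d
    - 12 * (b * f1 * f1 + a * f2 * f2 - 2 * c * f1 * f2) / d.
Proof.
move=> d0 f0 /=.
rewrite /scal_jet /ric_jet /sum4 /dchr /= /dinv_u /dinv_v /dinv_w.
by field; rewrite d0 f0.
Qed.
End ScalarNumbers.

Section ScalarCurvatureBlock.
Context {R : realType}.
Implicit Types (F a b c : R -> R -> R) (x : 'rV[R]_4).

Definition met a b c x : 'M[R]_4 := block (lift2 a x) (lift2 b x) (lift2 c x).

Lemma sum4E (F : 'I_4 -> R) (G : nat -> R) : (forall i : 'I_4, F i = G i) ->
  \sum_(i < 4) F i = sum4 G.
Proof. by move=> FG; rewrite big_ord4 !FG !inordK. Qed.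

Variables a b c : R -> R -> R.
Hypotheses (ca : Cn 2 a) (cb : Cn 2 b) (cc : Cn 2 c).
Hypothesis d0 : forall y1 y2, a y1 y2 * b y1 y2 - c y1 y2 ^+ 2 != 0.

Let d y1 y2 := a y1 y2 * b y1 y2 - c y1 y2 ^+ 2.
Let u y1 y2 := b y1 y2 / d y1 y2.
Let v y1 y2 := a y1 y2 / d y1 y2.
Let w y1 y2 := - c y1 y2 / d y1 y2.

Let Chr (k i j : nat) y1 y2 := chr (u y1 y2) (v y1 y2) (w y1 y2)
  (D1 a y1 y2) (D2 a y1 y2) (D1 b y1 y2) (D2 b y1 y2) (D1 c y1 y2) (D2 c y1 y2) k i j.

Lemma partial_met (l i j : 'I_4) x : partial l (fun y => met a b c y i j) x =
  match nat_of_ord l with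
  | 0 => ent (lift2 (D1 a) x) (lift2 (D1 b) x) (lift2 (D1 c) x) i j
  | 2 => ent (lift2 (D2 a) x) (lift2 (D2 b) x) (lift2 (D2 c) x) i j
  | _ => 0
  end.
Proof.
have c0 (F : R -> R -> R) : F = (fun _ _ => 0) -> partial l (lift2 F) x = 0.
  move=> ->; rewrite partial_lift2 /lift2 /dir /D1 /D2.
  by case: (nat_of_ord l) => [|[|[|]]] *; rewrite ?derive_cst.
have -> : (fun y => met a b c y i j) =
    lift2 (fun y1 y2 => ent (a y1 y2) (b y1 y2) (c y1 y2) i j).
  by apply/funext => y; rewrite !mxE.
case: i => -[|[|[|[|//]]]] i4; case: j => -[|[|[|[|//]]]] j4; rewrite /ent /=;
  first [by rewrite c0//; case: (nat_of_ord l) => [|[|[|]]]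
        |by rewrite partial_lift2 /dir /=; case: (nat_of_ord l) => [|[|[|]]]].
Qed.

Lemma christoffel_met (k i j : 'I_4) :
  christoffel (met a b c) k i j = lift2 (Chr k i j).
Proof.
apply/funext => x; rewrite /christoffel /lift2 /Chr -chrE; congr (_ * _).
apply: eq_bigr => l _; rewrite !partial_met.
rewrite /met invmx_block ?mxE; last exact: d0.
by congr (_ * _); rewrite /low.
Qed.

Lemma has_der_inverse (f g h : R -> R) (t f' g' h' : R) :
  f t * g t - h t ^+ 2 != 0 ->
  has_der f t f' -> has_der g t g' -> has_der h t h' ->
  let e t := f t * g t - h t ^+ 2 in
  let p := g t / e t in let q := f t / e t in let r := - h t / e t in
  [/\ has_der (fun t => g t / e t) t (dinv_u p q r f' g' h'),
      has_der (fun t => f t / e t) t (dinv_v p q r f' g' h') &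
      has_der (fun t => - h t / e t) t (dinv_w p q r f' g' h')].
Proof.
move=> e0 hf hg hh /=; rewrite /dinv_u /dinv_v /dinv_w.
by split; der; field; exact: e0.
Qed.

Let dC (F : R -> R -> R) y1 y2 : Cn 2 F ->
  [/\ has_der (F ^~ y2) y1 (D1 F y1 y2),
      has_der (F y1) y2 (D2 F y1 y2),
      has_der ((D1 F) ^~ y2) y1 (D1 (D1 F) y1 y2),
      has_der ((D2 F) ^~ y2) y1 (D1 (D2 F) y1 y2) &
      has_der (D1 F y1) y2 (D1 (D2 F) y1 y2) /\
      has_der (D2 F y1) y2 (D2 (D2 F) y1 y2)].
Proof.
move=> cF; have h12 := Cn_der2 y1 y2 (Cn_D1 cF).
rewrite -(schwarz cF) in h12.
have h1 := Cn_der1 y1 y2 cF; have h2 := Cn_der2 y1 y2 cF.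
have h11 := Cn_der1 y1 y2 (Cn_D1 cF); have h21 := Cn_der1 y1 y2 (Cn_D2 cF).
have h22 := Cn_der2 y1 y2 (Cn_D2 cF).
exact: (And5 h1 h2 h11 h21 (conj h12 h22)).
Qed.

Let dChr (k i j : 'I_4) (l : 'I_4) x :
  partial l (christoffel (met a b c) k i j) x =
  let y1 := x 0 (inord 0) in let y2 := x 0 (inord 2) in
  dchr (u y1 y2) (v y1 y2) (w y1 y2)
    (D1 a y1 y2) (D2 a y1 y2) (D1 b y1 y2) (D2 b y1 y2) (D1 c y1 y2) (D2 c y1 y2)
    (D1 (D1 a) y1 y2) (D1 (D2 a) y1 y2) (D2 (D2 a) y1 y2)
    (D1 (D1 b) y1 y2) (D1 (D2 b) y1 y2) (D2 (D2 b) y1 y2)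
    (D1 (D1 c) y1 y2) (D1 (D2 c) y1 y2) (D2 (D2 c) y1 y2) l k i j.
Proof.
rewrite christoffel_met partial_lift2 /lift2 /=.
move: (x 0 (inord 0)) (x 0 (inord 2)) => y1 y2.
have [a1 a2 a11 a12 [a12' a22]] := dC y1 y2 ca.
have [b1 b2 b11 b12 [b12' b22]] := dC y1 y2 cb.
have [c1 c2 c11 c12 [c12' c22]] := dC y1 y2 cc.
have [u1 v1 w1] := has_der_inverse (d0 y1 y2) a1 b1 c1.
have [u2 v2 w2] := has_der_inverse (d0 y1 y2) a2 b2 c2.
case: l => -[|[|[|[|//]]]] l4; rewrite /dir /dchr //=.
- exact: (has_derE (has_der_chr k i j u1 v1 w1 a11 a12 b11 b12 c11 c12)).
- exact: (has_derE (has_der_chr k i j u2 v2 w2 a12' a22 b12' b22 c12' c22)).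
Qed.

Lemma scalar_curvature_met x :
  scalar_curvature (met a b c) x =
  let y1 := x 0 (inord 0) in let y2 := x 0 (inord 2) in
  scal_jet (u y1 y2) (v y1 y2) (w y1 y2)
    (D1 a y1 y2) (D2 a y1 y2) (D1 b y1 y2) (D2 b y1 y2) (D1 c y1 y2) (D2 c y1 y2)
    (D1 (D1 a) y1 y2) (D1 (D2 a) y1 y2) (D2 (D2 a) y1 y2)
    (D1 (D1 b) y1 y2) (D1 (D2 b) y1 y2) (D2 (D2 b) y1 y2)
    (D1 (D1 c) y1 y2) (D1 (D2 c) y1 y2) (D2 (D2 c) y1 y2).
Proof.
rewrite /scalar_curvature /scal_jet /=.
apply: sum4E => j; apply: sum4E => k.
rewrite {1}/met invmx_block; last exact: d0.
rewrite mxE; congr (_ * _); rewrite /ricci /ric_jet.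
apply: sum4E => i; rewrite !dChr /=; congr (_ + _).
by apply: sum4E => m; rewrite !christoffel_met.
Qed.

End ScalarCurvatureBlock.

(** * Toric data and the divergence theorem on the orbit *)

Section RationalFunctions.
Context {R : realType}.

(** Rational functions of (mu_1, mu_2) are kept as syntax, so that their derivatives, their domains
    and their smoothness in every chart are obtained once for all by recursion. *)
Inductive ratexp : Type :=
  | EX | EY | EC of R | EAdd of ratexp & ratexp | EMul of ratexp & ratexp
  | EInv of ratexp.

Fixpoint eval (E : ratexp) (x y : R) : R :=
  match E with
  | EX => x
  | EY => y
  | EC c => c
  | EAdd E1 E2 => eval E1 x y + eval E2 x y
  | EMul E1 E2 => eval E1 x y * eval E2 x y
  | EInv E1 => (eval E1 x y)^-1
  end.

Fixpoint defined (E : ratexp) (x y : R) : Prop :=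
  match E with
  | EAdd E1 E2 | EMul E1 E2 => defined E1 x y /\ defined E2 x y
  | EInv E1 => eval E1 x y != 0 /\ defined E1 x y
  | _ => True
  end.

(* [b] selects the variable: the first if [b], else the second.               *)
Fixpoint diffE (b : bool) (E : ratexp) : ratexp :=
  match E with
  | EX => EC (if b then 1 else 0)
  | EY => EC (if b then 0 else 1)
  | EC _ => EC 0
  | EAdd E1 E2 => EAdd (diffE b E1) (diffE b E2)
  | EMul E1 E2 => EAdd (EMul (diffE b E1) E2) (EMul E1 (diffE b E2))
  | EInv E1 => EMul (EMul (EC (- 1)) (diffE b E1)) (EMul (EInv E1) (EInv E1))
  end.

Lemma defined_diffE b E x y : defined E x y -> defined (diffE b E) x y.
Proof.
elim: E => //= [E1 IH1 E2 IH2 [h1 h2]|E1 IH1 E2 IH2 [h1 h2]|E1 IH1 [h0 h1]].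
- by split; [exact: IH1|exact: IH2].
- by split; split => //; [exact: IH1|exact: IH2].
- by split; split => //; exact: IH1.
Qed.

Lemma has_der_eval E (u v : R -> R) (t u' v' : R) : defined E (u t) (v t) ->
  has_der u t u' -> has_der v t v' ->
  has_der (fun t => eval E (u t) (v t)) t
    (eval (diffE true E) (u t) (v t) * u' + eval (diffE false E) (u t) (v t) * v').
Proof.
move=> + hu hv; elim: E => /=
  [_|_|c _|E1 IH1 E2 IH2 [h1 h2]|E1 IH1 E2 IH2 [h1 h2]|E1 IH1 [h0 h1]].
- by apply: (has_der_eq hu); ring.
- by apply: (has_der_eq hv); ring.
- by apply: (has_der_eq (has_der_cst c t)); ring.
- by apply: (has_der_eq (has_derD (IH1 h1) (IH2 h2))); ring.
- by apply: (has_der_eq (has_derM (IH1 h1) (IH2 h2))); ring.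
- by apply: (has_der_eq (@has_derV _ (fun t => eval E1 (u t) (v t)) _ _ h0 (IH1 h1)));
    ring.
Qed.

Lemma Cn_eval n E (u v : R -> R -> R) : (forall x y, defined E (u x y) (v x y)) ->
  Cn n u -> Cn n v -> Cn n (fun x y => eval E (u x y) (v x y)).
Proof.
move=> + cu cv; elim: E => /= [_|_|c _|E1 IH1 E2 IH2 h|E1 IH1 E2 IH2 h|E1 IH1 h].
- exact: cu.
- exact: cv.
- exact: Cn_cst.
- by apply: CnD; [apply: IH1|apply: IH2] => x y; case: (h x y).
- by apply: CnM; [apply: IH1|apply: IH2] => x y; case: (h x y).
- apply: CnV; first by move=> x y; case: (h x y).
  by apply: IH1 => x y; case: (h x y).
Qed.

End RationalFunctions.
Arguments ratexp : clear implicits.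

Section ToricData.
Context {R : realType}.

(* The restriction of an invariant Kahler metric to the real slices of the    *)
(* charts: [M1], [M2] are the moment map coordinates, and [cA], [cB], [cC] the *)
(* metric coefficients; [m1] ... [f22] are the corresponding functions on     *)
(* the orbit, in the coordinates [(y1, y2)].                                  *)
Record toric_data (p q : R) := ToricData {
  M1 : chart -> R -> R -> R; M2 : chart -> R -> R -> R;
  cA : chart -> R -> R -> R; cB : chart -> R -> R -> R; cC : chart -> R -> R -> R;
  m1 : R -> R -> R; m2 : R -> R -> R;
  f11 : R -> R -> R; f12 : R -> R -> R; f22 : R -> R -> R;
  M1_smooth : forall e, smooth2 (M1 e); M2_smooth : forall e, smooth2 (M2 e);
  cA_smooth : forall e, smooth2 (cA e); cB_smooth : forall e, smooth2 (cB e);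
  cC_smooth : forall e, smooth2 (cC e);
  det_chart : forall e r1 r2, cA e r1 r2 * cB e r1 r2 - cC e r1 r2 ^+ 2 != 0;
  m1E : charted M1 m1; m2E : charted M2 m2;
  f11E : charted (fun e r1 r2 => r1 ^+ 2 * cA e r1 r2) f11;
  f12E : charted (fun e r1 r2 => sg e.1 * sg e.2 * r1 * r2 * cC e r1 r2) f12;
  f22E : charted (fun e r1 r2 => r2 ^+ 2 * cB e r1 r2) f22;
  D1m1 : D1 m1 = f11; D2m1 : D2 m1 = f12;
  D1m2 : D1 m2 = f12; D2m2 : D2 m2 = f22;
  M1_range : forall e r1 r2, 0 <= M1 e r1 r2 <= p;
  M2_range : forall e r1 r2, 0 <= M2 e r1 r2 <= q;
  M1_edge : forall e r, M1 e 0 r = if e.1 then p else 0;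
  M2_edge : forall e r, M2 e r 0 = if e.2 then q else 0
}.

Lemma det_charted (b1 b2 : bool) (r1 r2 A B C : R) :
  r1 ^+ 2 * A * (r2 ^+ 2 * B) - (sg b1 * sg b2 * r1 * r2 * C) ^+ 2 =
  r1 ^+ 2 * r2 ^+ 2 * (A * B - C ^+ 2).
Proof. by rewrite !sgE; case: b1; case: b2; ring. Qed.

Lemma charted_swap (S : chart -> R -> R -> R) W : charted S W ->
  charted (fun e r1 r2 => S (e.2, e.1) r2 r1) (fun y1 y2 => W y2 y1).
Proof. by move=> SW e y1 y2; rewrite (SW (e.2, e.1)). Qed.

Lemma smooth2_swap (f : R -> R -> R) : smooth2 f -> smooth2 (fun x y => f y x).
Proof. by move=> sf n; exact: Cn_swap. Qed.

(** Exchange of the two factors. Both sides p and q of the rectangle are kept general, although the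
    second is 1 in the end, so that toric data are stable under it and one component of each field
    suffices. *)
Definition swap_data p q (T : toric_data p q) : toric_data q p.
Proof.
refine (@ToricData q p
  (fun e r1 r2 => M2 T (e.2, e.1) r2 r1) (fun e r1 r2 => M1 T (e.2, e.1) r2 r1)
  (fun e r1 r2 => cB T (e.2, e.1) r2 r1) (fun e r1 r2 => cA T (e.2, e.1) r2 r1)
  (fun e r1 r2 => cC T (e.2, e.1) r2 r1)
  (fun y1 y2 => m2 T y2 y1) (fun y1 y2 => m1 T y2 y1)
  (fun y1 y2 => f22 T y2 y1) (fun y1 y2 => f12 T y2 y1) (fun y1 y2 => f11 T y2 y1)
  _ _ _ _ _ _ _ _ _ _ _ _ _ _ _ _ _ _ _).
- by move=> e; exact/smooth2_swap/M2_smooth.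
- by move=> e; exact/smooth2_swap/M1_smooth.
- by move=> e; exact/smooth2_swap/cB_smooth.
- by move=> e; exact/smooth2_swap/cA_smooth.
- by move=> e; exact/smooth2_swap/cC_smooth.
- by move=> e r1 r2; rewrite mulrC; exact: det_chart.
- exact: charted_swap (m2E T).
- exact: charted_swap (m1E T).
- exact: charted_swap (f22E T).
- move=> e y1 y2; rewrite (f12E T (e.2, e.1)) /=.
  by rewrite [sg e.2 * sg e.1]mulrC [X in X * cC _ _ _ _]mulrAC.
- exact: charted_swap (f11E T).
- by rewrite -(D2m2 T).
- by rewrite -(D1m2 T).
- by rewrite -(D2m1 T).
- by rewrite -(D1m1 T).
- by move=> e r1 r2; exact: M2_range.
- by move=> e r1 r2; exact: M1_range.
- by move=> e r; exact: (M2_edge T (e.2, e.1)).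
- by move=> e r; exact: (M1_edge T (e.2, e.1)).
Defined.

(** Extends an identity from the open orbit to the edge r1 = 0 by continuity, along the points exp
    (- n). *)
Lemma cont2_edge (f g : R -> R -> R) (r : R) : cont2 f -> cont2 g -> 0 < r ->
  (forall s, 0 < s -> f s r = g s r) -> f 0 r = g 0 r.
Proof.
move=> cf cg r0 fg.
have lim0 (k : R -> R -> R) : cont2 k ->
    k (expR (- n%:R)) r @[n --> \oo] --> k 0 r.
  move=> ck; apply: (cvg_comp (fun n => expR (- n%:R : R)) (k ^~ r) (@cvg_expRN R)).
  exact: cont2_1.
have l2 := lim0 _ cg; have := lim0 _ cf.
have -> : (fun n : nat => f (expR (- n%:R)) r) = fun n => g (expR (- n%:R)) r.
  by apply/funext => n; rewrite fg ?expR_gt0.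
move=> l1; exact: (cvg_unique (@Rhausdorff R) l1 l2).
Qed.

Variables (p q : R) (T : toric_data p q).

Lemma charted_smooth (S : chart -> R -> R -> R) W : charted S W ->
  (forall e, smooth2 (S e)) -> smooth2 W.
Proof.
move=> SW sS n; pose e : chart := (false, false).
have -> : W = fun y1 y2 => S e (expR (sg e.1 * y1)) (expR (sg e.2 * y2)).
  by apply/funext => y1; apply/funext => y2; exact: SW.
exact/Cn_comp_expR/sS.
Qed.

Lemma m1_smooth : smooth2 (m1 T).
Proof. exact: charted_smooth (m1E T) (M1_smooth T). Qed.

Lemma m2_smooth : smooth2 (m2 T).
Proof. exact: charted_smooth (m2E T) (M2_smooth T). Qed.

Lemma f11_smooth : smooth2 (f11 T).
Proof. by rewrite -(D1m1 T); exact/smooth2_D1/m1_smooth. Qed.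

Lemma f12_smooth : smooth2 (f12 T).
Proof. by rewrite -(D2m1 T); exact/smooth2_D2/m1_smooth. Qed.

Lemma f22_smooth : smooth2 (f22 T).
Proof. by rewrite -(D2m2 T); exact/smooth2_D2/m2_smooth. Qed.

(** The rows of H are the gradients of the moment coordinates, so the mixed derivatives of mu_1
    agree; [D1f22] is the same for mu_2. Equivalently, the adjugate of H is divergence free. *)
Lemma D2f11 : D2 (f11 T) = D1 (f12 T).
Proof. by rewrite -(D1m1 T) -(D2m1 T) schwarz//; exact: m1_smooth. Qed.

Lemma D1f22 : D1 (f22 T) = D2 (f12 T).
Proof. by rewrite -(D2m2 T) -(D1m2 T) -schwarz//; exact: m2_smooth. Qed.

Lemma det_orbit y1 y2 : f11 T y1 y2 * f22 T y1 y2 - f12 T y1 y2 ^+ 2 != 0.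
Proof.
pose e : chart := (false, false).
rewrite (f11E T e) (f22E T e) (f12E T e).
set r1 := expR _; set r2 := expR _.
have r10 : r1 != 0 by rewrite gt_eqF ?expR_gt0.
have r20 : r2 != 0 by rewrite gt_eqF ?expR_gt0.
rewrite det_charted !mulf_neq0 ?expf_neq0//; exact: det_chart.
Qed.

(** Along an edge r1 = 0 the coefficient r [cB] that appears in the fluxes is the derivative of
    mu_2, so a flux through the edge is an integral in d mu_2. *)
Lemma D2M2_edge b (r : R) : 0 < r ->
  D2 (M2 T (b, false)) 0 r = r * cB T (b, false) 0 r.
Proof.
move=> r0.
have cc : cont2 (fun r1 r2 => r2 * cB T (b, false) r1 r2).
  exact: (Cn_cont2 (CnM (Cn_snd 0) (cB_smooth T _ 0%N))).
have cD : cont2 (D2 (M2 T (b, false))) by exact/smooth2_cont2/smooth2_D2/M2_smooth.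
apply: (cont2_edge cD cc r0) => s s0.
pose y1 := sg b * ln s; pose y2 := ln r.
have e1 : expR (sg b * y1) = s by rewrite mulrA sg2 mul1r lnK.
have e2 : expR (1 * y2) = r by rewrite mul1r lnK.
have := is_derive_comp_expR (t := y2) (s := 1)
  (smooth2_der2 s (expR (1 * y2)) (M2_smooth T (b, false))).
rewrite e2 mul1r => h.
have E : (fun t => M2 T (b, false) s (expR (1 * t))) = m2 T y1.
  by apply/funext => t; rewrite (m2E T (b, false)) /= e1 (sgE false).
rewrite E in h.
have := @derive_val _ _ _ _ _ _ _ h.
rewrite -/(D2 (m2 T) y1 y2) (D2m2 T) (f22E T (b, false)) /= e1 (sgE false) e2.
rewrite expr2 -mulrA => k; apply: (mulfI (lt0r_neq0 r0)); exact: esym.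
Qed.

Lemma M2_edge_glue b y : M2 T (b, false) 0 (expR y) = M2 T (b, true) 0 (expR (- y)).
Proof.
have c1 : cont2 (fun r1 r2 => M2 T (b, false) r1 (expR y)).
  by apply: (cont2_pair (v := fun=> expR y)) (smooth2_cont2 (M2_smooth T (b, false)));
    [move=> ?; exact: cvg_id|exact: cst_continuous].
have c2 : cont2 (fun r1 r2 => M2 T (b, true) r1 (expR (- y))).
  by apply: (cont2_pair (v := fun=> expR (- y))) (smooth2_cont2 (M2_smooth T (b, true)));
    [move=> ?; exact: cvg_id|exact: cst_continuous].
apply: (@cont2_edge _ _ 1 c1 c2 ltr01) => s s0.
pose y1 := sg b * ln s.
have e1 : expR (sg b * y1) = s by rewrite mulrA sg2 mul1r lnK.
have := m2E T (b, false) y1 y; rewrite (m2E T (b, true)) /= e1.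
by rewrite (sgE false) (sgE true) mul1r mulN1r.
Qed.

End ToricData.

(** * Integrals over the rectangle as fluxes *)

Section VolumeIntegral.
Context {R : realType}.
Variables (p q : R) (T : toric_data p q).

Definition in_box (E : ratexp R) := forall x y, 0 <= x <= p -> 0 <= y <= q ->
  defined E x y.

(* The function [E] of the moment map, on the orbit and in the chart [e].      *)
Definition orb (E : ratexp R) y1 y2 := eval E (m1 T y1 y2) (m2 T y1 y2).

Definition che (E : ratexp R) (e : chart) r1 r2 :=
  eval E (M1 T e r1 r2) (M2 T e r1 r2).

Definition corner (E : ratexp R) (e : chart) :=
  eval E (if e.1 then p else 0) (if e.2 then q else 0).

Definition vol y1 y2 := f11 T y1 y2 * f22 T y1 y2 - f12 T y1 y2 ^+ 2.

Lemma orbE E : charted (che E) (orb E).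
Proof. by move=> e y1 y2; rewrite /orb /che (m1E T e) (m2E T e). Qed.

Lemma in_box_diffE b E : in_box E -> in_box (diffE b E).
Proof. by move=> h x y hx hy; apply: defined_diffE; exact: h. Qed.

Lemma defined_che E e r1 r2 : in_box E -> defined E (M1 T e r1 r2) (M2 T e r1 r2).
Proof. by apply; [exact: M1_range|exact: M2_range]. Qed.

Lemma che_smooth E e : in_box E -> smooth2 (che E e).
Proof.
move=> h n; apply: Cn_eval; [|exact: M1_smooth|exact: M2_smooth] => r1 r2.
exact: defined_che.
Qed.

Lemma orb_smooth E : in_box E -> smooth2 (orb E).
Proof.
by move=> h; apply: (charted_smooth (orbE E)) => e; exact: che_smooth.
Qed.

Lemma defined_orb E y1 y2 : in_box E -> defined E (m1 T y1 y2) (m2 T y1 y2).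
Proof.
move=> h; rewrite (m1E T (false, false)) (m2E T (false, false)).
exact: defined_che.
Qed.

Lemma orb_der1 E y1 y2 : in_box E ->
  has_der (orb E ^~ y2) y1
    (orb (diffE true E) y1 y2 * f11 T y1 y2 + orb (diffE false E) y1 y2 * f12 T y1 y2).
Proof.
move=> h; apply: has_der_eval; first exact: defined_orb.
- by rewrite -(D1m1 T); exact: smooth2_der1 (m1_smooth T).
- by rewrite -(D1m2 T); exact: smooth2_der1 (m2_smooth T).
Qed.

Lemma orb_der2 E y1 y2 : in_box E ->
  has_der (orb E y1) y2
    (orb (diffE true E) y1 y2 * f12 T y1 y2 + orb (diffE false E) y1 y2 * f22 T y1 y2).
Proof.
move=> h; apply: has_der_eval; first exact: defined_orb.
- by rewrite -(D2m1 T); exact: smooth2_der2 (m1_smooth T).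
- by rewrite -(D2m2 T); exact: smooth2_der2 (m2_smooth T).
Qed.

Let edge_x (e : chart) : R := if e.1 then p else 0.

Lemma edge_x_range e : 0 <= edge_x e <= p.
Proof. by have := M1_range T e 0 0; rewrite M1_edge. Qed.

Lemma edge_der (E : ratexp R) e (r : R) : in_box E ->
  has_der (fun r => eval E (edge_x e) (M2 T e 0 r)) r
    (eval (diffE false E) (edge_x e) (M2 T e 0 r) * D2 (M2 T e) 0 r).
Proof.
move=> h.
have d : defined E (edge_x e) (M2 T e 0 r).
  by apply: h; [exact: edge_x_range|exact: M2_range].
have := has_der_eval (u := fun=> edge_x e) (v := M2 T e 0) d
  (has_der_cst _ _) (smooth2_der2 0 r (M2_smooth T e)).
by rewrite mulr0 add0r.
Qed.

Lemma edge_der_cont (E : ratexp R) e : in_box E ->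
  continuous (fun r => eval (diffE false E) (edge_x e) (M2 T e 0 r) * D2 (M2 T e) 0 r).
Proof.
move=> h; apply: continuous_mulr.
  have := cont2_2 (x := 0) (smooth2_cont2 (che_smooth e (in_box_diffE false h))).
  have -> : che (diffE false E) e 0 =
     fun r => eval (diffE false E) (edge_x e) (M2 T e 0 r) => //.
  by apply/funext => r; rewrite /che M1_edge.
exact/cont2_2/smooth2_cont2/smooth2_D2/M2_smooth.
Qed.

(** The flux of a field whose boundary value on an edge is k E'(mu_2) d mu_2: the antiderivative
    along the edge is k E, read at its two ends. *)
Lemma flux1_edges (S : chart -> R -> R -> R) W (k : bool -> R) (E : ratexp R) :
  flux1 S W -> in_box E ->
  (forall b r, 0 < r -> S (b, false) 0 r =
     k b * (eval (diffE false E) (edge_x (b, false)) (M2 T (b, false) 0 r) *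
     (r * cB T (b, false) 0 r))) ->
  int2 (D1 W) = corners (fun e => k e.1 * corner E e).
Proof.
move=> fW hE hS.
have dN e (r : R) : is_derive r 1 (fun r => k e.1 * eval E (edge_x e) (M2 T e 0 r))
    (k e.1 * (eval (diffE false E) (edge_x e) (M2 T e 0 r) * D2 (M2 T e) 0 r)).
  have := has_derM (has_der_cst (k e.1) r) (edge_der e r hE).
  by rewrite mul0r add0r.
have cN e : continuous (fun r =>
    k e.1 * (eval (diffE false E) (edge_x e) (M2 T e 0 r) * D2 (M2 T e) 0 r)).
  apply: (@continuous_mulr _ (fun=> k e.1)); first exact: cst_continuous.
  exact: edge_der_cont.
have := flux1_int2 fW dN cN; rewrite /= /corner => ->.
- by rewrite /corners /= !M2_edge.
- by move=> b y; rewrite M2_edge_glue.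
- by move=> b r r0; rewrite hS// D2M2_edge.
Qed.

Lemma orb_vol_tame E : in_box E ->
  let F y1 y2 := orb E y1 y2 * vol y1 y2 in cont2 F /\ dom2 F.
Proof.
move=> hE; apply: (@charted_tame _ (fun e r1 r2 => r1 * r2 *
  (cA T e r1 r2 * cB T e r1 r2 - cC T e r1 r2 ^+ 2) * che E e r1 r2)) => [e|e y1 y2].
  apply: CnM; last exact: che_smooth.
  apply: CnM; first by apply: CnM; [exact: Cn_fst|exact: Cn_snd].
  apply: CnD; first by apply: CnM; [exact: cA_smooth|exact: cB_smooth].
  by apply/CnN/CnX; exact: cC_smooth.
rewrite /vol (f11E T e) (f22E T e) (f12E T e) det_charted (orbE E e).
cbv beta; set r1 := expR _; set r2 := expR (sg e.2 * y2).
move: (che E e r1 r2) (_ - _) => k d; ring.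
Qed.

Lemma orb_box y1 y2 : 0 <= m1 T y1 y2 <= p /\ 0 <= m2 T y1 y2 <= q.
Proof.
rewrite (m1E T (false, false)) (m2E T (false, false)).
by split; [exact: M1_range|exact: M2_range].
Qed.

(** Since [vol] dy1 dy2 is the pullback of d mu_1 d mu_2, the integrand is d (E1 d mu_2). In
    coordinates this is the divergence of (f22 E1, - f12 E1), by the vanishing divergence of the
    adjugate of H. *)
Lemma volume_integral E E1 E2 : in_box E -> in_box E1 ->
  (forall x y, 0 <= x <= p -> 0 <= y <= q -> eval (diffE false E) x y = eval E1 x y) ->
  (forall x y, 0 <= x <= p -> 0 <= y <= q -> eval (diffE true E1) x y = eval E2 x y) ->
  int2 (fun y1 y2 => orb E2 y1 y2 * vol y1 y2) = corners (corner E).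
Proof.
move=> hE hE1 dE dE1.
pose W1 y1 y2 := f22 T y1 y2 * orb E1 y1 y2.
pose W2 y1 y2 := f12 T y1 y2 * orb E1 y1 y2.
pose S1 e r1 r2 := r2 * cB T e r1 r2 * che E1 e r1 r2.
pose S2 (e : chart) r1 r2 := sg e.1 * sg e.2 * r2 * cC T e r1 r2 * che E1 e r1 r2.
have fl1 : flux1 S1 W1.
  split=> [e|e y1 y2].
    apply: CnM; last exact: che_smooth.
    by apply: CnM; [exact: Cn_snd|exact: cB_smooth].
  by rewrite /W1 (f22E T e) (orbE E1 e) /S1 expr2 !mulrA.
have fl2 : flux2 S2 W2.
  split=> [e|e y1 y2].
    apply: CnM; last exact: che_smooth.
    apply: CnM; last exact: cC_smooth.
    by apply: CnM; [exact: Cn_cst|exact: Cn_snd].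
  rewrite /W2 (f12E T e) (orbE E1 e) /S2 !mulrA; congr (_ * _ * _ * _).
  by rewrite mulrC mulrA.
have FE : (fun y1 y2 => orb E2 y1 y2 * vol y1 y2) =
    fun y1 y2 => D1 W1 y1 y2 + -1 * D2 W2 y1 y2.
  apply/funext => y1; apply/funext => y2.
  have [b1 b2] := orb_box y1 y2.
  have d1 := has_derM (smooth2_der1 y1 y2 (f22_smooth T)) (orb_der1 y1 y2 hE1).
  have d2 := has_derM (smooth2_der2 y1 y2 (f12_smooth T)) (orb_der2 y1 y2 hE1).
  rewrite [D1 W1 y1 y2](has_derE d1) [D2 W2 y1 y2](has_derE d2) D1f22 /vol.
  rewrite {1}/orb -dE1// -/(orb _ _ _).
  move: (D2 _ _ _) (f11 _ _ _) (f12 _ _ _) (f22 _ _ _) (orb _ _ _) (orb _ _ _)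
    (orb _ _ _) => *; ring.
rewrite FE.
have [c1 o1] := flux1_tame fl1; have [c2 o2] := flux2_tame fl2.
have c2' := @cont2Z _ (-1) _ c2; have o2' := @dom2Z _ (-1) _ o2.
rewrite int2D// int2Z//.
(* On the edges r2 = 0 the coordinate mu_2 is constant, so E1 d mu_2 has no flux: [S2] carries a
   factor r2. *)
have -> : int2 (D2 W2) = 0.
  have := @flux2_int2 _ _ _ (fun _ _ => 0) (fun _ _ => 0) fl2.
  move=> -> //; first by rewrite /corners; ring.
  - by move=> e; exact: cst_continuous.
  - by move=> b r r0; rewrite /S2 mulr0 !mul0r.
rewrite mulr0 addr0 (@flux1_edges _ _ (fun=> 1) E fl1 hE).
  by congr corners; apply/funext => e; rewrite mul1r.
move=> b r r0; rewrite /S1 /che M1_edge mul1r dE; [by rewrite mulrC|exact: edge_x_range|].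
exact: M2_range.
Qed.

End VolumeIntegral.

(** * The weighted scalar curvature as a divergence *)

Section CurvatureField.
Context {R : realType}.

(* The first component (the second one after exchanging the variables) of a    *)
(* field with divergence s f^-5 l d, s the scalar curvature of f^-2 g: here    *)
(* H = [[a, c], [c, b]], d = det H, the suffixes 1, 2 stand for derivatives,   *)
(* and [al], [la] are the coefficients of mu_1 in f and l.                     *)
Definition Wg (f l b c d d1 d2 al la : R) : R :=
  let h := f^-1 in
  - (h ^+ 3 * l * (b * (d1 / d) - c * (d2 / d))) + 3 * h ^+ 4 * l * d * al
  + h ^+ 3 * d * la.

Definition Wf (f l a b c a1 a2 b1 b2 al la : R) : R :=
  Wg f l b c (a * b - c ^+ 2) (a1 * b + a * b1 - 2 * c * a2)
    (a2 * b + a * b2 - 2 * c * b1) al la.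

Definition dWg (f l b c d d1 d2 al la f' l' b' c' d' d1' d2' : R) : R :=
  let h := f^-1 in let h' := - (f' * h * h) in
  - ((3 * h ^+ 2 * h' * l + h ^+ 3 * l') * (b * (d1 / d) - c * (d2 / d))
     + h ^+ 3 * l * (b' * (d1 / d) + b * (d1' / d - d1 * d' / d ^+ 2)
         - c' * (d2 / d) - c * (d2' / d - d2 * d' / d ^+ 2)))
  + 3 * (4 * h ^+ 3 * h' * l * d + h ^+ 4 * l' * d + h ^+ 4 * l * d') * al
  + (3 * h ^+ 2 * h' * d + h ^+ 3 * d') * la.

Lemma has_der_Wg (f l b c d d1 d2 : R -> R) (t al la f' l' b' c' d' d1' d2' : R) :
  f t != 0 -> d t != 0 ->
  has_der f t f' -> has_der l t l' -> has_der b t b' -> has_der c t c' ->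
  has_der d t d' -> has_der d1 t d1' -> has_der d2 t d2' ->
  has_der (fun t => Wg (f t) (l t) (b t) (c t) (d t) (d1 t) (d2 t) al la) t
    (dWg (f t) (l t) (b t) (c t) (d t) (d1 t) (d2 t) al la f' l' b' c' d' d1' d2').
Proof.
move=> f0 d0 *; rewrite /Wg /dWg; der.
by field; rewrite f0 d0.
Qed.

Definition dWf (f l a b c a1 a2 b1 b2 al la f' l' a' b' c' a1' a2' b1' b2' : R) : R :=
  dWg f l b c (a * b - c ^+ 2) (a1 * b + a * b1 - 2 * c * a2)
    (a2 * b + a * b2 - 2 * c * b1) al la f' l' b' c' 
    (a' * b + a * b' - 2 * c * c')
    (a1' * b + a1 * b' + a' * b1 + a * b1' - 2 * (c' * a2 + c * a2'))
    (a2' * b + a2 * b' + a' * b2 + a * b2' - 2 * (c' * b1 + c * b1')).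

Lemma has_der_Wf (f l a b c a1 a2 b1 b2 : R -> R)
    (t al la f' l' a' b' c' a1' a2' b1' b2' : R) :
  f t != 0 -> a t * b t - c t ^+ 2 != 0 ->
  has_der f t f' -> has_der l t l' -> has_der a t a' -> has_der b t b' ->
  has_der c t c' -> has_der a1 t a1' -> has_der a2 t a2' ->
  has_der b1 t b1' -> has_der b2 t b2' ->
  has_der (fun t => Wf (f t) (l t) (a t) (b t) (c t) (a1 t) (a2 t) (b1 t) (b2 t) al la) t
    (dWf (f t) (l t) (a t) (b t) (c t) (a1 t) (a2 t) (b1 t) (b2 t) al la
       f' l' a' b' c' a1' a2' b1' b2').
Proof.
move=> f0 d0 hf hl ha hb hc ha1 ha2 hb1 hb2; rewrite /Wf /dWf.
apply: (@has_der_Wg f l b c (fun t => a t * b t - c t ^+ 2)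
  (fun t => a1 t * b t + a t * b1 t - 2 * c t * a2 t)
  (fun t => a2 t * b t + a t * b2 t - 2 * c t * b1 t)) => //.
- by der; ring.
- by der; ring.
- by der; ring.
Qed.

(* s(f^-2 g) = f^2 s(g) + 6 f Lap f - 12 |df|^2 in dimension 4, with           *)
(* s(g) = - tr (H^-1 Hess (log det H)).                                        *)
Definition scal_kahler (f f1 f2 f11 f12 f22 a b c a1 a2 b1 b2 a11 a12 a22 b12 b22 : R) : R :=
  let d := a * b - c ^+ 2 in
  let d1 := a1 * b + a * b1 - 2 * c * a2 in
  let d2 := a2 * b + a * b2 - 2 * c * b1 in
  let d11 := a11 * b + 2 * a1 * b1 + a * a22 - 2 * a2 * a2 - 2 * c * a12 in
  let d12 := a12 * b + a1 * b2 + a2 * b1 + a * b12 - 2 * a2 * b1 - 2 * c * a22 in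
  let d22 := a22 * b + 2 * a2 * b2 + a * b22 - 2 * b1 * b1 - 2 * c * b12 in
  f ^+ 2 * (- (b * (d11 / d - d1 * d1 / d ^+ 2) + a * (d22 / d - d2 * d2 / d ^+ 2)
          - 2 * c * (d12 / d - d1 * d2 / d ^+ 2)) / d)
    + 6 * f * (b * f11 + a * f22 - 2 * c * f12) / d
    - 12 * (b * f1 * f1 + a * f2 * f2 - 2 * c * f1 * f2) / d.

(** Write W = - f^-3 l adj(H) grad log d + 3 f^-4 l d al + f^-3 d la. The adjugate is divergence
    free, so the first term yields f^-3 l d s(g) and the term - d (log d)' along the mu-gradient of
    f^-3 l, because a y-gradient is H times a mu-gradient. The latter combines with the derivatives
    of d in the other two terms into 6 f^-4 l (al . grad d), which is the Laplacian term since Hess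
    f is the derivative of H along al. The terms pairing al with la through H cancel, and the rest
    is - 12 f^-5 l d |df|^2. *)
Lemma divergence_Wf (f l a b c a1 a2 b1 b2 a11 a12 a22 b12 b22 al1 al2 la1 la2 : R) :
  f != 0 -> a * b - c ^+ 2 != 0 ->
  let f1 := al1 * a + al2 * c in let f2 := al1 * c + al2 * b in
  let l1 := la1 * a + la2 * c in let l2 := la1 * c + la2 * b in
  let f11 := al1 * a1 + al2 * a2 in let f12 := al1 * a2 + al2 * b1 in
  let f22 := al1 * b1 + al2 * b2 in
  scal_kahler f f1 f2 f11 f12 f22 a b c a1 a2 b1 b2 a11 a12 a22 b12 b22
    / f ^+ 5 * l * (a * b - c ^+ 2) =
  dWf f l a b c a1 a2 b1 b2 al1 la1 f1 l1 a1 b1 a2 a11 a12 a22 b12 +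
  dWf f l b a c b2 b1 a2 a1 al2 la2 f2 l2 b2 a2 b1 b22 b12 a22 a12.
Proof.
move=> f0 d0 /=; rewrite /scal_kahler /dWf /dWg [b * a]mulrC.
by field; rewrite f0 d0.
Qed.

End CurvatureField.

Section VolumeDerivative.
Context {R : realType}.

Definition detc (p q : R) (T : toric_data p q) (e : chart) r1 r2 :=
  cA T e r1 r2 * cB T e r1 r2 - cC T e r1 r2 ^+ 2.

(** In a chart det H = r1^2 r2^2 d, so its logarithmic derivatives in y1 and y2 are, up to sign, 2 +
    r1 d1 / d and 2 + r2 d2 / d. All negative powers of the radii cancel and a factor r2 comes out,
    as a field in [flux1] needs. *)
Lemma Wg_charted (b1 b2 : bool) (f l r1 r2 B C d d1 d2 al la : R) :
  f != 0 -> r1 != 0 -> r2 != 0 -> d != 0 ->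
  Wg f l (r2 ^+ 2 * B) (sg b1 * sg b2 * r1 * r2 * C) (r1 ^+ 2 * r2 ^+ 2 * d)
    (sg b1 * r1 ^+ 2 * r2 ^+ 2 * (2 * d + r1 * d1))
    (sg b2 * r1 ^+ 2 * r2 ^+ 2 * (2 * d + r2 * d2)) al la =
  r2 * (- (f^-1 ^+ 3 * l * sg b1 * (r2 * B * (2 + r1 * d1 * d^-1)
      - r1 * C * (2 + r2 * d2 * d^-1)))
    + (3 * f^-1 ^+ 4 * l * al + f^-1 ^+ 3 * la) * r1 ^+ 2 * r2 * d).
Proof.
by move=> f0 r10 r20 d0; rewrite /Wg !sgE; case: b1; case: b2; field;
  rewrite f0 r10 r20 d0.
Qed.

(** At r1 = 0 only the constant 2 of the logarithmic derivative survives: the curvature integral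
    becomes twice a boundary integral of l f^-3, whatever the metric. *)
Lemma S_curv_edge (h l s r B C x y d z : R) :
  - (h * l * s * (r * B * (2 + 0 * x * d^-1) - 0 * C * y)) + z * 0 ^+ 2 * r * d =
  - 2 * s * (l * h * (r * B)).
Proof. by rewrite !mul0r; ring. Qed.

Definition vol1 (p q : R) (T : toric_data p q) y1 y2 :=
  D1 (f11 T) y1 y2 * f22 T y1 y2 + f11 T y1 y2 * D1 (f22 T) y1 y2
  - 2 * f12 T y1 y2 * D2 (f11 T) y1 y2.

Definition vol2 (p q : R) (T : toric_data p q) y1 y2 :=
  D2 (f11 T) y1 y2 * f22 T y1 y2 + f11 T y1 y2 * D2 (f22 T) y1 y2
  - 2 * f12 T y1 y2 * D1 (f22 T) y1 y2.

Lemma detc_smooth (p q : R) (T : toric_data p q) e : smooth2 (detc T e).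
Proof.
move=> n; apply: CnD; first by apply: CnM; [exact: cA_smooth|exact: cB_smooth].
by apply/CnN/CnX; exact: cC_smooth.
Qed.

Lemma volE (p q : R) (T : toric_data p q) e y1 y2 : vol T y1 y2 =
  expR (sg e.1 * y1) ^+ 2 * expR (sg e.2 * y2) ^+ 2 *
    detc T e (expR (sg e.1 * y1)) (expR (sg e.2 * y2)).
Proof. by rewrite /vol (f11E T e) (f22E T e) (f12E T e) det_charted. Qed.

Lemma vol1E (p q : R) (T : toric_data p q) e y1 y2 : vol1 T y1 y2 =
  let r1 := expR (sg e.1 * y1) in let r2 := expR (sg e.2 * y2) in
  sg e.1 * r1 ^+ 2 * r2 ^+ 2 * (2 * detc T e r1 r2 + r1 * D1 (detc T e) r1 r2).
Proof.
rewrite /=.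
have h1 : has_der (vol T ^~ y2) y1 (vol1 T y1 y2).
  have h11 : has_der (f11 T ^~ y2) y1 (D1 (f11 T) y1 y2) := smooth2_der1 y1 y2 (f11_smooth T).
  have h22 : has_der (f22 T ^~ y2) y1 (D1 (f22 T) y1 y2) := smooth2_der1 y1 y2 (f22_smooth T).
  have h12 : has_der (f12 T ^~ y2) y1 (D1 (f12 T) y1 y2) := smooth2_der1 y1 y2 (f12_smooth T).
  rewrite /vol /vol1 D2f11.
  apply: has_der_eq (has_derD (has_derM h11 h22) (has_derN (has_derX 2 h12))) _.
  by move: (D1 _ _ _) (D1 _ _ _) (D1 _ _ _) (f11 _ _ _) (f12 _ _ _) (f22 _ _ _) => *; rewrite /=; ring.
set r1 := expR _; set r2 := expR _.
pose P r := r ^+ 2 * r2 ^+ 2 * detc T e r r2.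
have hP : has_der P r1 (2 * r1 * r2 ^+ 2 * detc T e r1 r2
    + r1 ^+ 2 * r2 ^+ 2 * D1 (detc T e) r1 r2).
  have hid : has_der id r1 1 by exact: is_derive_id.
  have hd : has_der (detc T e ^~ r2) r1 (D1 (detc T e) r1 r2) := smooth2_der1 r1 r2 (@detc_smooth _ _ T e).
  have := has_derM (has_derM (has_derX 2 hid) (has_der_cst (r2 ^+ 2) r1)) hd.
  by move=> /has_der_eq; apply; rewrite /=; move: (detc _ _ _ _) (D1 _ _ _) => *; ring.
have := is_derive_comp_expR (t := y1) (s := sg e.1) hP.
have -> : (fun t => P (expR (sg e.1 * t))) = vol T ^~ y2.
  by apply/funext => t; rewrite (volE T e).
rewrite -/(has_der _ _ _) => /has_derE; rewrite (has_derE h1) -/r1 => ->.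
by move: (detc _ _ _ _) (D1 _ _ _) => *; rewrite /=; ring.
Qed.

Lemma vol2E (p q : R) (T : toric_data p q) e y1 y2 : vol2 T y1 y2 =
  let r1 := expR (sg e.1 * y1) in let r2 := expR (sg e.2 * y2) in
  sg e.2 * r1 ^+ 2 * r2 ^+ 2 * (2 * detc T e r1 r2 + r2 * D2 (detc T e) r1 r2).
Proof.
transitivity (vol1 (swap_data T) y2 y1).
  have -> : vol1 (swap_data T) y2 y1 = D2 (f22 T) y1 y2 * f11 T y1 y2 +
      f22 T y1 y2 * D2 (f11 T) y1 y2 - 2 * f12 T y1 y2 * D1 (f22 T) y1 y2 by [].
  by rewrite /vol2 addrC [in RHS]addrC; congr (_ + _); rewrite addrC; congr (_ + _);
    rewrite mulrC.
rewrite (vol1E _ (e.2, e.1)) /=.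
set r1 := expR _; set r2 := expR _.
have -> : detc (swap_data T) (e.2, e.1) = fun r1 r2 => detc T e r2 r1.
  apply/funext => s; apply/funext => t; rewrite /detc /=.
  by rewrite mulrC -surjective_pairing.
by rewrite -[D1 _ _ _]/(D2 (detc T e) r2 r1) [sg e.2 * _ * _]mulrAC.
Qed.

End VolumeDerivative.

Section CurvatureFlux.
Context {R : realType}.
Variables (p q : R) (T : toric_data p q).

Definition affE (a b c : R) : ratexp R :=
  EAdd (EAdd (EMul (EC a) EX) (EMul (EC b) EY)) (EC c).

Definition invE (n : nat) (E : ratexp R) : ratexp R := iter n (EMul (EInv E)) (EC 1).

Lemma affE_box a b c : in_box p q (affE a b c).
Proof. by []. Qed.

Variables (al1 al2 al0 la1 la2 la0 : R).
Let f := affE al1 al2 al0.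
Let l := affE la1 la2 la0.
Hypothesis f_pos : forall x y, 0 <= x <= p -> 0 <= y <= q -> 0 < eval f x y.

Definition W_curv y1 y2 := Wf (orb T f y1 y2) (orb T l y1 y2)
  (f11 T y1 y2) (f22 T y1 y2) (f12 T y1 y2)
  (D1 (f11 T) y1 y2) (D2 (f11 T) y1 y2) (D1 (f22 T) y1 y2) (D2 (f22 T) y1 y2) al1 la1.

Definition S_curv e r1 r2 :=
  let h := che T (EInv f) e r1 r2 in let l := che T l e r1 r2 in
  let d := detc T e r1 r2 in
  - (h ^+ 3 * l * sg e.1 *
     (r2 * cB T e r1 r2 * (2 + r1 * D1 (detc T e) r1 r2 * d^-1)
      - r1 * cC T e r1 r2 * (2 + r2 * D2 (detc T e) r1 r2 * d^-1)))
  + (3 * h ^+ 4 * l * al1 + h ^+ 3 * la1) * r1 ^+ 2 * r2 * d.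

Lemma f_box : in_box p q (EInv f).
Proof. by move=> x y hx hy; split => //; rewrite gt_eqF// f_pos. Qed.

Lemma orb_f_neq0 y1 y2 : orb T f y1 y2 != 0.
Proof. by have [] := defined_orb T y1 y2 f_box. Qed.

Lemma flux1_curv : flux1 S_curv W_curv.
Proof.
split=> [e|e y1 y2].
  have ch : Cn 1 (che T (EInv f) e) := che_smooth T e f_box 1.
  have cl : Cn 1 (che T l e) := che_smooth T e (@affE_box _ _ _) 1.
  have cd : Cn 1 (detc T e) := @detc_smooth _ _ _ T e 1.
  have cdV : Cn 1 (fun r1 r2 => (detc T e r1 r2)^-1).
    by apply: CnV cd; exact: det_chart.
  have cd1 : Cn 1 (D1 (detc T e)) := smooth2_D1 (@detc_smooth _ _ _ T e) 1.
  have cd2 : Cn 1 (D2 (detc T e)) := smooth2_D2 (@detc_smooth _ _ _ T e) 1.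
  have cb : Cn 1 (cB T e) := cB_smooth T e 1.
  have cc : Cn 1 (cC T e) := cC_smooth T e 1.
  have x1 : Cn 1 (fun x _ : R => x) := Cn_fst 1.
  have x2 : Cn 1 (fun _ x : R => x) := Cn_snd 1.
  apply: CnD; [apply: CnN; apply: CnM|].
  - by apply: CnM (Cn_cst 1 _); apply: CnM cl; exact: CnX.
  - apply: CnD; [|apply: CnN]; apply: CnM.
    + exact: CnM x2 cb.
    + by apply: CnD (Cn_cst 1 _) _; apply: CnM cdV; exact: CnM x1 cd1.
    + exact: CnM x1 cc.
    + by apply: CnD (Cn_cst 1 _) _; apply: CnM cdV; exact: CnM x2 cd2.
  - apply: CnM cd; apply: CnM x2; apply: CnM; last exact: CnX.
    apply: CnD; apply: CnM (Cn_cst 1 _); last exact: CnX.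
    by apply: CnM cl; apply: CnM (Cn_cst 1 _) _; exact: CnX.
rewrite /W_curv /Wf -/(vol T y1 y2) -/(vol1 T y1 y2) -/(vol2 T y1 y2).
have := orb_f_neq0 y1 y2.
rewrite (volE T e) (vol1E T e) (vol2E T e) (f22E T e) (f12E T e) !(orbE T _ e).
rewrite /S_curv => f0; rewrite Wg_charted//.
- by rewrite gt_eqF// expR_gt0.
- by rewrite gt_eqF// expR_gt0.
- exact: det_chart.
Qed.

Lemma flux1_curv_int E : in_box p q E ->
  (forall x y, 0 <= x <= p -> 0 <= y <= q ->
    eval (diffE false E) x y = eval l x y / eval f x y ^+ 3) ->
  int2 (D1 W_curv) = corners (fun e => - 2 * sg e.1 * corner p q E e).
Proof.
move=> hE Ef; rewrite (flux1_edges (T := T) (k := fun b => - 2 * sg b) flux1_curv hE)//.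
move=> b r r0; rewrite Ef; last 2 first.
- by have := M1_range T (b, false) 0 r; rewrite M1_edge.
- exact: M2_range.
rewrite /S_curv /che M1_edge /= -exprVn; exact: S_curv_edge.
Qed.

End CurvatureFlux.

Section CurvatureIntegral.
Context {R : realType}.

Fixpoint swapE (E : ratexp R) : ratexp R :=
  match E with
  | EX => EY
  | EY => EX
  | EC c => EC c
  | EAdd E1 E2 => EAdd (swapE E1) (swapE E2)
  | EMul E1 E2 => EMul (swapE E1) (swapE E2)
  | EInv E1 => EInv (swapE E1)
  end.

Lemma eval_swapE E x y : eval (swapE E) x y = eval E y x.
Proof. by elim: E => //= [E1 -> E2 ->|E1 -> E2 ->|E1 ->]. Qed.

Lemma diff_swapE b E : diffE b (swapE E) = swapE (diffE (~~ b) E).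
Proof.
by case: b; elim: E => //= [E1 -> E2 ->|E1 -> E2 ->|E1 ->].
Qed.

Lemma swapE_box p q E : in_box p q E -> in_box q p (swapE E).
Proof.
move=> h x y hx hy; have := h y x hy hx; elim: E {h} => //= [E1 h1 E2 h2|E1 h1 E2 h2|E1 h1].
- by case=> /h1 ? /h2.
- by case=> /h1 ? /h2.
- by case=> e0 /h1; rewrite eval_swapE.
Qed.

Variables (p q : R) (T : toric_data p q).
Variables (al1 al2 al0 la1 la2 la0 : R).
Let f := affE al1 al2 al0.
Let l := affE la1 la2 la0.
Hypothesis f_pos : forall x y, 0 <= x <= p -> 0 <= y <= q -> 0 < eval f x y.

(* The scalar curvature of f^-2 g. *)
Definition scal_conf y1 y2 : R :=
  scal_kahler (orb T f y1 y2)
    (al1 * f11 T y1 y2 + al2 * f12 T y1 y2) (al1 * f12 T y1 y2 + al2 * f22 T y1 y2)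
    (al1 * D1 (f11 T) y1 y2 + al2 * D2 (f11 T) y1 y2)
    (al1 * D2 (f11 T) y1 y2 + al2 * D1 (f22 T) y1 y2)
    (al1 * D1 (f22 T) y1 y2 + al2 * D2 (f22 T) y1 y2)
    (f11 T y1 y2) (f22 T y1 y2) (f12 T y1 y2)
    (D1 (f11 T) y1 y2) (D2 (f11 T) y1 y2) (D1 (f22 T) y1 y2) (D2 (f22 T) y1 y2)
    (D1 (D1 (f11 T)) y1 y2) (D1 (D2 (f11 T)) y1 y2) (D2 (D2 (f11 T)) y1 y2)
    (D1 (D2 (f22 T)) y1 y2) (D2 (D2 (f22 T)) y1 y2).

Lemma D1D1f22 : D1 (D1 (f22 T)) = D2 (D2 (f11 T)).
Proof. by rewrite D1f22 schwarz ?D2f11//; exact: f12_smooth. Qed.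

Lemma orb_aff_der1 a b c y1 y2 : has_der (orb T (affE a b c) ^~ y2) y1
  (a * f11 T y1 y2 + b * f12 T y1 y2).
Proof.
have := orb_der1 T y1 y2 (@affE_box R p q a b c).
by move=> /has_der_eq; apply; rewrite /orb /=; ring.
Qed.

Lemma orb_aff_der2 a b c y1 y2 : has_der (orb T (affE a b c) y1) y2
  (a * f12 T y1 y2 + b * f22 T y1 y2).
Proof.
have := orb_der2 T y1 y2 (@affE_box R p q a b c).
by move=> /has_der_eq; apply; rewrite /orb /=; ring.
Qed.

Let W1 := W_curv T al1 al2 al0 la1 la2 la0.
(** The second component is the first one for the exchanged factors, so its flux comes from
    [swap_data]. *)
Let W2 y1 y2 := W_curv (swap_data T) al2 al1 al0 la2 la1 la0 y2 y1.

Let f_pos' x y : 0 <= x <= q -> 0 <= y <= p -> 0 < eval (affE al2 al1 al0) x y.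
Proof. by move=> hx hy; have := f_pos hy hx; rewrite /= [X in X + al0]addrC. Qed.

Lemma scal_divergence y1 y2 :
  scal_conf y1 y2 / orb T f y1 y2 ^+ 5 * orb T l y1 y2 * vol T y1 y2 =
  D1 W1 y1 y2 + D2 W2 y1 y2.
Proof.
have f0 : orb T f y1 y2 != 0 by exact: orb_f_neq0.
have d0 := det_orbit T y1 y2.
have sf11 := f11_smooth T; have sf22 := f22_smooth T; have sf12 := f12_smooth T.
have E1 : D1 W1 y1 y2 = _ := has_derE (@has_der_Wf R (orb T f ^~ y2) (orb T l ^~ y2)
  (f11 T ^~ y2) (f22 T ^~ y2) (f12 T ^~ y2) (D1 (f11 T) ^~ y2) (D2 (f11 T) ^~ y2)
  (D1 (f22 T) ^~ y2) (D2 (f22 T) ^~ y2) y1 al1 la1 _ _ _ _ _ _ _ _ _ f0 d0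
  (orb_aff_der1 al1 al2 al0 y1 y2) (orb_aff_der1 la1 la2 la0 y1 y2)
  (smooth2_der1 y1 y2 sf11) (smooth2_der1 y1 y2 sf22) (smooth2_der1 y1 y2 sf12)
  (smooth2_der1 y1 y2 (smooth2_D1 sf11)) (smooth2_der1 y1 y2 (smooth2_D2 sf11))
  (smooth2_der1 y1 y2 (smooth2_D1 sf22)) (smooth2_der1 y1 y2 (smooth2_D2 sf22))).
have d0' : f22 T y1 y2 * f11 T y1 y2 - f12 T y1 y2 ^+ 2 != 0 by rewrite mulrC.
have E2 := has_derE (@has_der_Wf R (orb T f y1) (orb T l y1)
  (f22 T y1) (f11 T y1) (f12 T y1) (D2 (f22 T) y1) (D1 (f22 T) y1)
  (D2 (f11 T) y1) (D1 (f11 T) y1) y2 al2 la2 _ _ _ _ _ _ _ _ _ f0 d0'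
  (orb_aff_der2 al1 al2 al0 y1 y2) (orb_aff_der2 la1 la2 la0 y1 y2)
  (smooth2_der2 y1 y2 sf22) (smooth2_der2 y1 y2 sf11) (smooth2_der2 y1 y2 sf12)
  (smooth2_der2 y1 y2 (smooth2_D2 sf22)) (smooth2_der2 y1 y2 (smooth2_D1 sf22))
  (smooth2_der2 y1 y2 (smooth2_D2 sf11)) (smooth2_der2 y1 y2 (smooth2_D1 sf11))).
pose V t := Wf (orb T f y1 t) (orb T l y1 t)
    (f22 T y1 t) (f11 T y1 t) (f12 T y1 t) (D2 (f22 T) y1 t) (D1 (f22 T) y1 t)
    (D2 (f11 T) y1 t) (D1 (f11 T) y1 t) al2 la2.
have VE : W2 y1 = V.
  apply/funext => t; rewrite /W2 /V /W_curv /orb /=.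
  by rewrite [al2 * _ + _]addrC [la2 * _ + _]addrC.
have W2E : D2 W2 y1 y2 = 'D_1 V y2 by rewrite /D2 VE.
have E := @divergence_Wf R (orb T f y1 y2) (orb T l y1 y2)
  (f11 T y1 y2) (f22 T y1 y2) (f12 T y1 y2)
  (D1 (f11 T) y1 y2) (D2 (f11 T) y1 y2) (D1 (f22 T) y1 y2) (D2 (f22 T) y1 y2)
  (D1 (D1 (f11 T)) y1 y2) (D1 (D2 (f11 T)) y1 y2) (D2 (D2 (f11 T)) y1 y2)
  (D1 (D2 (f22 T)) y1 y2) (D2 (D2 (f22 T)) y1 y2) al1 al2 la1 la2 f0 d0.
rewrite D1D1f22 -D2f11 in E1.
rewrite -(schwarz (f22_smooth T 2)) -(schwarz (f11_smooth T 2)) -D1f22 in E2.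
by rewrite W2E E1 E2; exact: E.
Qed.

Lemma curvature_tame :
  let F y1 y2 := scal_conf y1 y2 / orb T f y1 y2 ^+ 5 * orb T l y1 y2 * vol T y1 y2 in
  cont2 F /\ dom2 F.
Proof.
move=> F.
have -> : F = fun y1 y2 => D1 W1 y1 y2 + D2 W2 y1 y2.
  by apply/funext => y1; apply/funext => y2; exact: scal_divergence.
have [c1 o1] := flux1_tame (flux1_curv T la1 la2 la0 f_pos).
have [c2' [K o2']] := flux1_tame (flux1_curv (swap_data T) la2 la1 la0 f_pos').
have c2 : cont2 (D2 W2) by exact: cont2_swap c2'.
have o2 : dom2 (D2 W2).
  by exists K => y1 y2; rewrite [ebound y1 * _]mulrC; exact: o2'.
by split; [exact: cont2D|exact: dom2D].
Qed.

(** [Ev] and [Eh] are antiderivatives of l f^-3 along vertical and horizontal lines. The signs in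
    [corners] together with [sg] make the contributions of opposite edges add up. *)
Lemma curvature_integral Ev Eh : in_box p q Ev -> in_box p q Eh ->
  (forall x y, 0 <= x <= p -> 0 <= y <= q ->
    eval (diffE false Ev) x y = eval l x y / eval f x y ^+ 3) ->
  (forall x y, 0 <= x <= p -> 0 <= y <= q ->
    eval (diffE true Eh) x y = eval l x y / eval f x y ^+ 3) ->
  int2 (fun y1 y2 =>
    scal_conf y1 y2 / orb T f y1 y2 ^+ 5 * orb T l y1 y2 * vol T y1 y2) =
    - 2 * corners (fun e => sg e.1 * corner p q Ev e + sg e.2 * corner p q Eh e).
Proof.
move=> hv hh dv dh.
have -> : (fun y1 y2 =>
    scal_conf y1 y2 / orb T f y1 y2 ^+ 5 * orb T l y1 y2 * vol T y1 y2) =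
    fun y1 y2 => D1 W1 y1 y2 + D2 W2 y1 y2.
  by apply/funext => y1; apply/funext => y2; exact: scal_divergence.
have [c1 o1] := flux1_tame (flux1_curv T la1 la2 la0 f_pos).
have [c2' [K o2']] := flux1_tame (flux1_curv (swap_data T) la2 la1 la0 f_pos').
have c2 : cont2 (D2 W2) by exact: cont2_swap c2'.
have o2 : dom2 (D2 W2).
  by exists K => y1 y2; rewrite [ebound y1 * _]mulrC; exact: o2'.
rewrite int2D// (flux1_curv_int T f_pos hv dv).
have -> : int2 (D2 W2) = int2 (D1 (W_curv (swap_data T) al2 al1 al0 la2 la1 la0)).
  by rewrite [RHS]int2_swap//; exists K.
rewrite (flux1_curv_int (swap_data T) f_pos' (swapE_box hh)); last first.
  move=> x y hx hy; rewrite diff_swapE eval_swapE dh//.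
  by rewrite /= [la1 * _ + _]addrC [al1 * _ + _]addrC.
by rewrite /corners /corner !eval_swapE /=; ring.
Qed.

End CurvatureIntegral.

(** * From toric Kahler metrics to toric data *)

Section Slices.
Context {R : realType}.
Implicit Types (u : 'rV[R]_4 -> R) (x : 'rV[R]_4).

Definition vec4 (a b c d : R) : 'rV[R]_4 := \row_(i < 4) [:: a; b; c; d]`_i.

(** Restriction to the real points of a chart; by torus invariance nothing is lost. *)
Definition slice u r1 r2 : R := u (vec4 r1 0 r2 0).

Lemma vec4_eta x : x = vec4 (x 0 (inord 0)) (x 0 (inord 1)) (x 0 (inord 2)) (x 0 (inord 3)).
Proof.
apply/rowP => i; rewrite !mxE; case: i => -[|[|[|[|//]]]] i4 /=;
  by congr (x 0 _); apply: val_inj; rewrite /= inordK.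
Qed.

Lemma vec4E a b c d : [/\ vec4 a b c d 0 (inord 0) = a, vec4 a b c d 0 (inord 1) = b,
  vec4 a b c d 0 (inord 2) = c & vec4 a b c d 0 (inord 3) = d].
Proof. by split; rewrite mxE inordK. Qed.

Lemma vec4D a b c d a' b' c' d' :
  vec4 a b c d + vec4 a' b' c' d' = vec4 (a + a') (b + b') (c + c') (d + d').
Proof. by apply/rowP => -[[|[|[|[|//]]]] i4]; rewrite !mxE. Qed.

Lemma vec4Z h a b c d : h *: vec4 a b c d = vec4 (h * a) (h * b) (h * c) (h * d).
Proof. by apply/rowP => -[[|[|[|[|//]]]] i4]; rewrite !mxE. Qed.

Lemma delta4 : [/\ delta_mx 0 (inord 0) = vec4 1 0 0 0, delta_mx 0 (inord 1) = vec4 0 1 0 0,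
  delta_mx 0 (inord 2) = vec4 0 0 1 0 & delta_mx 0 (inord 3) = vec4 0 0 0 1].
Proof.
by split; apply/rowP => -[[|[|[|[|//]]]] i4]; rewrite !mxE eqxx -val_eqE /= inordK.
Qed.

Lemma smooth_partial i u : smooth u -> smooth (partial i u).
Proof. by move=> su s x; rewrite -foldr_rcons; exact: su. Qed.

Lemma slice_der1 u (r1 r2 : R) : smooth u ->
  is_derive r1 1 (slice u ^~ r2) (slice (partial (inord 0) u) r1 r2).
Proof.
move=> su; have [d0 _ _ _] := delta4.
have E (h : R) : u (h *: delta_mx 0 (inord 0) + vec4 r1 0 r2 0) =
    (slice u ^~ r2) (h *: (1 : R) + r1).
  by rewrite d0 vec4Z vec4D /slice; congr (u (vec4 _ _ _ _));
    rewrite ?mulr0 ?add0r.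
apply: DeriveDef.
  by apply: (derivable_eq_along E); apply: diff_derivable; exact: (su [::]).
by rewrite /slice /partial -(derive_eq_along E).
Qed.

Lemma slice_der2 u (r1 r2 : R) : smooth u ->
  is_derive r2 1 (slice u r1) (slice (partial (inord 2) u) r1 r2).
Proof.
move=> su; have [_ _ d2 _] := delta4.
have E (h : R) : u (h *: delta_mx 0 (inord 2) + vec4 r1 0 r2 0) =
    slice u r1 (h *: (1 : R) + r2).
  by rewrite d2 vec4Z vec4D /slice; congr (u (vec4 _ _ _ _));
    rewrite ?mulr0 ?add0r.
apply: DeriveDef.
  by apply: (derivable_eq_along E); apply: diff_derivable; exact: (su [::]).
by rewrite /slice /partial -(derive_eq_along E).
Qed.

Lemma continuous_vec4 (T : topologicalType) (a b c d : T -> R) t :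
  {for t, continuous a} -> {for t, continuous b} -> {for t, continuous c} ->
  {for t, continuous d} -> {for t, continuous (fun t => vec4 (a t) (b t) (c t) (d t))}.
Proof.
move=> ca cb cc cd.
have -> : (fun t => vec4 (a t) (b t) (c t) (d t)) = fun t =>
    a t *: vec4 1 0 0 0 + b t *: vec4 0 1 0 0 + c t *: vec4 0 0 1 0 + d t *: vec4 0 0 0 1.
  apply/funext => s; rewrite !vec4Z !vec4D.
  by congr vec4; rewrite !(mulr0, mulr1, addr0, add0r).
have cZ (k : T -> R) (v : 'rV[R]_4) : {for t, continuous k} ->
    {for t, continuous (fun t => k t *: v)}.
  by move=> ck; apply: cvgZr_tmp.
by apply: continuousD; [apply: continuousD; [apply: continuousD|]|]; exact: cZ.
Qed.

Lemma slice_cont2 u : smooth u -> cont2 (slice u).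
Proof.
move=> su z; apply: (@continuous_comp _ _ _ (fun z : R * R => vec4 z.1 0 z.2 0) u).
  by apply: continuous_vec4; [exact: cvg_fst|exact: cvg_cst|exact: cvg_snd|exact: cvg_cst].
exact: differentiable_continuous (su [::] _).
Qed.

Lemma slice_smooth u : smooth u -> smooth2 (slice u).
Proof.
move=> + n; elim: n u => [|n IH] u su; first exact/Cn0/slice_cont2.
have h1 r1 r2 : has_der (slice u ^~ r2) r1 (slice (partial (inord 0) u) r1 r2).
  exact: slice_der1.
have h2 r1 r2 : has_der (slice u r1) r2 (slice (partial (inord 2) u) r1 r2).
  exact: slice_der2.
apply: (@Cn_intro _ n _ _ _ (slice_cont2 su) h1 h2).
- exact/IH/smooth_partial.
- exact/IH/smooth_partial.
Qed.

End Slices.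

Section OrbitChart.
Context {R : realType}.
Implicit Types (x : 'rV[R]_4) (e : chart).

Lemma differentiable_comp1 (u : R -> R) (k : 'rV[R]_4 -> R) x :
  (forall t, derivable u t 1) -> differentiable k x ->
  differentiable (fun x => u (k x)) x.
Proof.
by move=> du dk; apply: (differentiable_comp dk); exact/derivable1_diffP.
Qed.

Lemma differentiable_orbit_chart e x : differentiable (@orbit_chart R e) x.
Proof.
have -> : @orbit_chart R e = \sum_(j < 4) (fun x => orbit_chart e x 0 j *: delta_mx 0 j).
  by apply/funext => y; rewrite fct_sumE -row_sum_delta.
have dc (s : R) i y : differentiable (fun x : 'rV[R]_4 => s * x 0 i) y.
  by apply: differentiableM; [exact: differentiable_cst|exact: differentiable_coord].
have de (s : R) i y : differentiable (fun x : 'rV[R]_4 => expR (s * x 0 i)) y.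
  by apply: differentiable_comp1; [exact: derivable_expR|exact: dc].
have dcos (s : R) i y : differentiable (fun x : 'rV[R]_4 => cos (s * x 0 i)) y.
  by apply: differentiable_comp1; [exact: derivable_cos|exact: dc].
have dsin (s : R) i y : differentiable (fun x : 'rV[R]_4 => sin (s * x 0 i)) y.
  by apply: differentiable_comp1; [exact: derivable_sin|exact: dc].
apply: differentiable_sum => j; apply: differentiableZl.
have -> : (fun x => orbit_chart e x 0 j) = fun x =>
  [:: expR ((-1) ^+ e.1 * x 0 (inord 0)) * cos ((-1) ^+ e.1 * x 0 (inord 1));
      expR ((-1) ^+ e.1 * x 0 (inord 0)) * sin ((-1) ^+ e.1 * x 0 (inord 1));
      expR ((-1) ^+ e.2 * x 0 (inord 2)) * cos ((-1) ^+ e.2 * x 0 (inord 3));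
      expR ((-1) ^+ e.2 * x 0 (inord 2)) * sin ((-1) ^+ e.2 * x 0 (inord 3))]`_j.
  by apply/funext => y; rewrite mxE.
case: j => -[|[|[|[|//]]]] j4 /=; apply: differentiableM;
  by [exact: de|exact: dcos|exact: dsin].
Qed.

Lemma orbit_chart_vec4 e (y1 t1 y2 t2 : R) : orbit_chart e (vec4 y1 t1 y2 t2) =
  vec4 (expR (sg e.1 * y1) * cos (sg e.1 * t1)) (expR (sg e.1 * y1) * sin (sg e.1 * t1))
       (expR (sg e.2 * y2) * cos (sg e.2 * t2)) (expR (sg e.2 * y2) * sin (sg e.2 * t2)).
Proof.
have [v0 v1 v2 v3] := vec4E y1 t1 y2 t2.
by rewrite /orbit_chart v0 v1 v2 v3.
Qed.

Lemma orbit_chart_real e (y1 y2 : R) : orbit_chart e (vec4 y1 0 y2 0) =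
  vec4 (expR (sg e.1 * y1)) 0 (expR (sg e.2 * y2)) 0.
Proof. by rewrite orbit_chart_vec4 !mulr0 cos0 sin0 !mulr1 !mulr0. Qed.

Lemma has_der_polar (s y a b : R) :
  has_der (fun h => expR (s * (h * a + y)) * cos (s * (h * b))) 0 (s * a * expR (s * y)) /\
  has_der (fun h => expR (s * (h * a + y)) * sin (s * (h * b))) 0 (s * b * expR (s * y)).
Proof.
have hid : has_der id (0 : R) 1 by exact: is_derive_id.
have h1 : has_der (fun h => s * (h * a + y)) 0 (s * a).
  by der; ring.
have h2 : has_der (fun h => s * (h * b)) 0 (s * b).
  by der; ring.
have he : has_der (expR \o (fun h => s * (h * a + y))) 0 (expR (s * y) * (s * a)).
  apply: (is_derive1_comp (f := expR)); last exact: h1.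
  by rewrite mul0r add0r; exact: is_derive_expR.
have hc : has_der (cos \o (fun h => s * (h * b))) 0 (- sin 0 * (s * b)).
  apply: (is_derive1_comp (f := cos)); last exact: h2.
  by rewrite mul0r mulr0; exact: is_derive_cos.
have hs : has_der (sin \o (fun h => s * (h * b))) 0 (cos 0 * (s * b)).
  apply: (is_derive1_comp (f := sin)); last exact: h2.
  by rewrite mul0r mulr0; exact: is_derive_sin.
split.
- apply: (has_der_eq (has_derM he hc)); rewrite /= !mul0r !mulr0 cos0 sin0 add0r.
  by ring.
- apply: (has_der_eq (has_derM he hs)); rewrite /= !mul0r !mulr0 cos0 sin0 add0r.
  by ring.
Qed.

(** The chart map is z -> exp (s (y + i t)), holomorphic with real derivative s exp (s y) at real
    points; so the Jacobian there is diagonal with these entries, equal for y_j and t_j. *)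
Definition lam e (y1 y2 : R) (i : nat) : R :=
  if (i < 2)%N then sg e.1 * expR (sg e.1 * y1) else sg e.2 * expR (sg e.2 * y2).

Lemma derive_orbit_chart e (y1 y2 a b c d : R) :
  'D_(vec4 a b c d) (@orbit_chart R e) (vec4 y1 0 y2 0) =
  vec4 (a * lam e y1 y2 0) (b * lam e y1 y2 1) (c * lam e y1 y2 2) (d * lam e y1 y2 3).
Proof.
rewrite derive_mx; last exact/diff_derivable/differentiable_orbit_chart.
apply/rowP => j; rewrite !mxE.
have [p1 p2] := has_der_polar (sg e.1) y1 a b.
have [p3 p4] := has_der_polar (sg e.2) y2 c d.
pose g (j : nat) h := [:: expR (sg e.1 * (h * a + y1)) * cos (sg e.1 * (h * b));
                    expR (sg e.1 * (h * a + y1)) * sin (sg e.1 * (h * b));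
                    expR (sg e.2 * (h * c + y2)) * cos (sg e.2 * (h * d));
                    expR (sg e.2 * (h * c + y2)) * sin (sg e.2 * (h * d))]`_j.
rewrite (@derive_eq_along R _ _ _ _ (g j) _ _ 0 1); last first.
  move=> h; rewrite vec4Z vec4D orbit_chart_vec4 mxE !addr0 /g /GRing.scale /= mulr1.
  by [].
by case: j => -[|[|[|[|//]]]] j4; rewrite /g /lam /=; [rewrite (has_derE p1)
  |rewrite (has_derE p2)|rewrite (has_derE p3)|rewrite (has_derE p4)]; ring.
Qed.

Lemma jacobian_orbit_chart e (y1 y2 : R) :
  'J (@orbit_chart R e) (vec4 y1 0 y2 0) = diag_mx (\row_(i < 4) lam e y1 y2 i).
Proof.
apply/row_matrixP => i; rewrite rowE -deriveEjacobian; last exact: differentiable_orbit_chart.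
have [d0 d1 d2 d3] := delta4 (R := R).
have -> : i = inord i by rewrite inord_val.
by case: i => -[|[|[|[|//]]]] i4 /=; rewrite ?d0 ?d1 ?d2 ?d3 derive_orbit_chart;
  apply/rowP => -[[|[|[|[|//]]]] j4]; rewrite !mxE -?val_eqE /= ?inordK //=
   ?mul0r ?mul1r ?mulr0n ?mulr1n.
Qed.

Lemma pullback_orbit_chart (g : 'rV[R]_4 -> 'M[R]_4) e (y1 y2 : R) (i j : 'I_4) :
  pullback (orbit_chart e) g (vec4 y1 0 y2 0) i j =
  lam e y1 y2 i * lam e y1 y2 j *
    g (vec4 (expR (sg e.1 * y1)) 0 (expR (sg e.2 * y2)) 0) i j.
Proof.
rewrite /pullback jacobian_orbit_chart orbit_chart_real tr_diag_mx.
by rewrite mul_mx_diag mul_diag_mx !mxE mulrAC.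
Qed.

End OrbitChart.

(** * Shape of the metric and of the moment map on the orbit *)

Section Hermitian.
Context {R : realType}.
Notation i0 := (inord 0 : 'I_4).
Notation i1 := (inord 1 : 'I_4).
Notation i2 := (inord 2 : 'I_4).
Notation i3 := (inord 3 : 'I_4).

Lemma JmxE (A : 'M[R]_4) k : [/\ (Jmx *m A) i0 k = A i1 k, (Jmx *m A) i1 k = - A i0 k,
  (Jmx *m A) i2 k = A i3 k & (Jmx *m A) i3 k = - A i2 k].
Proof.
by split; rewrite !mxE big_ord4 !mxE !inordK//= ?mulr0n ?mulr1n ?subr0 ?sub0r
  ?mul0r ?mul1r ?mulN1r ?add0r ?addr0.
Qed.

(** Symmetry and J-invariance leave, besides H, only one free entry, the product of d/dy1 and d/dt2,
    which reappears up to sign as that of d/dt1 and d/dy2. *)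
Lemma hermitian_block (A : 'M[R]_4) : A^T = A -> Jmx *m A *m Jmx^T = A ->
  A i0 i3 = 0 -> A = block (A i0 i0) (A i2 i2) (A i0 i2).
Proof.
move=> sA hA a03.
have s i j : A i j = A j i by rewrite -[in LHS]sA mxE.
have E i j : (Jmx *m A *m Jmx^T) i j = (Jmx *m (Jmx *m A)^T) j i.
  have -> : Jmx *m (Jmx *m A)^T = (Jmx *m A *m Jmx^T)^T by rewrite [RHS]trmx_mul trmxK.
  by rewrite [RHS]mxE.
have h i j : A i j = (Jmx *m (Jmx *m A)^T) j i by rewrite -E hA.
have [e0 e1 e2 e3] : [/\ forall k, (Jmx *m A) i0 k = A i1 k,
    forall k, (Jmx *m A) i1 k = - A i0 k, forall k, (Jmx *m A) i2 k = A i3 k &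
    forall k, (Jmx *m A) i3 k = - A i2 k].
  by split=> k; case: (JmxE A k).
have [c0 c1 c2 c3] : [/\ forall k, A k i0 = (Jmx *m A) k i1,
    forall k, A k i1 = - (Jmx *m A) k i0, forall k, A k i2 = (Jmx *m A) k i3 &
    forall k, A k i3 = - (Jmx *m A) k i2].
  by split=> k; rewrite h; case: (JmxE (Jmx *m A)^T k) => q0 q1 q2 q3;
    rewrite ?q0 ?q1 ?q2 ?q3 mxE.
have a01 : A i0 i1 = 0.
  have : A i0 i1 = - A i0 i1 by rewrite {1}c1 e0 s.
  by move/eqP; rewrite -addr_eq0 -mulr2n mulrn_eq0 => /eqP.
have a23 : A i2 i3 = 0.
  have : A i2 i3 = - A i2 i3 by rewrite {1}c3 e2 s.
  by move/eqP; rewrite -addr_eq0 -mulr2n mulrn_eq0 => /eqP.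
have a12 : A i1 i2 = 0 by rewrite c2 e1 a03 oppr0.
have a11 : A i1 i1 = A i0 i0 by rewrite c1 e1 opprK.
have a33 : A i3 i3 = A i2 i2 by rewrite c3 e3 opprK.
have a13 : A i1 i3 = A i0 i2 by rewrite c3 e1 opprK.
apply/matrixP => i j; rewrite mxE.
have -> : i = inord i by rewrite inord_val.
have -> : j = inord j by rewrite inord_val.
by case: i => -[|[|[|[|//]]]] i4; case: j => -[|[|[|[|//]]]] j4; rewrite !inordK //=
  ?a01 ?a23 ?a12 ?a03 ?a11 ?a33 ?a13 // s ?a01 ?a23 ?a12 ?a03 ?a11 ?a33 ?a13.
Qed.

Lemma bilinear_delta (A : 'M[R]_4) (i k : 'I_4) :
  ((delta_mx 0 i : 'rV_4) *m A *m (delta_mx 0 k : 'rV_4)^T) 0 0 = A i k.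
Proof. by rewrite -rowE trmx_delta -colE !mxE. Qed.

Lemma torus_field_delta : torus_field (delta_mx 0 0 : 'rV[R]_2) = delta_mx 0 i1 /\
  torus_field (delta_mx 0 1 : 'rV[R]_2) = delta_mx 0 i3.
Proof.
by split; apply/rowP => -[[|[|[|[|//]]]] j4]; rewrite !mxE -?val_eqE /= ?inordK.
Qed.

Lemma torus_field_vec4 (h : 'rV[R]_2) : torus_field h = vec4 0 (h 0 0) 0 (h 0 1).
Proof. by []. Qed.

End Hermitian.

Section CoordinateCurves.
Context {R : realType}.
Implicit Types (u : 'rV[R]_4 -> R).

Lemma curve0 u (a b c d du : R) : is_derive (vec4 a b c d) (delta_mx 0 (inord 0)) u du ->
  has_der (fun t => u (vec4 t b c d)) a du.
Proof.
have [d0 _ _ _] := delta4 (R := R); move=> [h <-].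
have E (t : R) : u (t *: delta_mx 0 (inord 0) + vec4 a b c d) =
    (fun t => u (vec4 t b c d)) (t *: (1 : R) + a).
  by rewrite d0 vec4Z vec4D; congr (u (vec4 _ _ _ _)); rewrite ?mulr0 ?add0r.
apply: DeriveDef; first exact: derivable_eq_along E h.
by rewrite -(derive_eq_along E).
Qed.

Lemma curve1 u (a b c d du : R) : is_derive (vec4 a b c d) (delta_mx 0 (inord 1)) u du ->
  has_der (fun t => u (vec4 a t c d)) b du.
Proof.
have [_ d0 _ _] := delta4 (R := R); move=> [h <-].
have E (t : R) : u (t *: delta_mx 0 (inord 1) + vec4 a b c d) =
    (fun t => u (vec4 a t c d)) (t *: (1 : R) + b).
  by rewrite d0 vec4Z vec4D; congr (u (vec4 _ _ _ _)); rewrite ?mulr0 ?add0r.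
apply: DeriveDef; first exact: derivable_eq_along E h.
by rewrite -(derive_eq_along E).
Qed.

Lemma curve2 u (a b c d du : R) : is_derive (vec4 a b c d) (delta_mx 0 (inord 2)) u du ->
  has_der (fun t => u (vec4 a b t d)) c du.
Proof.
have [_ _ d0 _] := delta4 (R := R); move=> [h <-].
have E (t : R) : u (t *: delta_mx 0 (inord 2) + vec4 a b c d) =
    (fun t => u (vec4 a b t d)) (t *: (1 : R) + c).
  by rewrite d0 vec4Z vec4D; congr (u (vec4 _ _ _ _)); rewrite ?mulr0 ?add0r.
apply: DeriveDef; first exact: derivable_eq_along E h.
by rewrite -(derive_eq_along E).
Qed.

Lemma curve3 u (a b c d du : R) : is_derive (vec4 a b c d) (delta_mx 0 (inord 3)) u du ->
  has_der (fun t => u (vec4 a b c t)) d du.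
Proof.
have [_ _ _ d0] := delta4 (R := R); move=> [h <-].
have E (t : R) : u (t *: delta_mx 0 (inord 3) + vec4 a b c d) =
    (fun t => u (vec4 a b c t)) (t *: (1 : R) + d).
  by rewrite d0 vec4Z vec4D; congr (u (vec4 _ _ _ _)); rewrite ?mulr0 ?add0r.
apply: DeriveDef; first exact: derivable_eq_along E h.
by rewrite -(derive_eq_along E).
Qed.

Lemma has_der0_cst (u : R -> R) x y : (forall t, has_der u t 0) -> u x = u y.
Proof. by move=> h; apply: is_derive_0_is_cst => t; exact: h. Qed.

Lemma periodic_slope0 (u : R -> R) (k T : R) : T != 0 ->
  (forall t, has_der u t k) -> u T = u 0 -> k = 0.
Proof.
move=> T0 du uT.
have h t : has_der (fun t => u t - k * t) t 0.
  have hid : has_der id t 1 by exact: is_derive_id.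
  by have := du t => hu; der; ring.
have := has_der0_cst T 0 h; rewrite uT mulr0 subr0 => /eqP.
rewrite -subr_eq0 addrAC subrr add0r oppr_eq0 mulf_eq0 (negbTE T0) orbF.
by move/eqP.
Qed.

End CoordinateCurves.

Section OrbitMetric.
Context {R : realType}.
Notation i0 := (inord 0 : 'I_4).
Notation i1 := (inord 1 : 'I_4).
Notation i2 := (inord 2 : 'I_4).
Notation i3 := (inord 3 : 'I_4).
Variables (G : chart -> 'rV[R]_4 -> 'M[R]_4) (mu : 'I_2 -> chart -> 'rV[R]_4 -> R).
Hypotheses (hG : toric_kahler_metric G) (hmu : moment_map G mu).

Notation Om := (orbit_metric G).

Lemma orbit_metric_real e y1 y2 (i j : 'I_4) :
  Om (vec4 y1 0 y2 0) i j = lam e y1 y2 i * lam e y1 y2 j *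
    G e (vec4 (expR (sg e.1 * y1)) 0 (expR (sg e.2 * y2)) 0) i j.
Proof. by rewrite -(tk_compat hG e) pullback_orbit_chart. Qed.

Lemma orbit_metric_inv y1 t1 y2 t2 : Om (vec4 y1 t1 y2 t2) = Om (vec4 y1 0 y2 0).
Proof.
rewrite -(tk_invariant hG (vec2 t1 t2) (vec4 y1 0 y2 0)) torus_field_vec4 vec4D.
by rewrite /vec2 !mxE /= !addr0 !add0r.
Qed.

Lemma orbit_metric_sym x : (Om x)^T = Om x.
Proof. by rewrite /orbit_metric /pullback !trmx_mul trmxK (tk_sym hG) mulmxA. Qed.

Lemma Jmx_lam e y1 y2 (d := diag_mx (\row_(i < 4) lam e y1 y2 i) : 'M[R]_4) :
  Jmx *m d = d *m Jmx.
Proof.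
rewrite mul_mx_diag mul_diag_mx; apply/matrixP => i j; rewrite !mxE.
by case: i => -[|[|[|[|//]]]] i4; case: j => -[|[|[|[|//]]]] j4; rewrite /lam /=
  ?mulr0n ?mulr1n ?subr0 ?sub0r ?mulr0 ?mul0r ?mulr1 ?mul1r ?mulrN1 ?mulN1r.
Qed.

Lemma orbit_metric_hermitian y1 y2 (A := Om (vec4 y1 0 y2 0)) : Jmx *m A *m Jmx^T = A.
Proof.
rewrite /A /orbit_metric /pullback jacobian_orbit_chart orbit_chart_real.
set d := diag_mx _; set P := G _ _.
have dT : d^T = d by rewrite tr_diag_mx.
have hP : Jmx *m P *m Jmx^T = P by exact: (tk_hermitian hG).
have Jd : Jmx *m d = d *m Jmx by exact: Jmx_lam.
have dJ : d *m Jmx^T = Jmx^T *m d by rewrite -{1}dT -trmx_mul Jd trmx_mul dT.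
by rewrite dT -!mulmxA dJ !mulmxA Jd -[in RHS]hP !mulmxA.
Qed.

Lemma orbit_fun_chart j e x : mu j e (orbit_chart e x) = orbit_fun (mu j) x.
Proof. exact: (sf_compat (mm_smooth hmu j)). Qed.

Lemma moment_der j x i : is_derive x (delta_mx 0 i) (orbit_fun (mu j))
  ((Jmx *m Om x) i (if j == 0 then i1 else i3)).
Proof.
have := mm_hamiltonian hmu j x (delta_mx 0 i).
rewrite /fundamental_form.
have [T0 T1] := torus_field_delta (R := R).
case: eqP => [->|/eqP j0]; first by rewrite T0 bilinear_delta.
have -> : j = 1 by case: j j0 => -[|[|//]] j2 // _; exact: val_inj.
by rewrite T1 bilinear_delta.
Qed.

Lemma orbit_fun_period j y1 y2 :
  orbit_fun (mu j) (vec4 y1 (pi *+ 2) y2 0) = orbit_fun (mu j) (vec4 y1 0 y2 0).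
Proof.
rewrite /orbit_fun /= !orbit_chart_vec4 !(sgE false) !mul1r cos2pi sin2pi.
by rewrite cos0 sin0.
Qed.

(** Up to sign this entry is the derivative of mu_2 along t1. By invariance it is constant on the
    circle, and mu_2 is periodic in t1, so it is zero. *)
Lemma orbit_metric_03 y1 y2 : Om (vec4 y1 0 y2 0) i0 i3 = 0.
Proof.
have pi0 : (pi *+ 2 : R) != 0 by rewrite mulrn_eq0 /= gt_eqF// pi_gt0.
have := @periodic_slope0 R (fun t => orbit_fun (mu 1) (vec4 y1 t y2 0))
  (- Om (vec4 y1 0 y2 0) i0 i3) _ pi0 _ (orbit_fun_period 1 y1 y2).
move=> h; apply/eqP; rewrite -oppr_eq0; apply/eqP/h => t.
have := moment_der 1 (vec4 y1 t y2 0) i1; rewrite /= orbit_metric_inv.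
have [_ -> _ _] := JmxE (Om (vec4 y1 0 y2 0)) i3.
exact: curve1.
Qed.

Definition orbit11 y1 y2 := Om (vec4 y1 0 y2 0) i0 i0.
Definition orbit22 y1 y2 := Om (vec4 y1 0 y2 0) i2 i2.
Definition orbit12 y1 y2 := Om (vec4 y1 0 y2 0) i0 i2.
Definition orbit_mu j y1 y2 := orbit_fun (mu j) (vec4 y1 0 y2 0).

Lemma orbit_metric_block y1 y2 :
  Om (vec4 y1 0 y2 0) = block (orbit11 y1 y2) (orbit22 y1 y2) (orbit12 y1 y2).
Proof.
apply: hermitian_block; [exact: orbit_metric_sym|exact: orbit_metric_hermitian|].
exact: orbit_metric_03.
Qed.

Lemma orbit_metric_met : Om = met orbit11 orbit22 orbit12.
Proof.
by apply/funext => x; rewrite [in LHS](vec4_eta x) orbit_metric_inv orbit_metric_block.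
Qed.

(** The block form makes the t-derivatives of both moment coordinates vanish. *)
Lemma orbit_fun_mu j : orbit_fun (mu j) = lift2 (orbit_mu j).
Proof.
apply/funext => x; rewrite [in LHS](vec4_eta x) /lift2 /orbit_mu.
move: (x 0 i0) (x 0 i1) (x 0 i2) (x 0 i3) => y1 t1 y2 t2.
transitivity (orbit_fun (mu j) (vec4 y1 0 y2 t2)).
  apply: (@has_der0_cst _ (fun t => orbit_fun (mu j) (vec4 y1 t y2 t2))) => t.
  apply: curve1; have := moment_der j (vec4 y1 t y2 t2) i1.
  rewrite orbit_metric_inv orbit_metric_block.
  have [_ -> _ _] := JmxE (block (orbit11 y1 y2) (orbit22 y1 y2) (orbit12 y1 y2))
    (if j == 0 then i1 else i3).
  by case: ifP => _; rewrite mxE !inordK //= oppr0.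
apply: (@has_der0_cst _ (fun t => orbit_fun (mu j) (vec4 y1 0 y2 t))) => t.
apply: curve3; have := moment_der j (vec4 y1 0 y2 t) i3.
rewrite orbit_metric_inv orbit_metric_block.
have [_ _ _ ->] := JmxE (block (orbit11 y1 y2) (orbit22 y1 y2) (orbit12 y1 y2))
  (if j == 0 then i1 else i3).
by case: ifP => _; rewrite mxE !inordK //= oppr0.
Qed.

Lemma orbit_mu_charted j : charted (fun e => slice (mu j e)) (orbit_mu j).
Proof.
by move=> e y1 y2; rewrite /orbit_mu -(orbit_fun_chart j e) orbit_chart_real.
Qed.

Lemma orbit11_charted : charted (fun e r1 r2 => r1 ^+ 2 * slice (fun x => G e x i0 i0) r1 r2)
  orbit11.
Proof.
move=> e y1 y2; rewrite /orbit11 (orbit_metric_real e) /lam !inordK //=.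
by rewrite /slice mulrACA sg2 mul1r expr2.
Qed.

Lemma orbit22_charted : charted (fun e r1 r2 => r2 ^+ 2 * slice (fun x => G e x i2 i2) r1 r2)
  orbit22.
Proof.
move=> e y1 y2; rewrite /orbit22 (orbit_metric_real e) /lam !inordK //=.
by rewrite /slice mulrACA sg2 mul1r expr2.
Qed.

Lemma orbit12_charted : charted (fun e r1 r2 =>
  sg e.1 * sg e.2 * r1 * r2 * slice (fun x => G e x i0 i2) r1 r2) orbit12.
Proof.
move=> e y1 y2; rewrite /orbit12 (orbit_metric_real e) /lam !inordK //=.
by rewrite /slice mulrACA !mulrA.
Qed.

Lemma orbit_mu_der y1 y2 : [/\ has_der (orbit_mu 0 ^~ y2) y1 (orbit11 y1 y2),
  has_der (orbit_mu 0 y1) y2 (orbit12 y1 y2),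
  has_der (orbit_mu 1 ^~ y2) y1 (orbit12 y1 y2) &
  has_der (orbit_mu 1 y1) y2 (orbit22 y1 y2)].
Proof.
have B := orbit_metric_block y1 y2.
split.
- apply: curve0; have := moment_der 0 (vec4 y1 0 y2 0) i0; rewrite /= B.
  have [-> _ _ _] := JmxE (block (orbit11 y1 y2) (orbit22 y1 y2) (orbit12 y1 y2)) i1.
  by rewrite mxE !inordK.
- apply: curve2; have := moment_der 0 (vec4 y1 0 y2 0) i2; rewrite /= B.
  have [_ _ -> _] := JmxE (block (orbit11 y1 y2) (orbit22 y1 y2) (orbit12 y1 y2)) i1.
  by rewrite mxE !inordK.
- apply: curve0; have := moment_der 1 (vec4 y1 0 y2 0) i0; rewrite /= B.
  have [-> _ _ _] := JmxE (block (orbit11 y1 y2) (orbit22 y1 y2) (orbit12 y1 y2)) i3.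
  by rewrite mxE !inordK.
- apply: curve2; have := moment_der 1 (vec4 y1 0 y2 0) i2; rewrite /= B.
  have [_ _ -> _] := JmxE (block (orbit11 y1 y2) (orbit22 y1 y2) (orbit12 y1 y2)) i3.
  by rewrite mxE !inordK.
Qed.

Lemma chart_positive e x : 0 < G e x i0 i0 /\
  0 < G e x i0 i0 * G e x i2 i2 - G e x i0 i2 ^+ 2.
Proof.
have q a c : (vec4 a 0 c 0 *m G e x *m (vec4 a 0 c 0)^T) 0 0 =
    a ^+ 2 * G e x i0 i0 + 2 * a * c * G e x i0 i2 + c ^+ 2 * G e x i2 i2.
  have s : G e x i2 i0 = G e x i0 i2 by rewrite -[in LHS](tk_sym hG) mxE.
  rewrite !mxE big_ord4 !mxE !big_ord4; have [v0 v1 v2 v3] := vec4E a 0 c 0.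
  by rewrite v0 v1 v2 v3 s !inordK //=; ring.
have v_neq0 (a c : R) : a != 0 -> vec4 a 0 c 0 != 0.
  move=> a0; apply/eqP => /rowP/(_ i0); have [-> _ _ _] := vec4E a 0 c 0.
  by rewrite mxE => /eqP; rewrite (negbTE a0).
have v_neq0' (a c : R) : c != 0 -> vec4 a 0 c 0 != 0.
  move=> a0; apply/eqP => /rowP/(_ i2); have [_ _ -> _] := vec4E a 0 c 0.
  by rewrite mxE => /eqP; rewrite (negbTE a0).
have A0 : 0 < G e x i0 i0.
  have := tk_pos hG e x (v_neq0 1 0 (oner_neq0 R)); rewrite q.
  by rewrite expr1n mul1r !mulr0 expr0n /= !mul0r !addr0.
split=> //.
(* On the vector (- C, A) the form takes the value A (A B - C^2), so positivity of A yields that of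
   the determinant. *)
have := tk_pos hG e x (v_neq0' (- G e x i0 i2) _ (lt0r_neq0 A0)); rewrite q.
move: A0; move: (G e x i0 i0) (G e x i0 i2) (G e x i2 i2) => A C B A0.
rewrite (_ : _ + _ = A * (A * B - C ^+ 2)); last by ring.
by rewrite pmulr_rgt0.
Qed.

End OrbitMetric.

(** * Values of the moment map on the edges *)

Section Edge.
Context {R : realType}.
Variables (M A C : chart -> R -> R -> R) (m : R -> R -> R).
Hypothesis M_smooth : forall e, smooth2 (M e).
Hypothesis C_cont : forall e, cont2 (C e).
Hypothesis mM : charted M m.
Hypothesis m_der1 : charted (fun e r1 r2 => r1 ^+ 2 * A e r1 r2) (D1 m).
Hypothesis m_der2 :
  charted (fun e r1 r2 => sg e.1 * sg e.2 * r1 * r2 * C e r1 r2) (D2 m).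
Hypothesis A_pos : forall e r1 r2, 0 < A e r1 r2.
Hypothesis M_even : forall e r1 r2, 0 < r1 -> 0 < r2 -> M e r1 (- r2) = M e r1 r2.

Lemma chart_coord (b : bool) (s : R) : 0 < s -> expR (sg b * (sg b * ln s)) = s.
Proof. by move=> s0; rewrite mulrA sg2 mul1r lnK. Qed.

Lemma sg_neq0 b : sg b != 0 :> R.
Proof. by rewrite /sg signr_eq0. Qed.

Lemma edge_D1 e r1 r2 : 0 < r1 -> 0 < r2 -> D1 (M e) r1 r2 = sg e.1 * r1 * A e r1 r2.
Proof.
move=> r10 r20.
pose y1 := sg e.1 * ln r1; pose y2 := sg e.2 * ln r2.
have e1 : expR (sg e.1 * y1) = r1 := chart_coord e.1 r10.
have e2 : expR (sg e.2 * y2) = r2 := chart_coord e.2 r20.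
have h : has_der (M e ^~ r2) (expR (sg e.1 * y1)) (D1 (M e) (expR (sg e.1 * y1)) r2).
  exact: smooth2_der1 (M_smooth e).
have := has_derE (is_derive_comp_expR h).
have -> : (fun t => M e (expR (sg e.1 * t)) r2) = m ^~ y2.
  by apply/funext => t; rewrite (mM e) e2.
rewrite -/(D1 m y1 y2) (m_der1 e) e1 e2 => E.
have r1n : sg e.1 * r1 != 0 by rewrite mulf_neq0 ?(gt_eqF r10) ?(gt_eqF r20) ?sg_neq0.
by apply: (mulfI r1n); rewrite -E mulrA mulrACA sg2 mul1r expr2.
Qed.

Lemma edge_D2 e r1 r2 : 0 < r1 -> 0 < r2 -> D2 (M e) r1 r2 = sg e.1 * r1 * C e r1 r2.
Proof.
move=> r10 r20.
pose y1 := sg e.1 * ln r1; pose y2 := sg e.2 * ln r2.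
have e1 : expR (sg e.1 * y1) = r1 := chart_coord e.1 r10.
have e2 : expR (sg e.2 * y2) = r2 := chart_coord e.2 r20.
have h : has_der (M e r1) (expR (sg e.2 * y2)) (D2 (M e) r1 (expR (sg e.2 * y2))).
  exact: smooth2_der2 (M_smooth e).
have := has_derE (is_derive_comp_expR h).
have -> : (fun t => M e r1 (expR (sg e.2 * t))) = m y1.
  by apply/funext => t; rewrite (mM e) e1.
rewrite -/(D2 m y1 y2) (m_der2 e) e1 e2 => E.
have r2n : sg e.2 * r2 != 0 by rewrite mulf_neq0 ?(gt_eqF r10) ?(gt_eqF r20) ?sg_neq0.
apply: (mulfI r2n); rewrite -E; move: (C _ _ _) (sg e.1) (sg e.2) => *; ring.
Qed.

(** The derivative along the edge carries the factor r1, hence is zero at r1 = 0. *)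
Lemma edge_const_pos e r : 0 < r -> M e 0 r = M e 0 1.
Proof.
have D0 s : 0 < s -> D2 (M e) 0 s = 0.
  move=> s0; have cg : cont2 (fun r1 r2 => sg e.1 * r1 * C e r1 r2).
    exact: (cont2M (Cn_cont2 (CnM (Cn_cst 0 (sg e.1)) (Cn_fst 0))) (@C_cont e)).
  have := cont2_edge (smooth2_cont2 (smooth2_D2 (M_smooth e))) cg s0 => ->.
    by rewrite mulr0 mul0r.
  by move=> t t0; exact: edge_D2.
have mono a b : 0 < a -> a < b -> M e 0 b = M e 0 a.
  move=> a0 ab; have ab0 : 0 < b - a by rewrite subr_gt0.
  have [s /andP[s1 s2]] := @MVT_right _ (M e 0) (D2 (M e) 0) a (b - a)
    ab0 (fun s => smooth2_der2 0 s (M_smooth e)).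
  rewrite [a + _]addrC subrK D0 ?mulr0 => [/eqP|]; last exact: lt_trans s1.
  by rewrite subr_eq0 => /eqP.
move=> r0; case: (ltgtP r 1) => [r1|r1|->//]; first exact/esym/mono.
exact: mono.
Qed.

Lemma edge_const e r : M e 0 r = M e 0 1.
Proof.
have cM := smooth2_cont2 (M_smooth e).
(* Negative r is reached by the rotation by pi ([M_even]), and r = 0 by continuity. *)
case: (ltgtP r 0) => r0.
- have r0' : 0 < - r by rewrite oppr_gt0.
  rewrite -(edge_const_pos e r0').
  have c1 : cont2 (fun r1 r2 => M e r1 (- r2)).
    by apply: (cont2_pair (u := id) (v := -%R)) cM;
      [move=> ?; exact: cvg_id|exact: opp_continuous].
  rewrite -[in LHS](opprK r); apply: (cont2_edge c1 cM r0') => s s0.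
  exact: M_even.
- exact: edge_const_pos.
- rewrite r0; have c1 : cont2 (fun r1 r2 => M e 0 r1).
    by apply: (cont2_comp (u := M e 0)) cont2_fst; exact: cont2_2.
  have c2 : cont2 (fun _ _ => M e 0 1) by exact: cst_continuous.
  apply: (cont2_edge c1 c2 (@ltr01 R)) => s s0; exact: edge_const_pos.
Qed.

(** The two charts along an edge share an orbit point for every r1, so the edge value depends on
    [e.1] only. The bounds hold since M increases with r1 when [e.1] is false and decreases when it
    is true, by positivity of A. *)
Lemma edge_value : exists k : bool -> R, (forall e r, M e 0 r = k e.1) /\
  forall y1 y2, k false <= m y1 y2 <= k true.
Proof.
exists (fun b => M (b, false) 0 1); split.
  move=> [b1 b2] r; rewrite edge_const; case: b2 => //=.
  have cM b := smooth2_cont2 (M_smooth (b1, b)).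
  apply: (cont2_edge (cM true) (cM false) (@ltr01 R)) => s s0.
  have e1 := chart_coord b1 s0.
  have := mM (b1, true) (sg b1 * ln s) 0; rewrite (mM (b1, false)) /= e1.
  by rewrite !mulr0 expR0.
move=> y1 y2.
have key b : exists2 s, 0 < s & m y1 y2 = M (b, false) 0 1 + sg b * s.
  pose r1 := expR (sg b * y1); pose r2 := expR (1 * y2).
  have [s] := @MVT_right _ (M (b, false) ^~ r2) (D1 (M (b, false)) ^~ r2) 0 r1
    (expR_gt0 _) (fun s => smooth2_der1 s r2 (M_smooth (b, false))).
  rewrite add0r => /andP[s0 _]; rewrite edge_D1 ?expR_gt0// => /= E.
  exists (r1 * (s * A (b, false) s r2)).
    by rewrite !mulr_gt0 ?expR_gt0//; exact: A_pos.
  rewrite (mM (b, false)) /= (sgE false) -/r1 -/r2 -(edge_const (b, false) r2).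
  move/eqP: E; rewrite subr_eq => /eqP ->; rewrite [RHS]addrC; congr (_ + _).
  by rewrite -[sg b * s * _]mulrA mulrCA.
have [s s0 E1] := key false; have [t t0 E2] := key true.
apply/andP; split; first by rewrite E1 (sgE false) mul1r lerDl ltW.
by rewrite E2 (sgE true) mulN1r lerBlDr lerDl ltW.
Qed.

End Edge.

Section Polar.
Context {R : realType}.

Lemma polar (a b : R) : ~~ ((a == 0) && (b == 0)) ->
  exists r t : R, [/\ 0 < r, a = r * cos t & b = r * sin t].
Proof.
move=> ab0; pose r := Num.sqrt (a ^+ 2 + b ^+ 2).
have s0 : 0 < a ^+ 2 + b ^+ 2.
  rewrite lt_def addr_ge0 ?sqr_ge0// andbT; apply: contra ab0.
  by rewrite paddr_eq0 ?sqr_ge0// !sqrf_eq0.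
have r0 : 0 < r by rewrite sqrtr_gt0.
have rE : r ^+ 2 = a ^+ 2 + b ^+ 2 by rewrite sqr_sqrtr// ltW.
pose x := a / r.
have x1 : x ^+ 2 <= 1.
  by rewrite expr_div_n ler_pdivrMr ?exprn_gt0// mul1r rE lerDl sqr_ge0.
have xb : -1 <= x <= 1.
  by rewrite -ler_norml -(@ler_pXn2r _ 2) ?nnegrE// expr1n real_normK ?num_real.
have ax : a = r * x by rewrite mulrC divfK ?gt_eqF.
have bE : b ^+ 2 = r ^+ 2 * (1 - x ^+ 2) by rewrite mulrBr mulr1 -exprMn -ax rE addrAC subrr add0r.
have sE : r * sin (acos x) = `|b|.
  rewrite sin_acos// -[r in LHS](gtr0_norm r0) -sqrtr_sqr -sqrtrM ?sqr_ge0//.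
  by rewrite -bE sqrtr_sqr.
have cE : cos (acos x) = x by rewrite acosK// in_itv.
have [b0|b0] := leP 0 b.
  by exists r, (acos x); split=> //; [rewrite cE|rewrite sE ger0_norm].
exists r, (- acos x); split=> //; first by rewrite cosN cE.
by rewrite sinN mulrN sE ltr0_norm// opprK.
Qed.

End Polar.

Section MomentImage.
Context {R : realType}.

Lemma Delta_range (p : R) q : 0 <= p -> Delta p q -> 0 <= q 0 0 <= p /\ 0 <= q 0 1 <= 1.
Proof.
move=> p0 [t [/= t0 t1 ->]]; move: t0 t1.
rewrite !big_ord_recl !big_ord0 /= => t0; rewrite !mxE /=.
move: (t0 ord0) (t0 (lift ord0 ord0)) (t0 (lift ord0 (lift ord0 ord0)))
  (t0 (lift ord0 (lift ord0 (lift ord0 ord0)))).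
move: (t ord0) (t (lift ord0 ord0)) (t (lift ord0 (lift ord0 ord0)))
  (t (lift ord0 (lift ord0 (lift ord0 ord0)))) => a b c d a0 b0 c0 d0.
rewrite !addr0 !mulr0 !add0r !mulr1 !addr0 => s1.
rewrite -mulrDl mulr_ge0 ?addr_ge0//= ler_piMl//; last by rewrite -s1; lra.
by split=> //; rewrite -s1; lra.
Qed.

Lemma Delta_vertex (p : R) (q : 'rV[R]_2) :
  q \in [:: vec2 0 0; vec2 p 0; vec2 p 1; vec2 0 1] -> Delta p q.
Proof.
set s := [:: _; _; _; _]; move=> /(nthP 0)[i i4 <-].
exists (fun j => (j == i :> nat)%:R); split.
- by move=> j; rewrite ler0n.
- rewrite (bigD1 (Ordinal i4)) //= eqxx big1 ?addr0// => j.
  by rewrite -val_eqE /= => /negbTE ->.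
- rewrite (bigD1 (Ordinal i4)) //= eqxx scale1r big1 ?addr0// => j.
  by rewrite -val_eqE /= => /negbTE ->; rewrite scale0r.
Qed.

Variables (G : chart -> 'rV[R]_4 -> 'M[R]_4) (mu : 'I_2 -> chart -> 'rV[R]_4 -> R).
Hypotheses (hG : toric_kahler_metric G) (hmu : moment_map G mu).

Lemma mu_smooth j e : smooth (mu j e).
Proof. exact: sf_smooth (mm_smooth hmu j) e. Qed.

(** A chart point with a zero coordinate is the limit of orbit points, got by replacing that
    coordinate by exp (- n); orbit points of the chart are those with polar coordinates, on which mu
    is known. *)
Lemma orbit_dense j (A : set R) : closed A -> (forall y1 y2, A (orbit_mu mu j y1 y2)) ->
  forall e x, A (mu j e x).
Proof.
move=> clA hA e x; rewrite (vec4_eta x).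
move: (x 0 (inord 0)) (x 0 (inord 1)) (x 0 (inord 2)) (x 0 (inord 3)) => a b c d.
pose z (a b : R) (n : nat) : R := if (a == 0) && (b == 0) then expR (- n%:R) else a.
have zn a' b' n : ~~ ((z a' b' n == 0) && (b' == 0)).
  rewrite /z; case: ifP => [_|->//].
  by rewrite gt_eqF ?expR_gt0.
have zc a' b' : z a' b' n @[n --> \oo] --> a'.
  have [/andP[/eqP a0 b0]|ab0] := boolP ((a' == 0) && (b' == 0)).
    have -> : z a' b' = fun n => expR (- n%:R).
      by apply/funext => n; rewrite /z a0 eqxx b0.
    by rewrite a0; exact: cvg_expRN.
  have -> : z a' b' = fun=> a' by apply/funext => n; rewrite /z (negbTE ab0).
  exact: cvg_cst.
have orb n : exists y1 y2, mu j e (vec4 (z a b n) b (z c d n) d) = orbit_mu mu j y1 y2.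
  have [r [t [r0 -> ->]]] := polar (zn a b n).
  have [r' [t' [r0' -> ->]]] := polar (zn c d n).
  pose y1 := sg e.1 * ln r; pose y2 := sg e.2 * ln r'.
  exists y1, y2; have := orbit_fun_chart hmu j e (vec4 y1 (sg e.1 * t) y2 (sg e.2 * t')).
  rewrite orbit_chart_vec4 !chart_coord// !(mulrA (sg _) (sg _)) !sg2 !mul1r => ->.
  rewrite (orbit_fun_mu hG hmu) /lift2; have [-> _ -> _] := vec4E y1 (sg e.1 * t) y2 (sg e.2 * t').
  by [].
have cmu : {for vec4 a b c d, continuous (mu j e)}.
  exact: differentiable_continuous (mu_smooth j e [::] _).
have lim : mu j e (vec4 (z a b n) b (z c d n) d) @[n --> \oo] --> mu j e (vec4 a b c d).
  apply: (@cvg_comp _ _ _ (fun n => vec4 (z a b n) b (z c d n) d) (mu j e)); last exact: cmu.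
  have E (p1 p2 p3 p4 : R) : vec4 p1 p2 p3 p4 =
      p1 *: vec4 1 0 0 0 + p2 *: vec4 0 1 0 0 + p3 *: vec4 0 0 1 0 + p4 *: vec4 0 0 0 1.
    by rewrite !vec4Z !vec4D; congr vec4; rewrite !(mulr0, mulr1, addr0, add0r).
  rewrite E; under eq_cvg do rewrite E.
  apply: cvgD; [apply: cvgD; [apply: cvgD|]|]; apply: cvgZr_tmp;
    by [exact: zc|exact: cvg_cst].
apply: (closed_cvg A clA _ _ lim); apply: nearW => n.
by have [y1 [y2 ->]] := orb n; exact: hA.
Qed.

(** Rotating the angle by pi turns r_j into - r_j in the real slice and preserves mu. *)
Lemma orbit_mu_even j e r1 r2 : 0 < r1 -> 0 < r2 ->
  slice (mu j e) r1 (- r2) = slice (mu j e) r1 r2 /\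
  slice (mu j e) (- r1) r2 = slice (mu j e) r1 r2.
Proof.
move=> r10 r20; rewrite /slice.
pose y1 := sg e.1 * ln r1; pose y2 := sg e.2 * ln r2.
have E s t : mu j e (orbit_chart e (vec4 y1 s y2 t)) = orbit_mu mu j y1 y2.
  rewrite (orbit_fun_chart hmu) (orbit_fun_mu hG hmu) /lift2.
  by have [-> _ -> _] := vec4E y1 s y2 t.
have K b : sg b * (sg b * pi) = pi :> R by rewrite mulrA sg2 mul1r.
have := E 0 (sg e.2 * pi); have := E (sg e.1 * pi) 0; rewrite -(E 0 0).
rewrite !orbit_chart_vec4 !K !mulr0 cos0 sin0 cospi sinpi !mulr0 !mulr1 !mulrN1.
by rewrite !chart_coord.
Qed.

End MomentImage.

Section ToricDataOf.
Context {R : realType}.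
Variables (p : R) (G : chart -> 'rV[R]_4 -> 'M[R]_4) (mu : 'I_2 -> chart -> 'rV[R]_4 -> R).
Hypotheses (p0 : 0 <= p) (hG : toric_kahler_metric G) (hmu : moment_map G mu).
Hypothesis himage : moment_image mu = Delta p.
Notation i0 := (inord 0 : 'I_4).
Notation i2 := (inord 2 : 'I_4).

Lemma moment_range e x : 0 <= mu 0 e x <= p /\ 0 <= mu 1 e x <= 1.
Proof.
have : moment_image mu (\row_(j < 2) mu j e x) by exists e, x.
by rewrite himage => /(Delta_range p0); rewrite !mxE.
Qed.

Lemma moment_attained x y : vec2 x y \in [:: vec2 0 0; vec2 p 0; vec2 p 1; vec2 0 1] ->
  exists e v, mu 0 e v = x /\ mu 1 e v = y.
Proof.
move/Delta_vertex; rewrite -himage => -[e [v /rowP E]]; exists e, v.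
by have := E 0; have := E 1; rewrite !mxE /= => -> ->.
Qed.

(** The edge values are themselves attained, so they lie in [0, L]; they also bound mu on the orbit,
    hence everywhere by density, and mu attains 0 and L. *)
Lemma edge_image j L (k : bool -> R) :
  (forall e x, 0 <= mu j e x <= L) ->
  (exists e x, mu j e x = 0) -> (exists e x, mu j e x = L) ->
  (forall b, exists e x, mu j e x = k b) ->
  (forall y1 y2, k false <= orbit_mu mu j y1 y2 <= k true) ->
  forall b, k b = if b then L else 0.
Proof.
move=> rng [e [x at0]] [e' [x' atL]] ka kr.
have lo := orbit_dense hG hmu (@closed_ge _ (k false)) (fun y1 y2 => proj1 (andP (kr y1 y2))).
have hi := orbit_dense hG hmu (@closed_le _ (k true)) (fun y1 y2 => proj2 (andP (kr y1 y2))).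
case; apply/le_anti/andP; split.
- by have [e1 [x1 <-]] := ka true; have /andP[] := rng e1 x1.
- by rewrite -atL; exact: hi.
- by rewrite -at0; exact: lo.
- by have [e1 [x1 <-]] := ka false; have /andP[] := rng e1 x1.
Qed.

Let M j e := slice (mu j e).
Let A e := slice (fun x => G e x i0 i0).
Let B e := slice (fun x => G e x i2 i2).
Let C e := slice (fun x => G e x i0 i2).

Let sM j e : smooth2 (M j e).
Proof. exact/slice_smooth/(mu_smooth hmu). Qed.

Let sG i j e : smooth2 (slice (fun x => G e x i j)).
Proof. exact/slice_smooth/(tk_smooth hG). Qed.

Let A_gt0 e r1 r2 : 0 < A e r1 r2.
Proof. by have [] := chart_positive hG e (vec4 r1 0 r2 0). Qed.

Let B_gt0 e r1 r2 : 0 < B e r1 r2.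
Proof.
have [a0 d0] := chart_positive hG e (vec4 r1 0 r2 0).
rewrite -(pmulr_rgt0 _ a0) (lt_le_trans d0)//.
by rewrite gerBl sqr_ge0.
Qed.

Let D1_mu0 : D1 (orbit_mu mu 0) = orbit11 G.
Proof.
apply/funext => y1; apply/funext => y2.
by have [h _ _ _] := orbit_mu_der hG hmu y1 y2; exact: has_derE h.
Qed.

Let D2_mu0 : D2 (orbit_mu mu 0) = orbit12 G.
Proof.
apply/funext => y1; apply/funext => y2.
by have [_ h _ _] := orbit_mu_der hG hmu y1 y2; exact: has_derE h.
Qed.

Let D1_mu1 : D1 (orbit_mu mu 1) = orbit12 G.
Proof.
apply/funext => y1; apply/funext => y2.
by have [_ _ h _] := orbit_mu_der hG hmu y1 y2; exact: has_derE h.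
Qed.

Let D2_mu1 : D2 (orbit_mu mu 1) = orbit22 G.
Proof.
apply/funext => y1; apply/funext => y2.
by have [_ _ _ h] := orbit_mu_der hG hmu y1 y2; exact: has_derE h.
Qed.

Lemma moment_edge1 e r : M 0 e 0 r = if e.1 then p else 0.
Proof.
have cC e' : cont2 (C e') := smooth2_cont2 (sG i0 i2 e').
have dA : charted (fun e r1 r2 => r1 ^+ 2 * A e r1 r2) (D1 (orbit_mu mu 0)).
  by rewrite D1_mu0; exact: orbit11_charted.
have dC : charted (fun e r1 r2 => sg e.1 * sg e.2 * r1 * r2 * C e r1 r2)
    (D2 (orbit_mu mu 0)).
  by rewrite D2_mu0; exact: orbit12_charted.
have [k [kE kr]] := edge_value (sM 0) cC (orbit_mu_charted hmu 0) dA dC A_gt0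
  (fun e r1 r2 h1 h2 => proj1 (orbit_mu_even hG hmu 0 e h1 h2)).
rewrite kE; apply: (edge_image _ _ _ _ kr).
- by move=> e' x; have [] := moment_range e' x.
- by have [|e' [x [<- _]]] := @moment_attained 0 0; [rewrite !inE eqxx|exists e', x].
- by have [|e' [x [<- _]]] := @moment_attained p 0; [rewrite !inE eqxx orbT|exists e', x].
- by move=> b; exists (b, false), (vec4 0 0 0 0); exact: (kE (b, false) 0).
Qed.

Lemma moment_edge2 e r : M 1 e r 0 = if e.2 then 1 else 0.
Proof.
pose s (e : chart) : chart := (e.2, e.1).
have sM' e' : smooth2 (fun r1 r2 => M 1 (s e') r2 r1).
  exact/smooth2_swap/sM.
have cC e' : cont2 (fun r1 r2 => C (s e') r2 r1).
  exact: (smooth2_cont2 (smooth2_swap (sG i0 i2 (s e')))).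
have mM := charted_swap (orbit_mu_charted hmu 1).
have dA : charted (fun e r1 r2 => r1 ^+ 2 * B (s e) r2 r1)
    (D1 (fun y1 y2 => orbit_mu mu 1 y2 y1)).
  have -> : D1 (fun y1 y2 => orbit_mu mu 1 y2 y1) = fun y1 y2 => orbit22 G y2 y1.
    by rewrite -D2_mu1.
  exact: (charted_swap (orbit22_charted hG)).
have dC : charted (fun e r1 r2 => sg e.1 * sg e.2 * r1 * r2 * C (s e) r2 r1)
    (D2 (fun y1 y2 => orbit_mu mu 1 y2 y1)).
  have -> : D2 (fun y1 y2 => orbit_mu mu 1 y2 y1) = fun y1 y2 => orbit12 G y2 y1.
    by rewrite -D1_mu1.
  move=> e' y1 y2; rewrite (charted_swap (orbit12_charted hG) e') /=.
  by rewrite [sg e'.2 * sg e'.1]mulrC; congr (_ * _); exact: mulrAC.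
have [k [kE kr]] := edge_value sM' cC mM dA dC (fun e r1 r2 => B_gt0 (s e) r2 r1)
  (fun e r1 r2 h1 h2 => proj2 (orbit_mu_even hG hmu 1 (s e) h2 h1)).
have := kE (s e) r; rewrite /s /= -surjective_pairing => ->.
apply: (edge_image _ _ _ _ (fun y1 y2 => kr y2 y1)).
- by move=> e' x; have [] := moment_range e' x.
- by have [|e' [x [_ <-]]] := @moment_attained 0 0; [rewrite !inE eqxx|exists e', x].
- by have [|e' [x [_ <-]]] := @moment_attained 0 1; [rewrite !inE eqxx !orbT|exists e', x].
- by move=> b; exists (false, b), (vec4 0 0 0 0); exact: (kE (b, false) 0).
Qed.

Definition toric_data_of : toric_data p 1 := ToricData
  (sM 0) (sM 1) (sG i0 i0) (sG i2 i2) (sG i0 i2)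
  (fun e r1 r2 => lt0r_neq0 (proj2 (chart_positive hG e (vec4 r1 0 r2 0))))
  (orbit_mu_charted hmu 0) (orbit_mu_charted hmu 1)
  (orbit11_charted hG) (orbit12_charted hG) (orbit22_charted hG)
  D1_mu0 D2_mu0 D1_mu1 D2_mu1
  (fun e r1 r2 => proj1 (moment_range e (vec4 r1 0 r2 0)))
  (fun e r1 r2 => proj2 (moment_range e (vec4 r1 0 r2 0)))
  moment_edge1 moment_edge2.

End ToricDataOf.

(** * The conformal metric *)

Section ProductJets.
Context {R : realType}.
Implicit Types a q f : R -> R -> R.

Lemma D1M a q : Cn 1 a -> Cn 1 q -> D1 (fun x y => a x y * q x y) =
  fun x y => D1 a x y * q x y + a x y * D1 q x y.
Proof.
move=> ca cq; apply/funext => x; apply/funext => y.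
exact: (has_derE (has_derM (Cn_der1 x y ca) (Cn_der1 x y cq))).
Qed.

Lemma D2M a q : Cn 1 a -> Cn 1 q -> D2 (fun x y => a x y * q x y) =
  fun x y => D2 a x y * q x y + a x y * D2 q x y.
Proof.
move=> ca cq; apply/funext => x; apply/funext => y.
exact: (has_derE (has_derM (Cn_der2 x y ca) (Cn_der2 x y cq))).
Qed.

Lemma has_derMM (a q a' q' : R -> R) t (da dq da' dq' : R) :
  has_der a t da -> has_der q t dq -> has_der a' t da' -> has_der q' t dq' ->
  has_der (fun t => a' t * q t + a t * q' t) t
    (da' * q t + a' t * dq + da * q' t + a t * dq').
Proof. by move=> *; der; ring. Qed.

Lemma jet_product a q x y (w := fun x y => a x y * q x y) : Cn 2 a -> Cn 2 q ->
  [/\ D1 w x y = D1 a x y * q x y + a x y * D1 q x y,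
      D2 w x y = D2 a x y * q x y + a x y * D2 q x y,
      D1 (D1 w) x y = D1 (D1 a) x y * q x y + 2 * D1 a x y * D1 q x y
        + a x y * D1 (D1 q) x y,
      D1 (D2 w) x y = D1 (D2 a) x y * q x y + D1 a x y * D2 q x y
        + D2 a x y * D1 q x y + a x y * D1 (D2 q) x y &
      D2 (D2 w) x y = D2 (D2 a) x y * q x y + 2 * D2 a x y * D2 q x y
        + a x y * D2 (D2 q) x y].
Proof.
move=> ca cq; have ca1 := CnS ca; have cq1 := CnS cq.
rewrite /w (D1M ca1 cq1) (D2M ca1 cq1).
have h11 := has_derMM (Cn_der1 x y ca) (Cn_der1 x y cq)
  (Cn_der1 x y (Cn_D1 ca)) (Cn_der1 x y (Cn_D1 cq)).
have h12 := has_derMM (Cn_der1 x y ca) (Cn_der1 x y cq)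
  (Cn_der1 x y (Cn_D2 ca)) (Cn_der1 x y (Cn_D2 cq)).
have h22 := has_derMM (Cn_der2 x y ca) (Cn_der2 x y cq)
  (Cn_der2 x y (Cn_D2 ca)) (Cn_der2 x y (Cn_D2 cq)).
split=> //.
- rewrite [LHS](has_derE h11).
  by move: (D1 _ _ _) (D1 _ _ _) (D1 _ _ _) (D1 _ _ _) (a _ _) (q _ _) => *; ring.
- rewrite [LHS](has_derE h12).
  by move: (D1 (D2 _) _ _) (D1 (D2 _) _ _) => *;
   move: (D1 _ _ _) (D1 _ _ _) (D2 _ _ _) (D2 _ _ _) (a _ _) (q _ _) => *; ring.
- rewrite [LHS](has_derE h22).
  by move: (D2 _ _ _) (D2 _ _ _) (D2 _ _ _) (D2 _ _ _) (a _ _) (q _ _) => *; ring.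
Qed.

Lemma has_der_invsq (f : R -> R) t (df : R) : f t != 0 -> has_der f t df ->
  has_der (fun t => (f t)^-1 * (f t)^-1) t
    (2 * (f t)^-1 * - (df * (f t)^-1 * (f t)^-1)).
Proof. by move=> f0 hf; der => //; ring. Qed.

Lemma has_der_invsq2 (f g : R -> R) t (df dg : R) : f t != 0 ->
  has_der f t df -> has_der g t dg ->
  has_der (fun t => 2 * (f t)^-1 * - (g t * (f t)^-1 * (f t)^-1)) t
    (6 * df * g t * ((f t)^-1 * (f t)^-1) * ((f t)^-1 * (f t)^-1)
     - 2 * dg * ((f t)^-1 * (f t)^-1) * (f t)^-1).
Proof. by move=> f0 hf hg; der => //; ring. Qed.

Lemma jet_invsq f x y (q := fun x y => (f x y)^-1 * (f x y)^-1) :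
  (forall x y, f x y != 0) -> Cn 2 f ->
  let h := (f x y)^-1 in
  [/\ D1 q x y = 2 * h * - (D1 f x y * h * h),
      D2 q x y = 2 * h * - (D2 f x y * h * h),
      D1 (D1 q) x y = 6 * D1 f x y * D1 f x y * (h * h) * (h * h)
        - 2 * D1 (D1 f) x y * (h * h) * h,
      D1 (D2 q) x y = 6 * D1 f x y * D2 f x y * (h * h) * (h * h)
        - 2 * D1 (D2 f) x y * (h * h) * h &
      D2 (D2 q) x y = 6 * D2 f x y * D2 f x y * (h * h) * (h * h)
        - 2 * D2 (D2 f) x y * (h * h) * h].
Proof.
move=> f0 cf /=.
have E1 : D1 q = fun x y => 2 * (f x y)^-1 * - (D1 f x y * (f x y)^-1 * (f x y)^-1).
  apply/funext => s; apply/funext => t.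
  exact: has_derE (has_der_invsq (f0 s t) (Cn_der1 s t cf)).
have E2 : D2 q = fun x y => 2 * (f x y)^-1 * - (D2 f x y * (f x y)^-1 * (f x y)^-1).
  apply/funext => s; apply/funext => t.
  exact: has_derE (has_der_invsq (f0 s t) (Cn_der2 s t cf)).
rewrite E1 E2; split=> //.
- exact: has_derE (has_der_invsq2 (f0 x y) (Cn_der1 x y cf) (Cn_der1 x y (Cn_D1 cf))).
- exact: has_derE (has_der_invsq2 (f0 x y) (Cn_der1 x y cf) (Cn_der1 x y (Cn_D2 cf))).
- exact: has_derE (has_der_invsq2 (f0 x y) (Cn_der2 x y cf) (Cn_der2 x y (Cn_D2 cf))).
Qed.

Lemma conformal_met a b c f : conformal_metric (lift2 f) (met a b c) =
  met (fun x y => a x y * ((f x y)^-1 * (f x y)^-1))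
      (fun x y => b x y * ((f x y)^-1 * (f x y)^-1))
      (fun x y => c x y * ((f x y)^-1 * (f x y)^-1)).
Proof.
apply/funext => x; apply/matrixP => i j; rewrite !mxE /lift2 -expr2 exprVn.
by case: i => -[|[|[|[|//]]]] i4; case: j => -[|[|[|[|//]]]] j4; rewrite /ent /=
  ?mulr0// mulrC.
Qed.

Lemma conformal_inverse (a b c f : R) : f != 0 -> a * b - c ^+ 2 != 0 ->
  let q := f^-1 * f^-1 in let d := a * q * (b * q) - (c * q) ^+ 2 in
  [/\ d != 0, b * q / d = f ^+ 2 * (b / (a * b - c ^+ 2)),
      a * q / d = f ^+ 2 * (a / (a * b - c ^+ 2)) &
      - (c * q) / d = f ^+ 2 * (- c / (a * b - c ^+ 2))].
Proof.
move=> f0 d0 q d.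
have dE : d = (a * b - c ^+ 2) * (f^-1 ^+ 4) by rewrite /d /q; ring.
have dn : d != 0 by rewrite dE mulf_neq0// expf_neq0// invr_eq0.
by split=> //; rewrite dE /q; field; rewrite f0 d0.
Qed.

End ProductJets.

Section ConformalScalarCurvature.
Context {R : realType}.
Variables (p q : R) (T : toric_data p q) (al1 al2 al0 : R).
Hypothesis f_neq0 : forall y1 y2, orb T (affE al1 al2 al0) y1 y2 != 0.

Let F := orb T (affE al1 al2 al0).

Let F_smooth : smooth2 F.
Proof. exact/orb_smooth/affE_box. Qed.

Let D1F : D1 F = fun x y => al1 * f11 T x y + al2 * f12 T x y.
Proof.
by apply/funext => x; apply/funext => y; exact: has_derE (orb_aff_der1 T al1 al2 al0 x y).
Qed.

Let D2F : D2 F = fun x y => al1 * f12 T x y + al2 * f22 T x y.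
Proof.
by apply/funext => x; apply/funext => y; exact: has_derE (orb_aff_der2 T al1 al2 al0 x y).
Qed.

Let has_der_comb (f g : R -> R) t (df dg : R) : has_der f t df -> has_der g t dg ->
  has_der (fun t => al1 * f t + al2 * g t) t (al1 * df + al2 * dg).
Proof. by move=> *; der; ring. Qed.

Let jetF x y :
  [/\ D1 (D1 F) x y = al1 * D1 (f11 T) x y + al2 * D2 (f11 T) x y,
   D1 (D2 F) x y = al1 * D2 (f11 T) x y + al2 * D1 (f22 T) x y &
   D2 (D2 F) x y = al1 * D1 (f22 T) x y + al2 * D2 (f22 T) x y].
Proof.
have s11 := f11_smooth T; have s12 := f12_smooth T; have s22 := f22_smooth T.
rewrite D1F D2F D2f11 D1f22; split.
- exact: has_derE (has_der_comb (smooth2_der1 x y s11) (smooth2_der1 x y s12)).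
- rewrite -D1f22.
  exact: has_derE (has_der_comb (smooth2_der1 x y s12) (smooth2_der1 x y s22)).
- exact: has_derE (has_der_comb (smooth2_der2 x y s12) (smooth2_der2 x y s22)).
Qed.

(** The derivatives of f^-2 H are expanded by Leibniz and brought, through the symmetry of mixed
    derivatives and the Hessian relations of H, to the independent ones of [scal_jet_conformal]. *)
Lemma scalar_curvature_conformal :
  scalar_curvature (conformal_metric (lift2 F) (met (f11 T) (f22 T) (f12 T))) =
  lift2 (scal_conf T al1 al2 al0).
Proof.
have cF : Cn 2 F := F_smooth 2.
pose Q x y := (F x y)^-1 * (F x y)^-1.
have cQ : Cn 2 Q by apply: CnM; apply: CnV.
have ca : Cn 2 (f11 T) := f11_smooth T 2.
have cb : Cn 2 (f22 T) := f22_smooth T 2.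
have cc : Cn 2 (f12 T) := f12_smooth T 2.
rewrite conformal_met; apply/funext => z.
rewrite scalar_curvature_met; [|exact: CnM ca cQ|exact: CnM cb cQ|exact: CnM cc cQ|];
  last first.
  move=> x y.
  by have [] := conformal_inverse (f_neq0 x y) (det_orbit T x y).
rewrite /lift2 /=; move: (z 0 (inord 0)) (z 0 (inord 2)) => x y {z}.
have [_ -> -> ->] := conformal_inverse (f_neq0 x y) (det_orbit T x y).
have [-> -> -> -> ->] := jet_product x y ca cQ.
have [-> -> -> -> ->] := jet_product x y cb cQ.
have [-> -> -> -> ->] := jet_product x y cc cQ.
have [-> -> -> -> ->] := jet_invsq x y f_neq0 cF.
have [-> -> ->] := jetF x y.
have E12 : D1 (D2 (f12 T)) = D2 (D2 (f11 T)).
  by rewrite (schwarz cc) -D2f11.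
have E22 : D2 (D2 (f12 T)) = D1 (D2 (f22 T)).
  by rewrite (schwarz cb) D1f22.
have E11 : D1 (D1 (f12 T)) = D1 (D2 (f11 T)) := congr1 D1 (esym (D2f11 T)).
rewrite E12 E22 E11 D1D1f22 -D2f11 -D1f22 D1F D2F.
exact: scal_jet_conformal (det_orbit T x y) (f_neq0 x y).
Qed.

End ConformalScalarCurvature.

(** * Reduction of the invariant to plane integrals *)

Section IntegralM.
Context {R : realType}.

Lemma half_omega_sq_met (a b c : R -> R -> R) :
  half_omega_sq (met a b c) = lift2 (fun x y => a x y * b x y - c x y ^+ 2).
Proof.
apply/funext => x; rewrite /half_omega_sq /fundamental_form /=.
have [_ e02 _ _] := JmxE (met a b c x) (inord 2).
have [e01 _ _ _] := JmxE (met a b c x) (inord 1).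
have [e03 e13 e23 _] := JmxE (met a b c x) (inord 3).
have [e02' e12 _ _] := JmxE (met a b c x) (inord 2).
rewrite e01 e03 e13 e23 e02' e12 !mxE !inordK// /ent /lift2 /=; ring.
Qed.

Lemma Rintegral_circle (k : R) :
  \int[lebesgue_measure]_(t in `[0, 2 * pi]) (fun=> k) t = 2 * pi * k :> R.
Proof.
have pi0 : (0 : R) <= 2 * pi by rewrite mulr_ge0 ?pi_ge0.
rewrite Rintegral_cst//= lebesgue_measure_itv /= lte_fin.
case: ltP => [_|le0]; first by rewrite -EFinB /= subr0 mulrC.
have -> : (2 * pi : R) = 0 by apply: le_anti; rewrite le0 pi0.
by rewrite /= mulr0 mul0r.
Qed.

(** Nothing depends on the angles, and omega^2 / 2 has density det H; each circle contributes 2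
    pi. *)
Lemma integral_M_met (a b c Phi : R -> R -> R)
    (w := fun x y => Phi x y * (a x y * b x y - c x y ^+ 2)) : cont2 w -> dom2 w ->
  integral_M (met a b c) (lift2 Phi) = (2 * pi) ^+ 2 * int2 w.
Proof.
move=> cw dw; rewrite -(int2Z _ cw dw) /integral_M half_omega_sq_met.
apply: eq_Rintegral => y1 _; apply: eq_Rintegral => y2 _ /=.
transitivity (\int[lebesgue_measure]_(t1 in `[0, 2 * pi]) (fun=> 2 * pi * w y1 y2) t1).
  apply: eq_Rintegral => t1 _; rewrite -Rintegral_circle.
  apply: eq_Rintegral => t2 _; rewrite /lift2 -/(vec4 y1 t1 y2 t2).
  by have [-> _ -> _] := vec4E y1 t1 y2 t2.
by rewrite Rintegral_circle expr2 mulrA.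
Qed.

End IntegralM.

Section FutakiFunctional.
Context {R : realType}.
Variables (p q : R) (T : toric_data p q) (a b c : R).
Notation f := (affE a b c).
Notation one := (affE 0 0 1 : ratexp R).
Hypothesis f_pos : forall x y, 0 <= x <= p -> 0 <= y <= q -> 0 < eval f x y.

Lemma eval_invE n (E : ratexp R) x y : eval (invE n E) x y = (eval E x y ^+ n)^-1.
Proof.
elim: n => [|n IH]; first by rewrite expr0 invr1.
by rewrite exprS invfM -IH.
Qed.

Lemma f_neq0 x y : 0 <= x <= p -> 0 <= y <= q -> eval f x y != 0.
Proof. by move=> hx hy; rewrite gt_eqF// f_pos. Qed.

Lemma invE_box n : in_box p q (invE n f).
Proof.
by move=> x y hx hy; elim: n => //= n IH; split => //; split => //; exact: f_neq0.
Qed.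

Definition scal_density (l : ratexp R) y1 y2 :=
  scal_conf T a b c y1 y2 / orb T f y1 y2 ^+ 5 * orb T l y1 y2 * vol T y1 y2.

Definition vol_density (l : ratexp R) y1 y2 :=
  orb T (EMul (invE 5 f) l) y1 y2 * vol T y1 y2.

Lemma vol_densityE l y1 y2 : vol_density l y1 y2 =
  (orb T f y1 y2 ^+ 5)^-1 * orb T l y1 y2 * vol T y1 y2.
Proof. by rewrite /orb -(eval_invE 5 f). Qed.

Lemma scal_density_tame l1 l2 l0 (l := affE l1 l2 l0) :
  cont2 (scal_density l) /\ dom2 (scal_density l).
Proof. exact: curvature_tame. Qed.

Lemma vol_density_tame l1 l2 l0 (l := affE l1 l2 l0) :
  cont2 (vol_density l) /\ dom2 (vol_density l).
Proof. by apply: orb_vol_tame => x y hx hy; split; [exact: invE_box|]. Qed.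

Lemma int2_comb k k' u v w : cont2 u -> dom2 u -> cont2 v -> dom2 v ->
  (forall x y : R, w x y = k * u x y + k' * v x y) -> int2 w = k * int2 u + k' * int2 v.
Proof.
move=> cu du cv dv wE; have -> : w = fun x y => k * u x y + k' * v x y.
  by apply/funext => x; apply/funext => y.
rewrite int2D ?int2Z//; by [exact: cont2Z|exact: dom2Z].
Qed.

Lemma orb_comb k k' l1 l2 l0 l1' l2' l0' y1 y2 :
  orb T (affE (k * l1 + k' * l1') (k * l2 + k' * l2') (k * l0 + k' * l0')) y1 y2 =
  k * orb T (affE l1 l2 l0) y1 y2 + k' * orb T (affE l1' l2' l0') y1 y2.
Proof. by rewrite /orb /=; move: (m1 T _ _) (m2 T _ _) => *; ring. Qed.

Let comb_scal (k k' s l l' v : R) : s * (k * l + k' * l') * v = k * (s * l * v) + k' * (s * l' * v).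
Proof. by ring. Qed.

Let density_comb (s k h l v : R) : (s - k) * h * l * v = 1 * (s * h * l * v) + (- k) * (h * l * v).
Proof. by ring. Qed.

(** The invariant multiplied by the integral of f^-5, up to a factor (2 pi)^2: clearing the
    denominator of the mean curvature leaves a determinant, linear in l and zero at l = 1. *)
Definition futaki_det (l : ratexp R) :=
  int2 (scal_density l) * int2 (vol_density one) -
  int2 (scal_density one) * int2 (vol_density l).

Lemma futaki_det_comb k k' l1 l2 l0 l1' l2' l0' :
  futaki_det (affE (k * l1 + k' * l1') (k * l2 + k' * l2') (k * l0 + k' * l0')) =
  k * futaki_det (affE l1 l2 l0) + k' * futaki_det (affE l1' l2' l0').
Proof.
have [c1 d1] := scal_density_tame l1 l2 l0.
have [c2 d2] := scal_density_tame l1' l2' l0'.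
have [c3 d3] := vol_density_tame l1 l2 l0.
have [c4 d4] := vol_density_tame l1' l2' l0'.
set L := affE (_ + _) _ _; rewrite /futaki_det.
rewrite (int2_comb (k := k) (k' := k') (w := scal_density L) c1 d1 c2 d2);
  last first.
  by move=> x y; rewrite /scal_density orb_comb comb_scal.
rewrite (int2_comb (k := k) (k' := k') (w := vol_density L) c3 d3 c4 d4);
  last first.
  by move=> x y; rewrite !vol_densityE orb_comb comb_scal.
by move: (int2 _) (int2 _) (int2 _) (int2 _) (int2 _) => *; ring.
Qed.

Lemma futaki_det_one : futaki_det one = 0.
Proof. exact: subrr. Qed.

Notation g := (met (f11 T) (f22 T) (f12 T)).
Notation F := (lift2 (orb T f)).

Lemma orb_one y1 y2 : orb T one y1 y2 = 1.
Proof. by rewrite /orb /= !mul0r !add0r. Qed.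

Lemma scal_lift2 : scalar_curvature (conformal_metric F g) = lift2 (scal_conf T a b c).
Proof. by apply: scalar_curvature_conformal => y1 y2; exact: orb_f_neq0. Qed.

Lemma integral_scal : integral_M g (fun x => scalar_curvature (conformal_metric F g) x * F x ^- 5)
  = (2 * pi) ^+ 2 * int2 (scal_density one).
Proof.
have [cs ds] := scal_density_tame 0 0 1.
have E : scal_density one = fun y1 y2 =>
    scal_conf T a b c y1 y2 / orb T f y1 y2 ^+ 5 * vol T y1 y2.
  by apply/funext => x; apply/funext => y; rewrite /scal_density orb_one mulr1.
rewrite scal_lift2 E; rewrite E in cs ds.
exact: (@integral_M_met _ _ _ _ (fun y1 y2 => scal_conf T a b c y1 y2 / orb T f y1 y2 ^+ 5)).
Qed.

Lemma integral_vol : integral_M g (fun x => F x ^- 5) =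
  (2 * pi) ^+ 2 * int2 (vol_density one).
Proof.
have [cs ds] := vol_density_tame 0 0 1.
have E : vol_density one = fun y1 y2 => orb T f y1 y2 ^- 5 * vol T y1 y2.
  by apply/funext => x; apply/funext => y; rewrite vol_densityE orb_one mulr1.
rewrite E; rewrite E in cs ds.
exact: (@integral_M_met _ _ _ _ (fun y1 y2 => orb T f y1 y2 ^- 5)).
Qed.

Lemma futaki_vanishing l1 l2 l0 (l := affE l1 l2 l0) : int2 (vol_density one) != 0 ->
  (ckem_futaki g F (lift2 (orb T l)) = 0 <-> futaki_det l = 0).
Proof.
move=> V0; have pi20 : (2 * pi) ^+ 2 != 0 :> R.
  by rewrite expf_neq0// mulf_neq0 ?pnatr_eq0// gt_eqF ?pi_gt0.
have [c1 d1] := scal_density_tame l1 l2 l0.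
have [c2 d2] := vol_density_tame l1 l2 l0.
set k := mean_curvature_const g F.
have kE : k = int2 (scal_density one) / int2 (vol_density one).
  by rewrite /k /mean_curvature_const integral_scal integral_vol -mulf_div divff ?mul1r.
pose Phi y1 y2 := (scal_conf T a b c y1 y2 - k) / orb T f y1 y2 ^+ 5 * orb T l y1 y2.
have wE y1 y2 : Phi y1 y2 * vol T y1 y2 =
    1 * scal_density l y1 y2 + (- k) * vol_density l y1 y2.
  rewrite /Phi /scal_density vol_densityE; exact: density_comb.
have WE : (fun y1 y2 => Phi y1 y2 * vol T y1 y2) =
    fun y1 y2 => 1 * scal_density l y1 y2 + (- k) * vol_density l y1 y2.
  by apply/funext => x; apply/funext => y.
have cw : cont2 (fun y1 y2 => Phi y1 y2 * vol T y1 y2).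
  by rewrite WE; apply: cont2D; exact: cont2Z.
have dw : dom2 (fun y1 y2 => Phi y1 y2 * vol T y1 y2).
  by rewrite WE; apply: dom2D; exact: dom2Z.
have -> : ckem_futaki g F (lift2 (orb T l)) = (2 * pi) ^+ 2 *
    (int2 (scal_density l) - k * int2 (vol_density l)).
  rewrite /ckem_futaki scal_lift2 -/k.
  rewrite (@integral_M_met _ _ _ _ Phi)// (int2_comb c1 d1 c2 d2 wE).
  by rewrite mul1r mulNr.
have E : (int2 (scal_density l) - k * int2 (vol_density l)) * int2 (vol_density one) =
    futaki_det l.
  by rewrite kE /futaki_det mulrBl; congr (_ - _); rewrite mulrAC divfK.
rewrite -E; split=> [/eqP|/eqP]; rewrite mulf_eq0.
  by rewrite (negbTE pi20) /= => /eqP ->; rewrite mul0r.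
by rewrite (negbTE V0) orbF => /eqP ->; rewrite mulr0.
Qed.

End FutakiFunctional.

(** * The invariant as a function of a and b *)

Section Antiderivatives.
Context {R : realType}.
Variables (p q a b c : R).
Hypotheses (p0 : 0 <= p) (q0 : 0 <= q).
Notation f := (affE a b c).
Notation fx := (affE a 0 c).
Notation fy := (affE 0 b c).
Hypothesis f_pos : forall x y : R, 0 <= x <= p -> 0 <= y <= q -> 0 < eval f x y.

Lemma affine_neq0 (x y : R) : 0 <= x <= p -> 0 <= y <= q ->
  [/\ a * x + b * y + c != 0, a * x + c != 0, b * y + c != 0 & c != 0].
Proof.
move=> hx hy; have h0p : 0 <= (0 : R) <= p by rewrite lexx.
have h0q : 0 <= (0 : R) <= q by rewrite lexx.
have := f_pos h0p h0q; have := f_pos hx h0q; have := f_pos h0p hy; have := f_pos hx hy.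
rewrite /= !mulr0 !add0r !addr0.
by split; rewrite gt_eqF.
Qed.

(* Antiderivatives of f^-2 and f^-3 along vertical and horizontal lines, and   *)
(* of f^-4 and f^-5, in forms that stay regular when a or b vanishes.          *)
Definition edge2v := EMul EY (EMul (EInv fx) (EInv f)).
Definition edge2h := EMul EX (EMul (EInv fy) (EInv f)).
Definition edge3v := EMul (EC 2^-1) (EMul EY (EMul (EAdd fx f) (EMul (invE 2 fx) (invE 2 f)))).
Definition edge3h := EMul (EC 2^-1) (EMul EX (EMul (EAdd fy f) (EMul (invE 2 fy) (invE 2 f)))).

Definition prim4 := EMul (EC 3^-1) (EMul EX (EMul
  (EAdd (EMul f f) (EAdd (EMul f fy) (EMul fy fy))) (EMul (invE 3 fy) (invE 3 f)))).
Definition prim5 := EMul (EC 4^-1) (EMul EX (EMul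
  (EMul (EAdd f fy) (EAdd (EMul f f) (EMul fy fy))) (EMul (invE 4 fy) (invE 4 f)))).

(** On the rectangle with corners (0, 0) and (x, y) the values of f at the vertices are c, [fx],
    [fy] and f, with S = c + f = [fx] + [fy]. The integral of f^-4 is (c^-2 + f^-2 - fx^-2 - fy^-2)
    / (6 a b), and that of f^-5 is the analogue with cubes and 12. In terms of S, P and Q the
    numerator is divisible by Q - P = a b x y, which removes a b from the denominator. *)
Let S := EAdd (EC c) f.
Let P := EMul (EC c) f.
Let Q := EMul fx fy.

Definition pot4 := EMul (EC 6^-1) (EMul (EMul EX EY)
  (EMul (EAdd (EMul (EMul S S) (EAdd P Q)) (EMul (EC (- 2)) (EMul P Q)))
        (EMul (invE 2 P) (invE 2 Q)))).
Definition pot5 := EMul (EC 12^-1) (EMul (EMul EX EY) (EMul (EMul S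
  (EAdd (EMul (EMul S S) (EAdd (EMul P P) (EAdd (EMul P Q) (EMul Q Q))))
        (EMul (EC (- 3)) (EMul (EMul P Q) (EAdd P Q)))))
        (EMul (invE 3 P) (invE 3 Q)))).

Ltac dom := move=> x y hx hy; have [n1 n2 n3 n4] := affine_neq0 hx hy;
  rewrite /= ?mul0r ?addr0 ?add0r ?mulf_neq0//; repeat split.

Lemma edge_box : [/\ in_box p q edge2v, in_box p q edge2h, in_box p q edge3v &
  in_box p q edge3h].
Proof. by split; dom. Qed.

Lemma prim_box : in_box p q prim4 /\ in_box p q prim5.
Proof. by split; dom. Qed.

Lemma pot_box : in_box p q pot4 /\ in_box p q pot5.
Proof. by split; dom; rewrite ?mulf_neq0. Qed.

Lemma edge2_diff (x y : R) : 0 <= x <= p -> 0 <= y <= q ->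
  eval (diffE false edge2v) x y = eval f x y / eval f x y ^+ 3 /\
  eval (diffE true edge2h) x y = eval f x y / eval f x y ^+ 3.
Proof.
move=> hx hy; have [n1 n2 n3 n4] := affine_neq0 hx hy.
by split; rewrite /=; field; rewrite ?n1 ?n2 ?n3.
Qed.

Lemma edge3_diff (x y : R) : 0 <= x <= p -> 0 <= y <= q ->
  eval (diffE false edge3v) x y = eval (affE 0 0 1) x y / eval f x y ^+ 3 /\
  eval (diffE true edge3h) x y = eval (affE 0 0 1) x y / eval f x y ^+ 3.
Proof.
move=> hx hy; have [n1 n2 n3 n4] := affine_neq0 hx hy.
by split; rewrite /=; field; rewrite ?n1 ?n2 ?n3.
Qed.

Lemma prim4_diff (x y : R) : 0 <= x <= p -> 0 <= y <= q ->
  eval (diffE true prim4) x y = eval (EMul (invE 5 f) f) x y.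
Proof.
move=> hx hy; have [n1 n2 n3 n4] := affine_neq0 hx hy.
by rewrite /=; field; rewrite ?n1 ?n2 ?n3.
Qed.

Lemma prim5_diff (x y : R) : 0 <= x <= p -> 0 <= y <= q ->
  eval (diffE true prim5) x y = eval (EMul (invE 5 f) (affE 0 0 1)) x y.
Proof.
move=> hx hy; have [n1 n2 n3 n4] := affine_neq0 hx hy.
by rewrite /=; field; rewrite ?n1 ?n2 ?n3.
Qed.

Lemma pot4_diff (x y : R) : 0 <= x <= p -> 0 <= y <= q ->
  eval (diffE false pot4) x y = eval prim4 x y.
Proof.
move=> hx hy; have [n1 n2 n3 n4] := affine_neq0 hx hy.
by rewrite /=; field; rewrite ?n1 ?n2 ?n3 ?n4.
Qed.

Lemma pot5_diff (x y : R) : 0 <= x <= p -> 0 <= y <= q ->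
  eval (diffE false pot5) x y = eval prim5 x y.
Proof.
move=> hx hy; have [n1 n2 n3 n4] := affine_neq0 hx hy.
by rewrite /=; field; rewrite ?n1 ?n2 ?n3 ?n4.
Qed.

End Antiderivatives.

Section ExplicitInvariant.
Context {R : realType}.

Lemma curvature_corners (p q : R) (T : toric_data p q) (a b c l1 l2 l0 : R) Ev Eh
  (f := affE a b c) (l := affE l1 l2 l0) :
  (forall x y : R, 0 <= x <= p -> 0 <= y <= q -> 0 < eval f x y) ->
  in_box p q Ev -> in_box p q Eh ->
  (forall x y : R, 0 <= x <= p -> 0 <= y <= q ->
    eval (diffE false Ev) x y = eval l x y / eval f x y ^+ 3 /\
    eval (diffE true Eh) x y = eval l x y / eval f x y ^+ 3) ->
  (forall x, eval Ev x 0 = 0) -> (forall y, eval Eh 0 y = 0) ->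
  int2 (scal_density T a b c l) =
    2 * (eval Ev p q + eval Ev 0 q + eval Eh p q + eval Eh p 0).
Proof.
move=> fp bv bh d Ev0 Eh0.
have := curvature_integral T fp bv bh (fun x y hx hy => proj1 (d x y hx hy))
  (fun x y hx hy => proj2 (d x y hx hy)).
rewrite -/(scal_density T a b c l) => ->.
rewrite /corners /corner !sgE /= !Ev0 !Eh0.
by move: (eval _ _ _) (eval _ _ _) (eval _ _ _) (eval _ _ _) => *; ring.
Qed.

Lemma volume_corners (p q : R) (T : toric_data p q) (a b c l1 l2 l0 : R) E E1
  (l := affE l1 l2 l0) :
  in_box p q E -> in_box p q E1 ->
  (forall x y : R, 0 <= x <= p -> 0 <= y <= q -> eval (diffE false E) x y = eval E1 x y) ->
  (forall x y : R, 0 <= x <= p -> 0 <= y <= q ->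
    eval (diffE true E1) x y = eval (EMul (invE 5 (affE a b c)) l) x y) ->
  (forall x, eval E x 0 = 0) -> (forall y, eval E 0 y = 0) ->
  int2 (vol_density T a b c l) = eval E p q.
Proof.
move=> bE bE1 d d1 E0 E0'; rewrite /vol_density (volume_integral T bE bE1 d d1).
by rewrite /corners /corner /= !E0 !E0' !subr0 addr0.
Qed.

Variables (p : R) (T : toric_data p 1).
Hypothesis p_gt0 : 0 < p.

Let p0 : 0 <= p. Proof. exact: ltW. Qed.
Let h01 : 0 <= (0 : R) <= 1. Proof. by rewrite lexx ler01. Qed.
Let h11 : 0 <= (1 : R) <= 1. Proof. by rewrite lexx ler01. Qed.
Let h0p : 0 <= (0 : R) <= p. Proof. by rewrite lexx. Qed.
Let hpp : 0 <= p <= p. Proof. by rewrite lexx andbT. Qed.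

Section GeneralPotential.
Variables (a b c : R).
Notation f := (affE a b c).
Hypothesis f_pos : forall x y : R, 0 <= x <= p -> 0 <= y <= 1 -> 0 < eval f x y.
Hypothesis norm : b + p * a + 2 * c = 1.

Let P := c * (a * p + b + c).
Let Q := (a * p + c) * (b + c).

Lemma corner_gt0 : [/\ 0 < c, 0 < a * p + c, 0 < b + c & 0 < a * p + b + c].
Proof.
have := f_pos h0p h01; have := f_pos hpp h01; have := f_pos h0p h11.
have := f_pos hpp h11.
by rewrite /= !mulr0 !mulr1 !add0r !addr0.
Qed.

Lemma int_f5 : int2 (vol_density T a b c (affE 0 0 1)) =
  p * (P ^+ 2 + P * Q + Q ^+ 2 - 3 * P * Q * (P + Q)) / (12 * P ^+ 3 * Q ^+ 3).
Proof.
have [_ bp] := pot_box p0 ler01 f_pos; have [_ bp1] := prim_box p0 ler01 f_pos.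
rewrite (volume_corners T bp bp1 (pot5_diff p0 ler01 f_pos) (prim5_diff p0 ler01 f_pos)).
- have [c0 B0 C0 D0] := corner_gt0.
  (* By the normalization the values of f at opposite vertices add up to 1, so S = 1 at the vertex
     (p, 1). *)
  have E : a * p + b + c = 1 - c by rewrite -norm; ring.
  have D1 : 1 - c != 0 by rewrite -E gt_eqF.
  rewrite /= /P /Q !mulr1 !mul0r !addr0 !add0r E.
  rewrite [c + (1 - c)]addrC subrK.
  by field; rewrite ?D1 ?gt_eqF.
- by move=> x; rewrite /= !(mulr0, mul0r).
- by move=> y; rewrite /= !(mulr0, mul0r).
Qed.

Lemma int_f4 : int2 (vol_density T a b c f) =
  p * (P + Q - 2 * P * Q) / (6 * P ^+ 2 * Q ^+ 2).
Proof.
have [bp _] := pot_box p0 ler01 f_pos; have [bp1 _] := prim_box p0 ler01 f_pos.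
rewrite (volume_corners T bp bp1 (pot4_diff p0 ler01 f_pos) (prim4_diff p0 ler01 f_pos)).
- have [c0 B0 C0 D0] := corner_gt0.
  have E : a * p + b + c = 1 - c by rewrite -norm; ring.
  have D1 : 1 - c != 0 by rewrite -E gt_eqF.
  rewrite /= /P /Q !mulr1 !mul0r !addr0 !add0r E.
  rewrite [c + (1 - c)]addrC subrK.
  by field; rewrite ?D1 ?gt_eqF.
- by move=> x; rewrite /= !(mulr0, mul0r).
- by move=> y; rewrite /= !(mulr0, mul0r).
Qed.

(** P and Q are products of two positive numbers of sum 1, so each is at most 1/4 and the cubic term
    is dominated by the quadratic ones. *)
Lemma int_f5_gt0 : 0 < int2 (vol_density T a b c (affE 0 0 1)).
Proof.
have [A0 B0 C0 D0] := corner_gt0.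
have P0 : 0 < P by rewrite mulr_gt0.
have Q0 : 0 < Q by rewrite mulr_gt0.
have P4 : P <= 4^-1.
  have : 0 <= (2 * c - 1) ^+ 2 by exact: sqr_ge0.
  have -> : P = c * (1 - c) by rewrite /P -norm; ring.
  by move=> h; nra.
have Q4 : Q <= 4^-1.
  have : 0 <= (2 * (a * p + c) - 1) ^+ 2 by exact: sqr_ge0.
  have -> : Q = (a * p + c) * (1 - (a * p + c)) by rewrite /Q -norm; ring.
  by move: (a * p + c) => B h; nra.
rewrite int_f5; apply: divr_gt0; last by rewrite !mulr_gt0 ?exprn_gt0.
apply: mulr_gt0 => //; move: P Q P0 Q0 P4 Q4 => s t s0 t0 s4 t4.
have st : 0 < s * t by rewrite mulr_gt0.
have h1 : s * t * (s + t) <= s * t * 2^-1.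
  by rewrite ler_pM2l//; lra.
have h2 : 0 <= (s - t) ^+ 2 by exact: sqr_ge0.
nra.
Qed.

Lemma int_scal_f : int2 (scal_density T a b c f) =
  2 * (((a * p + c) * (a * p + b + c))^-1 + (c * (b + c))^-1
       + p / ((b + c) * (a * p + b + c)) + p / (c * (a * p + c))).
Proof.
have [bv bh _ _] := edge_box p0 ler01 f_pos.
rewrite (curvature_corners T f_pos bv bh (edge2_diff p0 ler01 f_pos)).
- have [A0 B0 C0 D0] := corner_gt0.
  rewrite /= !mulr1 !mulr0 !mul0r !addr0 !add0r !mul1r.
  by congr (2 * (_ + _ + _ + _)); rewrite invfM.
- by move=> x; rewrite /= mul0r.
- by move=> y; rewrite /= mul0r.
Qed.

Lemma int_scal_1 : int2 (scal_density T a b c (affE 0 0 1)) =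
  (a * p + c + (a * p + b + c)) / ((a * p + c) * (a * p + b + c)) ^+ 2
  + (c + (b + c)) / (c * (b + c)) ^+ 2
  + p * (b + c + (a * p + b + c)) / ((b + c) * (a * p + b + c)) ^+ 2
  + p * (c + (a * p + c)) / (c * (a * p + c)) ^+ 2.
Proof.
have [_ _ bv bh] := edge_box p0 ler01 f_pos.
rewrite (curvature_corners T f_pos bv bh (edge3_diff p0 ler01 f_pos)).
- have [A0 B0 C0 D0] := corner_gt0.
  rewrite /= !mulr1 !mulr0 !mul0r !addr0 !add0r.
  by field; rewrite ?gt_eqF.
- by move=> x; rewrite /= !(mul0r, mulr0).
- by move=> y; rewrite /= !(mul0r, mulr0).
Qed.

(** The test function f is chosen because l f^-5 and l f^-3 become the pure powers f^-4 and f^-2,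
    and because the outcome is even in both p a and b. *)
Lemma futaki_det_f : futaki_det T a b c f = - p *
  ((1 - (p * a) ^+ 2 - b ^+ 2) * ((2 - p) * (p * a) ^+ 2 + (2 * p - 1) * b ^+ 2)
   + 2 * (p * a) ^+ 4 + 2 * p * b ^+ 4) / (12 * (P * Q) ^+ 3).
Proof.
have [A0 B0 C0 D0] := corner_gt0.
rewrite /futaki_det int_scal_f int_f5 int_scal_1 int_f4 /P /Q.
(* The vertex values become (1 +- b +- p a) / 2, and the claim an identity in p, x = p a and b. *)
have cE : c = (1 - b - p * a) / 2 by move: norm; lra.
have h : [/\ 1 - b - p * a != 0, 1 - b + p * a != 0, 1 + b - p * a != 0 &
    1 + b + p * a != 0].
  split; apply: lt0r_neq0.
  - by move: A0; rewrite cE; lra.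
  - by move: B0; rewrite cE; lra.
  - by move: C0; rewrite cE; lra.
  - by move: D0; rewrite cE; lra.
rewrite cE {A0 B0 C0 D0 cE}; case: h => A0 B0 C0 D0.
rewrite (_ : a * p + (1 - b - p * a) / 2 = (1 - b + p * a) / 2); last by field.
rewrite (_ : b + (1 - b - p * a) / 2 = (1 + b - p * a) / 2); last by field.
rewrite (_ : a * p + b + (1 - b - p * a) / 2 = (1 + b + p * a) / 2); last by field.
by move: (p * a) A0 B0 C0 D0 => x A0 B0 C0 D0; field; rewrite A0 B0 C0 D0.
Qed.

End GeneralPotential.

End ExplicitInvariant.

(** * Vanishing when f does not depend on mu_2 *)

Section SymmetricPotentials.
Context {R : realType}.

(** With [l1] nonzero, l1 x + l0, y - 1/2 and 1 span the affine functions. *)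
Lemma affine_span0 (N : R -> R -> R -> R) (l1 l0 h1 h2 h0 : R) :
  (forall k k' u1 u2 u0 v1 v2 v0,
    N (k * u1 + k' * v1) (k * u2 + k' * v2) (k * u0 + k' * v0) =
    k * N u1 u2 u0 + k' * N v1 v2 v0) ->
  l1 != 0 -> N l1 0 l0 = 0 -> N 0 1 (- 2^-1) = 0 -> N 0 0 1 = 0 -> N h1 h2 h0 = 0.
Proof.
move=> comb l1n N1 N2 N0; pose k0 := h1 / l1 * l0 + h2 * - 2^-1.
have E : N h1 h2 k0 = 0.
  have := comb (h1 / l1) h2 l1 0 l0 0 1 (- 2^-1).
  by rewrite N1 N2 divfK// !mulr0 addr0 add0r mulr1 addr0.
have := comb 1 (h0 - k0) h1 h2 k0 0 0 1; rewrite E N0 !mulr0 !addr0 !mul1r mulr1.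
by rewrite addrCA subrr addr0.
Qed.

Variables (p : R) (T : toric_data p 1).
Hypothesis p_gt0 : 0 < p.

Let p0 : 0 <= p. Proof. exact: ltW. Qed.
Let h11 : 0 <= (1 : R) <= 1. Proof. by rewrite lexx ler01. Qed.

Section IndependentOfSecond.
Variables (a c : R).
Hypothesis f_pos : forall x y : R, 0 <= x <= p -> 0 <= y <= 1 -> 0 < eval (affE a 0 c) x y.

Let pot : ratexp R := EMul (EC 2^-1) (EAdd (EMul EY EY) (EMul (EC (- 1)) EY)).
Let lin : ratexp R := EAdd EY (EC (- 2^-1)).

(** The test function mu_2 - 1/2 is odd under the reflection mu_2 -> 1 - mu_2, which preserves f.
    Concretely, [pot] is the antiderivative of [lin] that vanishes at both ends, and [lin] takes
    opposite values there. *)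
Lemma futaki_det_mu2 : futaki_det T a 0 c (affE 0 1 (- 2^-1)) = 0.
Proof.
have [_ bp1] := prim_box p0 ler01 f_pos; have [_ _ _ bh] := edge_box p0 ler01 f_pos.
have bE1 : in_box p 1 (EMul lin (prim5 a 0 c)) by move=> x y hx hy; split=> //; exact: bp1.
have bE : in_box p 1 (EMul pot (prim5 a 0 c)) by move=> x y hx hy; split=> //; exact: bp1.
have bv : in_box p 1 (EMul pot (invE 3 (affE a 0 c))).
  by move=> x y hx hy; split=> //; exact: (invE_box f_pos).
have bh' : in_box p 1 (EMul lin (edge3h a 0 c)).
  by move=> x y hx hy; split=> //; exact: bh.
have V0 : int2 (vol_density T a 0 c (affE 0 1 (- 2^-1))) = 0.
  rewrite (volume_corners T bE bE1).
  - rewrite [LHS]/= (_ : 1 * 1 + -1 * 1 = 0) ?mulr0 ?mul0r//; ring.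
  - move=> x y hx hy; have [n1 n2 n3 n4] := affine_neq0 p0 ler01 f_pos hx hy.
    rewrite mul0r addr0 in n1.
    by rewrite /=; field; rewrite ?n1 ?n4.
  - move=> x y hx hy; have [n1 n2 n3 n4] := affine_neq0 p0 ler01 f_pos hx hy.
    rewrite mul0r addr0 in n1.
    by rewrite /=; field; rewrite ?n1 ?n4.
  - by move=> x; rewrite /= !(mulr0, addr0, mul0r).
  - by move=> y; rewrite /= !(mulr0, mul0r).
have S0 : int2 (scal_density T a 0 c (affE 0 1 (- 2^-1))) = 0.
  rewrite (curvature_corners T f_pos bv bh').
  - rewrite [LHS]/= !(mul0r, addr0, add0r); field.
    have hp : 0 <= p <= p by rewrite p0 lexx.
    have [_ n2 _ n4] := affine_neq0 p0 ler01 f_pos hp (y := 1) h11.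
    by rewrite n2.
  - move=> x y hx hy; have [n1 n2 n3 n4] := affine_neq0 p0 ler01 f_pos hx hy.
    rewrite mul0r addr0 in n1.
    by split; rewrite /=; field; rewrite ?n1 ?n4.
  - by move=> x; rewrite /= !(mulr0, addr0, mul0r).
  - by move=> y; rewrite /= !(mulr0, mul0r).
by rewrite /futaki_det V0 S0 mul0r mulr0 subr0.
Qed.

End IndependentOfSecond.

Section ConstantPotential.
Variable c : R.
Hypothesis c_gt0 : 0 < c.

Let f_pos (x y : R) : 0 <= x <= p -> 0 <= y <= 1 -> 0 < eval (affE 0 0 c) x y.
Proof. by rewrite /= !mul0r !add0r. Qed.

Let pot : ratexp R := EMul (EC 2^-1) (EAdd (EMul EX EX) (EMul (EC (- p)) EX)).
Let lin : ratexp R := EAdd EX (EC (- (p / 2))).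

(** For constant f the reflection mu_1 -> p - mu_1 is a symmetry too, and mu_1 - p/2 is odd under
    it. *)
Lemma futaki_det_mu1 : futaki_det T 0 0 c (affE 1 0 (- (p / 2))) = 0.
Proof.
have n : c != 0 by rewrite gt_eqF.
have bE1 : in_box p 1 (EMul pot (invE 5 (affE 0 0 c))).
  by move=> x y hx hy; split=> //; exact: (invE_box f_pos).
have bE : in_box p 1 (EMul EY (EMul pot (invE 5 (affE 0 0 c)))).
  by move=> x y hx hy; split=> //; exact: bE1.
have bv : in_box p 1 (EMul EY (EMul lin (invE 3 (affE 0 0 c)))).
  by move=> x y hx hy; split=> //; split=> //; exact: (invE_box f_pos).
have bh : in_box p 1 (EMul pot (invE 3 (affE 0 0 c))).
  by move=> x y hx hy; split=> //; exact: (invE_box f_pos).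
have V0 : int2 (vol_density T 0 0 c (affE 1 0 (- (p / 2)))) = 0.
  rewrite (volume_corners T bE bE1).
  - by rewrite /=; field.
  - by move=> x y hx hy; rewrite /=; field.
  - by move=> x y hx hy; rewrite /=; field.
  - by move=> x; rewrite /= mul0r.
  - by move=> y; rewrite /= !(mulr0, addr0, mul0r).
have S0 : int2 (scal_density T 0 0 c (affE 1 0 (- (p / 2)))) = 0.
  rewrite (curvature_corners T f_pos bv bh).
  - by rewrite /=; field.
  - by move=> x y hx hy; split; rewrite /=; field.
  - by move=> x; rewrite /= mul0r.
  - by move=> y; rewrite /= !(mulr0, addr0, mul0r).
by rewrite /futaki_det V0 S0 mul0r mulr0 subr0.
Qed.

End ConstantPotential.

Lemma futaki_det_vanishes a c h1 h2 h0 :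
  (forall x y : R, 0 <= x <= p -> 0 <= y <= 1 -> 0 < eval (affE a 0 c) x y) ->
  p * a + 2 * c = 1 -> a = 0 \/ p * (p * a) ^+ 2 = p - 2 ->
  futaki_det T a 0 c (affE h1 h2 h0) = 0.
Proof.
move=> f_pos norm Ha.
have det2 := futaki_det_mu2 f_pos.
have det0 := futaki_det_one T a 0 c.
suff [l1 [l0 [l1n det1]]] : exists l1 l0, l1 != 0 /\ futaki_det T a 0 c (affE l1 0 l0) = 0.
  exact: (@affine_span0 (fun l1 l2 l0 => futaki_det T a 0 c (affE l1 l2 l0)) l1 l0 h1 h2 h0
    (futaki_det_comb T f_pos) l1n det1 det2 det0).
have norm' : 0 + p * a + 2 * c = 1 by rewrite add0r.
have [a0|an] := eqVneq a 0.
  exists 1, (- (p / 2)); split; [exact: oner_neq0|rewrite a0].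
  apply: futaki_det_mu1.
  have := f_pos 0 0; rewrite /= !mulr0 !add0r; apply; by rewrite lexx ?ler01.
(* The third test function is f itself, not constant as a is nonzero; at b = 0 the bracket is (p
   a)^2 (2 - p + p (p a)^2). *)
exists a, c; split; [exact: an|rewrite (futaki_det_f T p_gt0 f_pos norm') expr0n /=].
rewrite !mulr0 !addr0 subr0; case: Ha => [/eqP|Ha]; first by rewrite (negbTE an).
rewrite -[X in _ * X / _](_ : (p * a) ^+ 2 * (2 - p + p * (p * a) ^+ 2) = _); last by ring.
rewrite Ha (_ : 2 - p + (p - 2) = 0); last by ring.
by rewrite !mulr0 mul0r.
Qed.

End SymmetricPotentials.

(** * Hamiltonian functions are affine in the moment map *)

Section Hamiltonians.
Context {R : realType}.

(** The barycentric weights are the bilinear ones of x / p and y. *)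
Lemma Delta_box (p x y : R) : 0 < p -> 0 <= x <= p -> 0 <= y <= 1 -> Delta p (vec2 x y).
Proof.
move=> p0 /andP[x0 xp] /andP[y0 y1]; pose s := x / p.
have xE : x = s * p by rewrite divfK ?gt_eqF.
have s0 : 0 <= s by rewrite divr_ge0// ltW.
have s1 : s <= 1 by rewrite ler_pdivrMr// mul1r.
exists (fun i : 'I_4 => [:: (1 - s) * (1 - y); s * (1 - y); s * y; (1 - s) * y]`_i).
split.
- by case=> -[|[|[|[|//]]]] i4 /=; rewrite mulr_ge0 ?subr_ge0.
- by rewrite !big_ord_recl big_ord0 /=; ring.
- rewrite xE; apply/rowP => j; rewrite summxE !big_ord_recl big_ord0 /= !mxE.
  by case: j => -[|[|//]] j2 /=; ring.
Qed.

Lemma has_der_ray (w : 'rV[R]_4 -> R) (x : 'rV[R]_4) :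
  (forall z v : 'rV[R]_4, is_derive z v w 0) -> w x = w 0.
Proof.
move=> dw; have h t : has_der (fun t : R => w (t *: x)) t 0.
  have [d1 d2] := dw (t *: x) x.
  have E (h : R) : w (h *: x + t *: x) = (fun s : R => w (s *: x)) (h *: (1 : R) + t).
    by rewrite /= -scalerDl /GRing.scale /= mulr1.
  by apply: DeriveDef; [exact: derivable_eq_along E d1|rewrite -(derive_eq_along E)].
by have := has_der0_cst 1 0 h; rewrite scale1r scale0r.
Qed.

Variables (G : chart -> 'rV[R]_4 -> 'M[R]_4) (mu : 'I_2 -> chart -> 'rV[R]_4 -> R).
Hypothesis hmu : moment_map G mu.

Lemma hamiltonian_affine (h : 'rV[R]_2) (k : R) : hamiltonian (orbit_metric G) h
  (fun x => h 0 0 * orbit_fun (mu 0) x + h 0 1 * orbit_fun (mu 1) x + k).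
Proof.
move=> x v.
have d0 := mm_hamiltonian hmu 0 x v; have d1 := mm_hamiltonian hmu 1 x v.
have hE : torus_field h = h 0 0 *: torus_field (delta_mx 0 0) + h 0 1 *: torus_field (delta_mx 0 1).
  apply/rowP => j; rewrite !mxE.
  by case: j => -[|[|[|[|//]]]] j4 /=; rewrite ?(mulr0, mulr1, addr0, add0r).
rewrite hE linearD /= !linearZ /= mulmxDr -!scalemxAr !mxE -[X in is_derive _ _ _ X]addr0.
have e0 := is_deriveZ (h 0 0) d0; have e1 := is_deriveZ (h 0 1) d1.
rewrite !mxE in e0 e1.
exact: is_deriveD (is_deriveD e0 e1) (is_derive_cst k x v).
Qed.

(** Two Hamiltonians of h have the same derivatives in all directions, and the orbit coordinates
    fill R^4, which is connected along rays from 0. *)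
Lemma hamiltonian_unique (h : 'rV[R]_2) u : hamiltonian (orbit_metric G) h u ->
  exists k, u = fun x => h 0 0 * orbit_fun (mu 0) x + h 0 1 * orbit_fun (mu 1) x + k.
Proof.
move=> hu; have ha := hamiltonian_affine h 0.
set u0 := fun _ => _ in ha; exists (u 0 - u0 0); apply/funext => x.
have d z v : is_derive z v (u - u0) 0.
  by have := is_deriveB (hu z v) (ha z v); rewrite subrr.
have := has_der_ray x d; rewrite /= => /eqP; rewrite -[X in X == _]/(u x - u0 x).
rewrite -[X in _ == X]/(u 0 - u0 0) subr_eq => /eqP ->; rewrite addrC /u0 addr0.
by [].
Qed.

End Hamiltonians.

Section Vanishing.
Context {R : realType}.
Variables (p : R) (G : chart -> 'rV[R]_4 -> 'M[R]_4) (mu : 'I_2 -> chart -> 'rV[R]_4 -> R).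
Hypotheses (p_gt0 : 0 < p) (hG : toric_kahler_metric G) (hmu : moment_map G mu).
Hypothesis himage : moment_image mu = Delta p.

Let T : toric_data p 1 := toric_data_of (ltW p_gt0) hG hmu himage.

Lemma affine_mu (a b c : R) : (fun x => a * orbit_fun (mu 0) x + b * orbit_fun (mu 1) x + c) =
  lift2 (orb T (affE a b c)).
Proof. by apply/funext => x; rewrite !(orbit_fun_mu hG hmu). Qed.

Lemma admissible_pos (a b c : R) : admissible p a b c ->
  forall x y : R, 0 <= x <= p -> 0 <= y <= 1 -> 0 < eval (affE a b c) x y.
Proof.
move=> [pos _] x y hx hy; have := pos _ (Delta_box p_gt0 hx hy).
by rewrite /affine_fun !mxE.
Qed.

(** Every affine function of the moment map is Hamiltonian for its linear part and conversely, so
    testing all fields of Lie(T^2) is testing all affine l. *)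
Lemma ckem_futaki_vanishesE (a b c : R) : admissible p a b c ->
  ckem_futaki_vanishes G mu a b c <->
  forall h1 h2 h0 : R, futaki_det T a b c (affE h1 h2 h0) = 0.
Proof.
move=> adm; have f_pos := admissible_pos adm.
have V0 : int2 (vol_density T a b c (affE 0 0 1)) != 0.
  by rewrite gt_eqF// int_f5_gt0//; case: adm.
have fE : (fun x => affine_fun a b c (\row_(j < 2) orbit_fun (mu j) x)) =
    lift2 (orb T (affE a b c)).
  by rewrite -affine_mu; apply/funext => x; rewrite /affine_fun !mxE.
have gE : orbit_metric G = met (f11 T) (f22 T) (f12 T) := orbit_metric_met hG hmu.
have key h1 h2 h0 := @futaki_vanishing _ _ _ T a b c f_pos h1 h2 h0 V0.
rewrite /ckem_futaki_vanishes fE gE; split=> [van h1 h2 h0|det0 h u].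
  apply/key; apply: (van (vec2 h1 h2)); rewrite -gE -affine_mu.
  by have := hamiltonian_affine hmu (vec2 h1 h2) h0; rewrite !mxE.
rewrite -gE => /(hamiltonian_unique hmu) [k ->]; rewrite gE affine_mu.
exact/key.
Qed.

End Vanishing.

(** * The equations for a and b *)

Section PotentialEquations.
Context {R : realType}.

(* With x = p a, the hypotheses bound the values of 2 f at the four corners.  *)
Lemma bracket_eq0 (p x b : R) : 1 <= p -> p <= 2 ->
  0 < 1 - b - x -> 0 < 1 - b + x -> 0 < 1 + b - x -> 0 < 1 + b + x ->
  (1 - x ^+ 2 - b ^+ 2) * ((2 - p) * x ^+ 2 + (2 * p - 1) * b ^+ 2)
   + 2 * x ^+ 4 + 2 * p * b ^+ 4 = 0 -> x = 0 /\ b = 0.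
Proof.
move=> p1 p2 h1 h2 h3 h4.
have u0 : 0 < 1 - x ^+ 2 - b ^+ 2.
  have k1 := mulr_gt0 h1 h4; have k2 := mulr_gt0 h2 h3.
  (* The mean of the products of the two pairs of opposite vertex values of 2 f. *)
  have -> : 1 - x ^+ 2 - b ^+ 2 =
    ((1 - b - x) * (1 + b + x) + (1 - b + x) * (1 + b - x)) / 2 by field.
  by rewrite divr_gt0// addr_gt0.
have X0 : 0 <= x ^+ 2 := sqr_ge0 x; have Y0 : 0 <= b ^+ 2 := sqr_ge0 b.
have t1 : 0 <= (1 - x ^+ 2 - b ^+ 2) * ((2 - p) * x ^+ 2 + (2 * p - 1) * b ^+ 2).
  by apply: mulr_ge0; [exact: ltW|apply: addr_ge0; apply: mulr_ge0 => //; lra].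
have t2 : 0 <= x ^+ 4 by rewrite (exprM x 2 2) sqr_ge0.
have t3 : 0 <= p * b ^+ 4 by rewrite mulr_ge0 ?(exprM b 2 2) ?sqr_ge0//; lra.
move: t1; set t := (_ * _) => t1 E.
have x4 : x ^+ 4 = 0 by apply/le_anti; rewrite t2 andbT; move: E; rewrite -mulrA; lra.
have b4 : p * b ^+ 4 = 0 by apply/le_anti; rewrite t3 andbT; move: E; rewrite -mulrA; lra.
split; apply/eqP; first by move/eqP: x4; rewrite expf_eq0.
by move/eqP: b4; rewrite mulf_eq0 expf_eq0 /= gt_eqF//; lra.
Qed.

Lemma root_sqr (p a : R) : 2 < p ->
  a = Num.sqrt (p - 2) / p `^ (3 / 2) \/ a = - (Num.sqrt (p - 2) / p `^ (3 / 2)) ->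
  p * (p * a) ^+ 2 = p - 2.
Proof.
move=> p2 ha; have p0 : 0 < p by lra.
have -> : (p * a) ^+ 2 = p ^+ 2 * (Num.sqrt (p - 2) / p `^ (3 / 2)) ^+ 2.
  by case: ha => ->; rewrite ?mulrN ?sqrrN exprMn.
have pE : (p `^ (3 / 2)) ^+ 2 = p ^+ 3.
  rewrite -powR_mulrn ?powR_ge0// -powRrM divfK ?pnatr_eq0//.
  by rewrite -[3]/(3%:R) powR_mulrn// ltW.
rewrite expr_div_n pE sqr_sqrtr; last by lra.
by field; rewrite gt_eqF.
Qed.

(** For b = 0, f interpolates linearly between its values (1 - p a) / 2 and (1 + p a) / 2 at mu_1 =
    0 and mu_1 = p. *)
Lemma admissible_first (p a c : R) : 0 < p -> p * a + 2 * c = 1 -> (p * a) ^+ 2 < 1 ->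
  admissible p a 0 c.
Proof.
move=> p0 norm a1; split; last by rewrite add0r.
move=> q /(Delta_range (ltW p0)) [/andP[x0 xp] _]; rewrite /affine_fun mul0r addr0.
move: (q 0 0) x0 xp => x x0 xp.
have /andP[l r] : -1 < p * a < 1.
  by rewrite -ltr_norml -(@ltr_pXn2r _ 2) ?nnegrE// expr1n real_normK ?num_real.
rewrite -(pmulr_rgt0 _ (mulr_gt0 (@ltr0n R 2) p0)).
have -> : 2 * p * (a * x + c) = (p - x) * (1 - p * a) + x * (1 + p * a).
  have cE : 2 * c = 1 - p * a by move: norm; lra.
  by transitivity (2 * p * a * x + p * (2 * c)); [ring|rewrite cE; ring].
have [xp'|px] := ltP x p.
  by rewrite ltr_pwDl ?mulr_gt0 ?mulr_ge0//; lra.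
by rewrite ltr_pwDr ?mulr_gt0 ?mulr_ge0//; lra.
Qed.

End PotentialEquations.

Theorem proposition4p2 (R : realType) (p : R)
    (G : chart -> 'rV[R]_4 -> 'M[R]_4)
    (mu : 'I_2 -> chart -> 'rV[R]_4 -> R)
    (hp : 1 <= p)
    (hG : toric_kahler_metric G)
    (hmu : moment_map G mu)
    (himage : moment_image mu = Delta p) :
  (p <= 2 ->
     forall a b c : R, admissible p a b c ->
       ckem_futaki_vanishes G mu a b c -> a = 0 /\ b = 0) /\
  (2 < p ->
     forall a b c : R, b + p * a + 2 * c = 1 ->
       b = 0 ->
       a = 0 \/ a = Num.sqrt (p - 2) / p `^ (3 / 2)
             \/ a = - (Num.sqrt (p - 2) / p `^ (3 / 2)) ->
       admissible p a b c /\ ckem_futaki_vanishes G mu a b c).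
Proof.
have p0 : 0 < p by exact: lt_le_trans hp.
split=> [p2 a b c adm|p2 a b c + b0 ha].
  have f_pos := admissible_pos p0 adm; have [_ norm] := adm.
  (* Only the test function l = f is used in this direction. *)
  move/(ckem_futaki_vanishesE p0 hG hmu himage adm)/(_ a b c).
  rewrite futaki_det_f//.
  have [A0 B0 C0 D0] := corner_gt0 p0 f_pos.
  have n0 : 12 * (c * (a * p + b + c) * ((a * p + c) * (b + c))) ^+ 3 != 0.
    by rewrite gt_eqF// mulr_gt0// exprn_gt0// !mulr_gt0.
  move/eqP; rewrite mulf_eq0 invr_eq0 (negbTE n0) orbF mulf_eq0 oppr_eq0 gt_eqF//= => /eqP E.
  have cE : 2 * c = 1 - b - p * a by move: norm; lra.
  rewrite [a * p]mulrC in B0 D0.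
  have [||||/eqP+ ->] := bracket_eq0 hp p2 _ _ _ _ E.
  - by move: A0; lra.
  - by move: B0; lra.
  - by move: C0; lra.
  - by move: D0; lra.
  - by rewrite mulf_eq0 gt_eqF//= => /eqP.
rewrite b0 add0r => norm.
have ha' : a = 0 \/ p * (p * a) ^+ 2 = p - 2.
  by case: ha => [->|/(root_sqr p2)]; [left|right].
(* Positivity of f is automatic: either a = 0, or (p a)^2 = (p - 2) / p < 1. *)
have adm : admissible p a 0 c.
  apply: admissible_first => //; case: ha' => [->|E]; first by rewrite mulr0 expr0n ltr01.
  by rewrite -(ltr_pM2l p0) E mulr1; lra.
split=> //; apply/(ckem_futaki_vanishesE p0 hG hmu himage adm) => h1 h2 h0.
exact: futaki_det_vanishes (admissible_pos p0 adm) norm ha'.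
Qed.
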